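(* Let $n\ge1$, $\mathcal T>0$, and consider the stochastic system on $\mathbb{R}^n\times\mathbb{R}^n$ $$dx_t=y_t\,dt,\qquad dy_t=-\big[C(x_t,y_t,t)\,y_t+\nabla V(x_t)+E(x_t,y_t,t)\big]\,dt+\Sigma(x_t,y_t,t)\,dB_t,$$ where $B_t$ is an $n$-dimensional Brownian motion, $V:\mathbb{R}^n\to\mathbb{R}$, $E:\mathbb{R}^n\times\mathbb{R}^n\times\mathbb{R}\to\mathbb{R}^n$ and $C,\Sigma:\mathbb{R}^n\times\mathbb{R}^n\times\mathbb{R}\to\mathbb{R}^{n\times n}$. Assume that there exist positive constants $\alpha,\beta,b,M,\epsilon,c,M_1$ with $c<1$ such that all of the following hold: (1) All coefficients of the system are continuous on their respective domains and locally Lipschitz continuous in $(x,y)$; $V\in C^2(\mathbb{R}^n)$ is bounded from below; and $C(x,y,t)$, $E(x,y,t)$, $\Sigma(x,y,t)$ are $\mathcal T$-periodic in $t$. (2) For all $(x,y,t)\in\mathbb{R}^n\times\mathbb{R}^n\times\mathbb{R}$, $$C^s(x,y,t)\ge2\alpha I_n,\qquad \max\{\|C(x,y,t)\|,\|E(x,y,t)\|\}\le\beta,$$ where $C^s(x,y,t):=\frac12\big(C(x,y,t)+C^\top(x,y,t)\big)$. (3) $$\langle x,\nabla V(x)\rangle\ge b\|x\|^{2+\epsilon}-M\qquad\forall x\in\mathbb{R}^n.$$ (4) $$\mathrm{Tr}\big[(\Sigma\Sigma^\top)(x,y,t)\big]\le c\,\alpha\big(\|y\|^2+b\|x\|^{2+\epsilon}\big)+M_1\qquad\forall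 (x,y,t)\in\mathbb{R}^n\times\mathbb{R}^n\times\mathbb{R}.$$ Then the system admits at least one $\mathcal T$-periodic probability solution.
   Context: $\|\cdot\|$ is the Euclidean norm (for matrices, the induced operator norm), $\langle\cdot,\cdot\rangle$ the Euclidean inner product, $I_n$ the $n\times n$ identity matrix, and $A\ge B$ for symmetric matrices means that $A-B$ is positive semidefinite. Periodic probability solution. For a $\mathcal T$-periodic stochastic differential equation $dZ_t=b(Z_t,t)\,dt+\sigma(Z_t,t)\,dB_t$ on $\mathbb{R}^N$, put $(a^{ij})=\frac12\sigma\sigma^{\top}$ and $\mathcal{L}\phi=\partial_t\phi+\sum_{i,j}a^{ij}\partial_{z_iz_j}\phi+\sum_ib^i\partial_{z_i}\phi$. A $\mathcal T$-periodic probability solution of the equation (equivalently, of its Fokker-Planck equation $-\partial_tp+\partial^2_{ij}(a^{ij}p)-\partial_i(b^ip)=0$) is a Borel measure $\mu$ on $\mathbb{R}^N\times\mathbb{R}$ of the form $d\mu=d\mu_t\,dt$, where $\{\mu_t\}_{t\in\mathbb{R}}$ is a family of Borel probability measures on $\mathbb{R}^N$ such that $\mu_t=\mu_{t+\mathcal T}$ for all $t\in\mathbb{R}$, $a^{ij},b^i\in L^1_{\rm loc}(\mathbb{R}^N\times\mathbb{R},d\mu_t\,dt)$ for all $i,j$, and $$\int_{\mathbb{R}}\int_{\mathbb{R}^N}\mathcal{L}\phi\,d\mu_t\,dt=0\qquad\forall\phi\in C_0^{2,1}(\mathbb{R}^N\times\mathbb{R}),$$ where $C_0^{2,1}$ denotes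 the compactly supported functions that are $C^2$ in $z$ and $C^1$ in $t$. For the system in the claim, $N=2n$, $z=(x,y)$, and $$\mathcal{L}\phi=\partial_t\phi+\tfrac12\sum_{i,j=1}^n(\Sigma\Sigma^\top)^{ij}\partial^2_{y_iy_j}\phi+\langle y,\nabla_x\phi\rangle-\langle C(x,y,t)y+\nabla V(x)+E(x,y,t),\nabla_y\phi\rangle.$$ *)

(* Defs.v *)
From HB Require Import structures.
From mathcomp Require Import all_boot all_order all_algebra.
From mathcomp Require Import all_classical all_reals all_analysis.

Set Implicit Arguments.
Unset Strict Implicit.
Unset Printing Implicit Defensive.

Import Order.TTheory GRing.Theory Num.Theory.
Import numFieldNormedType.Exports.

Local Open Scope classical_set_scope.
Local Open Scope ring_scope.

(* The library norm [`|_|] on matrices is the sup norm; it is used below only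
   through the topology and in local Lipschitz conditions, where the choice of
   norm is immaterial.  Growth conditions use the following Euclidean notions. *)

Definition dotv (R : realType) (n : nat) (u v : 'cV[R]_n) : R :=
  \sum_(i < n) u i ord0 * v i ord0.

Definition enorm (R : realType) (n : nat) (u : 'cV[R]_n) : R :=
  Num.sqrt (dotv u u).

Definition opnorm (R : realType) (m n : nat) (A : 'M[R]_(m, n)) : R :=
  sup [set enorm (A *m v) | v in [set v : 'cV[R]_n | enorm v <= 1]].

Definition psdmx (R : realType) (n : nat) (A : 'M[R]_n) : Prop :=
  A^T = A /\ forall v : 'cV[R]_n, 0 <= dotv v (A *m v).

Definition loewner_le (R : realType) (n : nat) (A B : 'M[R]_n) : Prop :=
  psdmx (B - A).

Definition sympart (R : realType) (n : nat) (A : 'M[R]_n) : 'M[R]_n :=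
  2^-1 *: (A + A^T).

Definition basisv (R : realType) (n : nat) (i : 'I_n) : 'cV[R]_n :=
  delta_mx i ord0.

Definition grad (R : realType) (n : nat) (V : 'cV[R]_n -> R) (x : 'cV[R]_n) :
    'cV[R]_n :=
  \col_i 'D_(basisv R i) V x.

(* [has_cont_deriv v f]: the derivative of [f] along [v] exists everywhere and
   is continuous. *)
Definition has_cont_deriv (R : realType) (U : normedModType R) (v : U)
    (f : U -> R) : Prop :=
  (forall p, derivable f p v) /\ continuous ('D_v f).

Definition C2 (R : realType) (n : nat) (V : 'cV[R]_n -> R) : Prop :=
  [/\ continuous V,
      forall i, has_cont_deriv (basisv R i) V &
      forall i j, has_cont_deriv (basisv R j) ('D_(basisv R i) V)].

Section SpaceTime.
Context (R : realType) (N : nat).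

Definition dirz (i : 'I_N) : 'cV[R]_N * R := (basisv R i, 0).
Definition dirt : 'cV[R]_N * R := (0, 1).

Definition C21 (phi : 'cV[R]_N * R -> R) : Prop :=
  [/\ continuous phi,
      has_cont_deriv dirt phi,
      forall i, has_cont_deriv (dirz i) phi &
      forall i j, has_cont_deriv (dirz j) ('D_(dirz i) phi)].

Definition compactly_supported (phi : 'cV[R]_N * R -> R) : Prop :=
  compact (closure [set p | phi p != 0]).

End SpaceTime.

Notation borelType T := (g_sigma_algebraType (@open T)).
Notation spacetime R N := (borelType 'cV[R]_N * measurableTypeR R)%type.

(* The stochastic differential equation dZ = b(Z,t) dt + sigma(Z,t) dB on R^N
   driven by an m-dimensional Brownian motion enters only through its
   coefficients [b] and [sigma]. *)
Section PeriodicProbabilitySolution.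
Context (R : realType) (N m : nat).
Variables (b : 'cV[R]_N -> R -> 'cV[R]_N).
Variables (sigma : 'cV[R]_N -> R -> 'M[R]_(N, m)).

Definition diffusion (z : 'cV[R]_N) (t : R) : 'M[R]_N :=
  2^-1 *: (sigma z t *m (sigma z t)^T).

(* Here a = sigma sigma^T / 2 and p = (z, t). *)
Definition generator (phi : 'cV[R]_N * R -> R) (p : 'cV[R]_N * R) : R :=
  'D_(dirt R N) phi p
  + \sum_(i < N) \sum_(j < N)
      diffusion p.1 p.2 i j * 'D_(dirz R j) ('D_(dirz R i) phi) p
  + \sum_(i < N) b p.1 p.2 i ord0 * 'D_(dirz R i) phi p.

(* [mu] is the measure [mu_ t] dt; the family must depend measurably on [t] for
   this to make sense, which is what a probability kernel provides. *)
Definition has_slices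
    (mu : {measure set (spacetime R N) -> \bar R})
    (mu_ : R.-pker (measurableTypeR R) ~> (borelType 'cV[R]_N)) : Prop :=
  forall A, measurable A ->
    mu A = (\int[@lebesgue_measure R]_t mu_ t [set z | A (z, t)])%E.

Definition L1loc (mu : {measure set (spacetime R N) -> \bar R})
    (f : 'cV[R]_N * R -> R) : Prop :=
  forall K : set ('cV[R]_N * R), compact K -> mu.-integrable K (EFin \o f).

Definition periodic_probability_solution (T : R)
    (mu : {measure set (spacetime R N) -> \bar R}) : Prop :=
  exists mu_ : R.-pker (measurableTypeR R) ~> (borelType 'cV[R]_N),
  [/\ has_slices mu mu_,
      forall t A, measurable A -> mu_ (t + T) A = mu_ t A,
      forall i j, L1loc mu (fun p => diffusion p.1 p.2 i j),
      forall i, L1loc mu (fun p => b p.1 p.2 i ord0) &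
      forall phi, C21 phi -> compactly_supported phi ->
        (\int[@lebesgue_measure R]_t
           \int[mu_ t]_z (generator phi (z, t))%:E = 0)%E].

End PeriodicProbabilitySolution.

(* Coefficients given as functions of (x, y, t) in R^n x R^n x R. *)
Section Coefficients.
Context (R : realType) (n : nat).

Definition coef_continuous (W : normedModType R)
    (f : 'cV[R]_n -> 'cV[R]_n -> R -> W) : Prop :=
  continuous (fun p : 'cV[R]_n * 'cV[R]_n * R => f p.1.1 p.1.2 p.2).

(* Lipschitz in (x, y) near every (x0, y0, t0), with the same constant for all
   t near t0. *)
Definition coef_locally_lipschitz (W : normedModType R)
    (f : 'cV[R]_n -> 'cV[R]_n -> R -> W) : Prop :=
  forall (x0 y0 : 'cV[R]_n) (t0 : R),
  exists (L : R) (U : set ('cV[R]_n * 'cV[R]_n * R)),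
    nbhs (x0, y0, t0) U /\
    forall (x y x' y' : 'cV[R]_n) (t : R), U (x, y, t) -> U (x', y', t) ->
      `|f x y t - f x' y' t| <= L * `|(x, y) - (x', y')|.

Definition coef_regular (W : normedModType R)
    (f : 'cV[R]_n -> 'cV[R]_n -> R -> W) : Prop :=
  coef_continuous f /\ coef_locally_lipschitz f.

Definition coef_periodic (W : Type) (T : R)
    (f : 'cV[R]_n -> 'cV[R]_n -> R -> W) : Prop :=
  forall x y t, f x y (t + T) = f x y t.

End Coefficients.

Lemma sys_generator_aux (R : comUnitRingType) (n : nat) (S : 'M[R]_n)
    (y w : 'cV[R]_n) (d1 : 'I_(n + n) -> R) (d2 : 'I_(n + n) -> 'I_(n + n) -> R) :
  let A : 'M[R]_(n + n, n) := col_mx 0 S in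
  \sum_(i < n + n) \sum_(j < n + n) (2^-1 *: (A *m A^T)) i j * d2 i j
  + \sum_(i < n + n) (col_mx y (- w)) i ord0 * d1 i
  = 2^-1 * (\sum_(i < n) \sum_(j < n)
        (S *m S^T) i j * d2 (rshift n i) (rshift n j))
    + \sum_(i < n) y i ord0 * d1 (lshift n i)
    - \sum_(i < n) w i ord0 * d1 (rshift n i).
Proof.
move=> A; rewrite -addrA; congr (_ + _).
  have -> : A *m A^T = block_mx 0 0 0 (S *m S^T).
    rewrite /A tr_col_mx mul_col_row trmx0 mul0mx mulmx0; congr block_mx.
    by rewrite mul0mx.
  rewrite big_split_ord /= big1 ?add0r => [|i _]; last first.
    rewrite big1// => j _; rewrite mxE /block_mx col_mxEu.
    by case: (splitP j) (splitK j) => k _ /= <-;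
      rewrite ?row_mxEl ?row_mxEr mxE mulr0 mul0r.
  rewrite mulr_sumr; apply: eq_bigr => i _.
  rewrite big_split_ord /= big1 ?add0r => [|j _]; last first.
    by rewrite mxE block_mxEdl mxE mulr0 mul0r.
  rewrite mulr_sumr; apply: eq_bigr => j _.
  by rewrite mxE block_mxEdr mulrA.
rewrite big_split_ord /= -sumrN; congr (_ + _); apply: eq_bigr => i _.
  by rewrite col_mxEu.
by rewrite col_mxEd mxE mulNr.
Qed.

(* The second-order system, written on R^(n+n) with z = (x, y). *)
Section SecondOrderSystem.
Context (R : realType) (n : nat).
Variables (V : 'cV[R]_n -> R) (E : 'cV[R]_n -> 'cV[R]_n -> R -> 'cV[R]_n).
Variables (C Sigma : 'cV[R]_n -> 'cV[R]_n -> R -> 'M[R]_n).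

Definition sys_drift (z : 'cV[R]_(n + n)) (t : R) : 'cV[R]_(n + n) :=
  let x := usubmx z in let y := dsubmx z in
  col_mx y (- (C x y t *m y + grad V x + E x y t)).

Definition sys_sigma (z : 'cV[R]_(n + n)) (t : R) : 'M[R]_(n + n, n) :=
  col_mx 0 (Sigma (usubmx z) (dsubmx z) t).

Lemma sys_generatorE (phi : 'cV[R]_(n + n) * R -> R) (x y : 'cV[R]_n) (t : R) :
  let p := (col_mx x y, t) in
  generator sys_drift sys_sigma phi p =
    'D_(dirt R (n + n)) phi p
    + 2^-1 * (\sum_(i < n) \sum_(j < n)
        (Sigma x y t *m (Sigma x y t)^T) i j
        * 'D_(dirz R (rshift n j)) ('D_(dirz R (rshift n i)) phi) p)
    + dotv y (\col_i 'D_(dirz R (lshift n i)) phi p)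
    - dotv (C x y t *m y + grad V x + E x y t)
        (\col_i 'D_(dirz R (rshift n i)) phi p).
Proof.
move=> p; rewrite /generator /diffusion /sys_drift /sys_sigma [p.1]/= [p.2]/=.
rewrite col_mxKu col_mxKd -!addrA; congr (_ + _); rewrite !addrA.
under [X in _ = _ + X - _]eq_bigr do rewrite [X in _ * X]mxE.
under [X in _ = _ - X]eq_bigr do rewrite [X in _ * X]mxE.
exact: sys_generator_aux (Sigma x y t) y (C x y t *m y + grad V x + E x y t)
  (fun i => 'D_(dirz R i) phi p)
  (fun i j => 'D_(dirz R j) ('D_(dirz R i) phi) p).
Qed.

End SecondOrderSystem.

(* Main.v *)
(* A discrete Krylov-Bogoliubov argument, with no stochastic calculus.

   An explicit Euler chain with Rademacher noise and step [T / K k] is stopped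
   from escaping by restarting it at the origin, at rate 1, outside the ball of
   radius [k]; a Lyapunov function whose generator is at most [a - W] then
   controls it.  Averaging its law over [k.+1] successive periods gives means
   that are nearly periodic, tight, and satisfy
   [a_(i+1) phi - a_i phi = h * a_i (generator phi) + o(h)] for test functions
   [phi].  An ultrafilter limit along [k] produces, for each time [t], a finitely
   additive tight mean [l_t], periodic in [t], such that [t |-> l_t (phi_t)] has
   derivative [l_t (generator phi_t)].  Tightness makes [l_t] a probability
   measure on continuous functions with bounded support, and the fundamental
   theorem of calculus gives the Fokker-Planck equation.

   For the damped system the Lyapunov function is
   [|y|^2 / 2 + V x + alpha * <x, y> + k0]: the Euler step acts exactly on its
   quadratic part, and [V] only sees the noiseless increment [h y]. *)

From HB Require Import structures.
Require Import Defs.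
From mathcomp Require Import all_boot all_order all_algebra.
From mathcomp Require Import all_classical all_reals all_analysis.
From mathcomp Require Import measurable_realfun.
From mathcomp Require Import ring lra zify.

Import Order.TTheory GRing.Theory Num.Theory.
Import numFieldNormedType.Exports.

Local Open Scope classical_set_scope.
Local Open Scope ring_scope.

Set Implicit Arguments.
Unset Strict Implicit.
Unset Printing Implicit Defensive.

(** * Positive normalized functionals and Markov chains *)

(** Where the force grows superlinearly, an explicit scheme with a fixed step need not inherit the
    drift inequality. The inequality is therefore asked only on the ball of radius [k], for a step
    chosen after the ball. The noise is bounded, so a short step moves by at most 1, and every law
    of the chain is a finite combination of point masses: its means act on all functions, with no
    measurability to check before the limit. Averages run over times congruent modulo the period,
    since averaging over all times would erase the phase. The chain starts at time [- k T], so that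
    each fixed time eventually has a full period of history. An ultrafilter yields limits for all
    times and all bounded functions at once, without a diagonal choice of subsequences. The price is
    that the limit is only finitely additive; countable additivity is recovered by coding the space
    in the unit interval. The generator of a test function is in general only continuous, so its
    mean must be shown continuous in time for merely continuous integrands; this comes from the
    density of smooth functions. *)

Section Means.
Context (R : realType) (Z : Type).
Implicit Types (l : (Z -> R) -> R) (f g : Z -> R).

(** Defined on all functions: expectations of the chain are finite convex combinations of point
    evaluations, so the unbounded Lyapunov function needs no integrability condition. *)
Definition is_mean l :=
  [/\ forall a f g, l (fun z => a * f z + g z) = a * l f + l g,
      forall f, (forall z, 0 <= f z) -> 0 <= l f &
      l (fun=> 1) = 1].

Section Theory.
Context (l : (Z -> R) -> R) (lP : is_mean l).

Lemma mean_lin a f g : l (fun z => a * f z + g z) = a * l f + l g.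
Proof. by case: lP. Qed.

Lemma mean_ge0 f : (forall z, 0 <= f z) -> 0 <= l f.
Proof. by case: lP => _ + _; apply. Qed.

Lemma meanB f g : l (fun z => f z - g z) = l f - l g.
Proof.
have -> : (fun z => f z - g z) = (fun z => -1 * g z + f z).
  by apply/funext => z; ring.
by rewrite mean_lin; ring.
Qed.

Lemma mean0 : l (fun=> 0) = 0.
Proof. by rewrite (_ : (fun=> 0) = (fun z : Z => 1 - 1 : R)) ?meanB ?subrr//; apply/funext => z; rewrite subrr. Qed.

Lemma meanZ a f : l (fun z => a * f z) = a * l f.
Proof.
have := mean_lin a f (fun=> 0); rewrite mean0 addr0 => <-.
by congr l; apply/funext => z; rewrite addr0.
Qed.

Lemma meanD f g : l (fun z => f z + g z) = l f + l g.
Proof.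
by rewrite -[l f]mul1r -mean_lin; congr l; apply/funext => z; rewrite mul1r.
Qed.

Lemma mean_sum (I : Type) (r : seq I) (F : I -> Z -> R) :
  l (fun z => \sum_(i <- r) F i z) = \sum_(i <- r) l (F i).
Proof.
elim: r => [|i r IH].
  by rewrite big_nil -[RHS]mean0; congr l; apply/funext => z; rewrite big_nil.
by rewrite big_cons -IH -meanD; congr l; apply/funext => z; rewrite big_cons.
Qed.

Lemma mean_cst a : l (fun=> a) = a.
Proof.
have -> : (fun=> a) = (fun z : Z => a * 1) by apply/funext => z; rewrite mulr1.
by rewrite meanZ; case: lP => _ _ ->; rewrite mulr1.
Qed.

Lemma mean_le f g : (forall z, f z <= g z) -> l f <= l g.
Proof.
by move=> fg; rewrite -subr_ge0 -meanB mean_ge0// => z; rewrite subr_ge0.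
Qed.

Lemma mean_dist f g q : (forall z, `|f z - g z| <= q z) -> `|l f - l g| <= l q.
Proof.
move=> fgq; rewrite -meanB ler_norml; apply/andP; split.
  rewrite -mulN1r -meanZ; apply: mean_le => z.
  by rewrite mulN1r; have := fgq z; rewrite ler_norml => /andP[].
by apply: mean_le => z; rewrite (le_trans _ (fgq z))// ler_norm.
Qed.

Lemma mean_norm f q : (forall z, `|f z| <= q z) -> `|l f| <= l q.
Proof.
move=> fq; have := @mean_dist f (fun=> 0) q.
by rewrite mean0 subr0; apply => z; rewrite subr0.
Qed.

Lemma mean_bnd f B : (forall z, `|f z| <= B) -> `|l f| <= B.
Proof. by move=> fB; rewrite -[leRHS]mean_cst mean_norm. Qed.

End Theory.

Lemma mean_point z0 : is_mean (fun f => f z0).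
Proof. by split. Qed.

Lemma mean_average (I : finType) (L : I -> (Z -> R) -> R) : (0 < #|I|)%N ->
  (forall i, is_mean (L i)) ->
  is_mean (fun f => #|I|%:R^-1 * \sum_i L i f).
Proof.
move=> I0 LP; have I0' : #|I|%:R != 0 :> R by rewrite pnatr_eq0 -lt0n.
split=> [a f g|f f0|].
- under eq_bigr do rewrite mean_lin//.
  by rewrite big_split -mulr_sumr /=; ring.
- by rewrite mulr_ge0 ?invr_ge0// sumr_ge0// => i _; exact: mean_ge0.
- under eq_bigr do rewrite mean_cst//.
  by rewrite sumr_const mulVf.
Qed.

Lemma mean_mix l l' (p : R) : 0 <= p <= 1 -> is_mean l -> is_mean l' ->
  is_mean (fun f => (1 - p) * l f + p * l' f).
Proof.
move=> /andP[p0 p1] lP lP'; split=> [a f g|f f0|].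
- by rewrite !mean_lin//; ring.
- by rewrite addr_ge0// mulr_ge0 ?subr_ge0 ?mean_ge0.
- by rewrite !mean_cst//; ring.
Qed.

Definition is_markov (P : (Z -> R) -> Z -> R) := forall z, is_mean (P ^~ z).

Lemma mean_markov l P : is_mean l -> is_markov P -> is_mean (fun f => l (P f)).
Proof.
move=> lP PP; split=> [a f g|f f0|].
- rewrite -mean_lin//; congr l; apply/funext => z.
  exact: (mean_lin (PP z)).
- by apply: mean_ge0 => // z; exact: (mean_ge0 (PP z)).
- rewrite -[RHS](mean_cst lP); congr l; apply/funext => z.
  exact: (mean_cst (PP z)).
Qed.

End Means.

(** * Phase averages of a periodic Markov chain and their Lyapunov bounds *)

Section Chain.
Context (R : realType) (Z : Type) (z0 : Z) (P : nat -> (Z -> R) -> Z -> R).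
Hypothesis PP : forall i, is_markov (P i).

(** [P i f z] is the expected value of [f] after step [i] from [z]. The recursion pulls [f] back
    through the latest step. *)
Fixpoint expect i f := if i is i'.+1 then expect i' (P i' f) else f z0.

Lemma expect_mean i : is_mean (expect i).
Proof.
elim: i => [|i IH]; first exact: mean_point.
exact: (mean_markov IH (PP i)).
Qed.

Context (K m : nat).
Hypotheses (m0 : (0 < m)%N) (PK : forall i, P (i + K) = P i).

(** A Cesaro mean over times of equal phase: it becomes nearly periodic as [m] grows, while each
    phase keeps its own law. *)
Definition avg i f := m%:R^-1 * \sum_(j < m) expect (i + j * K) f.

Lemma avg_mean i : is_mean (avg i).
Proof.
have := @mean_average R Z 'I_m (fun j => expect (i + j * K)).
by rewrite card_ord; apply => // j; exact: expect_mean.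
Qed.

Lemma P_period i j : P (i + j * K) = P i.
Proof. by elim: j => [|j IH]; rewrite ?addn0// mulSn addnCA addnC PK. Qed.

Lemma avgS i f : avg i.+1 f = avg i (P i f).
Proof.
by congr (_ * _); apply: eq_bigr => j _; rewrite addSn /= P_period.
Qed.

(** The sum over periods telescopes: only the laws at the two ends survive, each contributing at
    most [B], and [m] divides them. *)
Lemma avg_shift i f B : (forall z, `|f z| <= B) ->
  `|avg (i + K) f - avg i f| <= 2 * B / m%:R.
Proof.
move=> fB; have -> : avg (i + K) f - avg i f =
    m%:R^-1 * (expect (i + m * K) f - expect i f).
  rewrite -mulrBr -sumrB; congr (_ * _).
  pose u j := expect (i + j * K) f.
  have -> : expect (i + m * K) f - expect i f = u m - u 0%N.
    by rewrite /u mul0n addn0.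
  rewrite -(telescope_sumr u)// big_mkord; apply: eq_bigr => j _.
  by rewrite /u mulSn addnA.
rewrite normrM ger0_norm ?invr_ge0// mulrC ler_wpM2r ?invr_ge0//.
rewrite (le_trans (ler_normB _ _))// mulrDl mul1r lerD//.
  exact: (mean_bnd (expect_mean _)).
exact: (mean_bnd (expect_mean _)).
Qed.

Context (h A : R) (U W : Z -> R).
Hypotheses (h0 : 0 <= h) (A0 : 0 <= A)
  (W0 : forall z, 0 <= W z) (WU : forall z, W z <= U z)
  (PU : forall i z, P i U z <= U z + h * (A - W z)).

(** A discrete Dynkin formula: the expectation of [U] changes by at most [h * (A - W)] in mean per
    step. Summing, and discarding the final value of [U], which is nonnegative, bounds the
    occupation sum of [W]. *)
Lemma sum_expect I :
  h * \sum_(i < I) expect i W <= U z0 + h * A * I%:R.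
Proof.
suff H : expect I U + h * \sum_(i < I) expect i W <= U z0 + h * A * I%:R.
  apply: le_trans H; rewrite lerDr; apply: (mean_ge0 (expect_mean I)) => z.
  exact: le_trans (WU z).
elim: I => [|I IH]; first by rewrite big_ord0 !mulr0 !addr0.
rewrite big_ord_recr /= mulrDr -natr1 mulrDr mulr1.
have : expect I (P I U) <= expect I U + h * A - h * expect I W.
  have -> : expect I U + h * A - h * expect I W =
      expect I (fun z => U z + h * (A - W z)).
    have -> : (fun z => U z + h * (A - W z)) =
      (fun z => (U z + h * A) - h * W z) by apply/funext => z; ring.
    rewrite (meanB (expect_mean I)) (meanD (expect_mean I)).
    by rewrite (mean_cst (expect_mean I)) (meanZ (expect_mean I)).
  exact: (mean_le (expect_mean I)).
by move: IH; lra.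
Qed.

(** The [K] phases over [m] periods enumerate [m * K] consecutive times, so the occupation bound
    applies; the division by [m] also damps the initial value [U z0]. *)
Lemma avg_window i0 :
  h * \sum_(i < K) avg (i0 + i) W <= (U z0 + h * A * (i0 + m * K)%:R) / m%:R.
Proof.
rewrite ler_pdivlMr ?ltr0n//.
have -> : h * (\sum_(i < K) avg (i0 + i) W) * m%:R =
    h * \sum_(i < K) \sum_(j < m) expect (i0 + i + j * K) W.
  rewrite -mulrA mulr_suml; congr (_ * _); apply: eq_bigr => i _.
  by rewrite mulrAC mulVf ?mul1r// pnatr_eq0 -lt0n.
apply: le_trans (sum_expect _).
(* The occupation bound counts from time 0; the first [i0] terms are nonnegative and can be
   added. *)
rewrite ler_wpM2l// exchange_big /= big_split_ord /= addrC.
rewrite -[leLHS]addr0 lerD//; last first.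
  by apply: sumr_ge0 => i _; exact: (mean_ge0 (expect_mean _)).
rewrite -[leRHS](big_mkord xpredT (fun i => expect (i0 + i) W)).
clear; elim: m => [|k IH]; first by rewrite mul0n big_ord0 big_nil.
rewrite big_ord_recr mulSn addnC (@big_cat_nat _ _ _ (k * K))//=; last first.
  exact: leq_addr.
rewrite lerD// -[X in index_iota X _]add0n big_addn addKn big_mkord.
by apply: ler_sum => i _; rewrite addnA.

Qed.

(** A Markov operator sends [min U r] below both the image of [U] and [r]. Where [U <= r] the drift
    adds at most [h * A]; elsewhere the cap itself prevents any growth. *)
Lemma avg_cap i d r : 0 <= r ->
  avg (i + d) (fun z => Num.min (U z) r) <=
  avg i (fun z => Num.min (U z) r) + h * A * d%:R.
Proof.
move=> r0; elim: d => [|d IH]; first by rewrite addn0 mulr0 addr0.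
rewrite addnS avgS -natr1 mulrDr mulr1 addrA.
apply: le_trans (lerD IH (lexx _)).
rewrite -[leRHS](_ : avg (i + d) (fun z => Num.min (U z) r + h * A) = _).
  apply: (mean_le (avg_mean _)) => z.
  have hA : 0 <= h * A by rewrite mulr_ge0.
  have [Ur|Ur] := leP (U z) r.
    have : P (i + d) (fun z => Num.min (U z) r) z <= P (i + d) U z.
      by apply: (mean_le (PP _ _)) => x; rewrite ge_min lexx.
    have := PU (i + d) z; have : 0 <= h * W z by rewrite mulr_ge0.
    by lra.
  have : P (i + d) (fun z => Num.min (U z) r) z <= r.
    rewrite -[leRHS](mean_cst (PP (i + d) z)).
    by apply: (mean_le (PP _ _)) => x; rewrite ge_min lexx orbT.
  by lra.
by rewrite (meanD (avg_mean _)) (mean_cst (avg_mean _)).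
Qed.

(* A Markov operator contracts the concave cap [min U r], so that the cap at
   time [i] is controlled by its mean over the preceding period. *)
Lemma avg_tight i r w S : (K <= i)%N -> 0 <= r -> 0 < w -> 0 <= S ->
  (forall z, W z <= w -> U z <= S) ->
  h * K%:R * avg i (fun z => Num.min (U z) r) <=
  A * (h * K%:R) ^+ 2 + h * K%:R * S +
  r / w * ((U z0 + h * A * (i + m * K)%:R) / m%:R).
Proof.
move=> Ki r0 w0 S0 WS.
pose f z := Num.min (U z) r.
have H : h * \sum_(j < K) (avg i f) <=
    h * \sum_(j < K) (A * (h * K%:R) + S + r / w * avg (i - K + j) W).
  rewrite ler_wpM2l//; apply: ler_sum => j _.
  (* Each of the [K] times of the preceding period lies [K - j] steps before [i], so moving the cap
     back to it costs at most [h * A * K]. *)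
  have -> : i = (i - K + j + (K - j))%N by have := ltn_ord j; lia.
  apply: (le_trans (avg_cap _ _ r0)).
  have -> : (i - K + j + (K - j) - K + j = i - K + j)%N.
    by have := ltn_ord j; lia.
  have : h * A * (K - j)%:R <= A * (h * K%:R).
    by rewrite mulrA [A * h]mulrC ler_wpM2l ?mulr_ge0// ler_nat leq_subr.
  suff : avg (i - K + j) f <= S + r / w * avg (i - K + j) W by rewrite /f; lra.
  rewrite -(mean_cst (avg_mean (i - K + j)) S) -(meanZ (avg_mean _)).
  rewrite -(meanD (avg_mean _)).
  apply: (mean_le (avg_mean _)) => z; rewrite /f.
  have rw : 0 <= r / w by rewrite divr_ge0// ltW.
  (* Where [W <= w] the cap is at most [S]; elsewhere it is at most [r <= r / w * W], as in Markov's
     inequality. *)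
  have [/WS US|wW] := leP (W z) w.
    rewrite ge_min (le_trans US)// lerDl mulr_ge0//.
  rewrite ge_min; apply/orP; right.
  rewrite -[leLHS]add0r lerD// mulrAC ler_pdivlMr// ler_wpM2l// ltW//.
move: H; rewrite sumr_const card_ord big_split /= sumr_const card_ord -mulr_sumr.
rewrite -[X in h * X <= _]mulr_natr -[X in _ <= h * (X + _)]mulr_natr => H.
have := avg_window (i - K).
have : (U z0 + h * A * (i - K + m * K)%:R) / m%:R <=
       (U z0 + h * A * (i + m * K)%:R) / m%:R.
  rewrite ler_wpM2r ?invr_ge0// lerD2l ler_wpM2l ?mulr_ge0// ler_nat.
  by rewrite leq_add2r leq_subr.
move=> /[swap]/le_trans/[apply] /(ler_wpM2l (_ : 0 <= r / w)).
move=> /(_ (divr_ge0 r0 (ltW w0))).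
by move: H; rewrite /f; lra.
Qed.

End Chain.

(** * Calculus on column vectors *)

Lemma finite_pos_lower_bound (R : realType) (I : finType) (d : I -> R) :
  (forall i, 0 < d i) -> exists2 e, 0 < e & forall i, e <= d i.
Proof.
move=> d0; exists (\big[Num.min/1]_i d i).
  by elim/big_ind: _ => // x y x0 y0; rewrite lt_min x0.
by move=> i; rewrite (bigD1 i)//= ge_min lexx.
Qed.

Section Columns.
Context (R : realType) (N : nat).
Implicit Types v : 'cV[R]_N.

Lemma cV_norm_le v (B : R) : 0 <= B -> (`|v| <= B) = [forall i, `|v i ord0| <= B].
Proof.
move=> B0; rewrite [`|v|]/Num.Def.normr /= mx_normrE; apply/idP/forallP => [H i|H].
  by move/bigmax_leP : H => [_ /(_ (i, ord0))]; exact.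
by apply/bigmax_leP; split => // -[i j] _ /=; rewrite ord1.
Qed.

Lemma cV_norm_lt v (B : R) : 0 < B -> (`|v| < B) = [forall i, `|v i ord0| < B].
Proof.
move=> B0; rewrite [`|v|]/Num.Def.normr /= mx_normrE; apply/idP/forallP => [H i|H].
  by move/bigmax_ltP : H => [_ /(_ (i, ord0))]; exact.
by apply/bigmax_ltP; split => // -[i j] _ /=; rewrite ord1.
Qed.

Lemma cV_entry_le v i : `|v i ord0| <= `|v|.
Proof. by have := lexx `|v|; rewrite {1}cV_norm_le// => /forallP. Qed.

Lemma cV_entry_continuous i : continuous (fun v => v i ord0).
Proof.
by move=> v; exact: coord_continuous.
Qed.

(** Compactness of closed bounded sets of row vectors is carried over by transposition, which is
    continuous and does not increase the sup norm. *)
Lemma cV_closed_ball_compact (rho : R) : compact [set v : 'cV[R]_N | `|v| <= rho].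
Proof.
have rcpt : compact [set w : 'rV[R]_N | `|w| <= rho].
  apply: bounded_closed_compact.
    by exists rho; split => [|x rx w /= /le_trans]; [exact: num_real|apply; exact: ltW].
  rewrite [X in closed X](_ : _ = (fun w => `|w|) @^-1` [set x | x <= rho])//.
  by apply: preimage_closed; [move=> x _; exact: norm_continuous|exact: closed_le].
have -> : [set v : 'cV[R]_N | `|v| <= rho] = trmx @` [set w : 'rV[R]_N | `|w| <= rho].
  have trn p q (w : 'M[R]_(p, q)) : `|w^T| <= `|w|.
    rewrite [leLHS]/Num.Def.normr /= mx_normrE; apply/bigmax_leP; split => // -[i j] _ /=.
    rewrite mxE [leRHS]/Num.Def.normr /= mx_normrE.
    by apply/bigmax_geP; right => /=; exists (j, i).
  apply/seteqP; split => [v /= vr|_ [w /= wr <-]].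
    by exists v^T => /=; rewrite ?trmxK// (le_trans (trn _ _ _)).
  exact: le_trans (trn _ _ _) wr.
apply: continuous_compact => //; apply: continuous_subspaceT => w.
have Fw : Filter (nbhs w) by exact: nbhs_filter.
apply/(cvg_ballP (F := trmx @ nbhs w)) => e e0.
have : nbhs w (ball w e) by exact: nbhsx_ballx.
by apply: filterS => w' [_ H]; split => // i j; rewrite !mxE; exact: H.
Qed.

Lemma spacetime_box_compact (rho tau : R) :
  compact [set p : 'cV[R]_N * R | `|p.1| <= rho /\ `|p.2| <= tau].
Proof.
have -> : [set p : 'cV[R]_N * R | `|p.1| <= rho /\ `|p.2| <= tau] =
    [set v : 'cV[R]_N | `|v| <= rho] `*` `[- tau, tau].
  by apply/seteqP; split => -[v t] /=; rewrite in_itv/= ler_norml.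
by apply: compact_setX; [exact: cV_closed_ball_compact|exact: segment_compact].
Qed.

End Columns.

Section CompactUniformity.
Context (R : realType) (X : normedModType R).

Lemma epsilon_delta_continuous (f : X -> R) :
  (forall p e, 0 < e ->
     exists2 d, 0 < d & forall q, `|q - p| < d -> `|f q - f p| <= e) ->
  continuous f.
Proof.
move=> H p; apply/cvgrPdist_le => e /(H p)[d d0 dP].
near=> q; rewrite distrC; apply: dP; rewrite distrC.
by near: q; exact: cvgr_dist_lt.
Unshelve. all: by end_near. Qed.

Lemma continuous_epsilon_delta (f : X -> R) p e : {for p, continuous f} -> 0 < e ->
  exists2 d, 0 < d & forall q, `|q - p| < d -> `|f q - f p| < e.
Proof.
move=> /cvgrPdist_lt/(_ e) + e0 => /(_ e0)/nbhs_ballP[d /= d0 H].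
by exists d => // q qp; rewrite distrC; apply: H; rewrite -ball_normE /= distrC.
Qed.

(** Only [p] is confined to the compact set: in the applications [q] is a perturbation of [p] that
    may leave it. *)
Lemma compact_unif_cont (D : set X) (f : X -> R) (e : R) :
  compact D -> continuous f -> 0 < e ->
  exists2 d, 0 < d & forall p q, D p -> `|p - q| < d -> `|f p - f q| < e.
Proof.
move=> /compact_near_coveringP cD cf e0.
have : forall p, D p ->
  \forall p' \near p & d \near 0^'+, forall q, `|p' - q| < d -> `|f p' - f q| < e.
  move=> p Dp.
  have /cvgrPdist_lt/(_ (e / 2)) := cf p.
  rewrite divr_gt0// => /(_ isT) /nbhs_ballP[r /= r0 H].
  near=> p' d => q p'q.
  have p'r : `|p - p'| < r / 2.
    by near: p'; apply: cvgr_dist_lt => //; rewrite divr_gt0.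
  have dr : d < r / 2 by near: d; apply: nbhs_right_lt; rewrite divr_gt0.
  have pr : ball p r p'.
    by rewrite -ball_normE /=; apply: lt_trans p'r _; rewrite ltr_pdivrMr// ltr_pMr// ltr1n.
  have qr : ball p r q.
    rewrite -ball_normE /= -(subrKA p') (le_lt_trans (ler_normD _ _))//.
    by rewrite (splitr r) ltrD// (lt_trans p'q).
  rewrite -(subrKA (f p)) (le_lt_trans (ler_normD _ _))// (splitr e) ltrD//.
    by rewrite distrC; exact: H pr.
  exact: H qr.
move=> H; have {}H := cD _ _ _ (at_right_proper_filter 0) H.
have [d [d0 dH]] := filter_ex (filterI (nbhs_right_gt 0) H).
by exists d => // p q Dp; exact: dH.
Unshelve. all: by end_near. Qed.

End CompactUniformity.

Section LineDerivative.
Context (R : realType) (X : normedModType R).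
Implicit Types (f : X -> R) (q v : X).

Lemma is_derive_line f q v r : derivable f (q + r *: v) v ->
  is_derive r (1 : R) (fun a => f (q + a *: v)) ('D_v f (q + r *: v)).
Proof.
have E : (fun h : R => h^-1 *: (((fun a : R => f (q + a *: v)) \o shift r) (h *: 1)
      - f (q + r *: v))) =
    (fun h : R => h^-1 *: ((f \o shift (q + r *: v)) (h *: v) - f (q + r *: v))).
  apply/funext => h /=; congr (_ *: (f _ - _)).
  by rewrite [h *: 1]mulr1 scalerDl addrCA.
by move=> fv; split; rewrite /derivable /derive /= ?E.
Qed.

Lemma mvt_line f q v (a : R) : (forall p, derivable f p v) ->
  exists2 c, `|c| <= `|a| & f (q + a *: v) - f q = a * 'D_v f (q + c *: v).
Proof.
move=> fv.
have D r : is_derive r (1 : R) (fun a => f (q + a *: v)) ('D_v f (q + r *: v)).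
  by apply: is_derive_line; exact: fv.
have cont x y : {within `[x, y], continuous (fun a => f (q + a *: v))}.
  apply: continuous_subspaceT => r; apply: differentiable_continuous.
  by apply/derivable1_diffP; case: (D r).
have [a0|a0] := leP 0 a.
  have [c] := MVT_segment a0 (fun x _ => D x) (cont 0 a).
  rewrite in_itv/= => /andP[c0 ca]; rewrite scale0r addr0 subr0 mulrC => ->.
  by exists c => //; rewrite !ger0_norm.
have [c] := MVT_segment (ltW a0) (fun x _ => D x) (cont a 0).
rewrite in_itv/= => /andP[ac c0]; rewrite scale0r addr0 sub0r => H.
exists c; last by rewrite -opprB H; ring.
by rewrite !ler0_norm ?lerN2// ltW.
Qed.

End LineDerivative.

(** * Differentiability and Taylor expansion from continuous partial derivatives *)

Section Partials.
Context (R : realType) (N : nat) (f : 'cV[R]_N -> R).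
Hypothesis fC1 : forall i, has_cont_deriv (basisv R i) f.
Implicit Types p v : 'cV[R]_N.

Local Notation "'d_ i" := ('D_(basisv R i) f) (at level 8, i at level 2).

(** A staircase argument: [part k] keeps the first [k] coordinates of [v], each stair is a
    one-dimensional mean value theorem, and continuity of the partials at [p] replaces the
    intermediate points by [p]. *)
Lemma partials_differential p (e : R) : 0 < e -> exists2 d, 0 < d &
  forall v, `|v| < d -> `|f (p + v) - f p - \sum_i v i ord0 * 'd_i p| <= e * `|v|.
Proof.
(* Each of the [N] stairs contributes at most [e' * |v|]; dividing by the successor keeps [e']
   positive when [N = 0]. *)
move=> e0; pose e' := e / N.+1%:R; have e'0 : 0 < e' by rewrite divr_gt0.
have [d d0 dP] : exists2 d, 0 < d &
    forall i v, `|v| < d -> `|'d_i (p + v) - 'd_i p| < e'.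
  have /choice[d dP] : forall i, exists d, 0 < d /\
      forall v, `|v| < d -> `|'d_i (p + v) - 'd_i p| < e'.
    move=> i; have /cvgrPdist_lt/(_ _ e'0)/nbhs_ballP[r /= r0 H] := (fC1 i).2 p.
    exists r; split => // v vr; rewrite distrC; apply: H.
    by rewrite -ball_normE /= opprD addNKr normrN.
  have [r r0 rd] := finite_pos_lower_bound (fun i => (dP i).1).
  by exists r => // i v vd; apply: (dP i).2; exact: lt_le_trans vd (rd i).
exists d => // v vd.
pose part k : 'cV[R]_N := \col_i (if (i < k)%N then v i ord0 else 0).
have partv k : `|part k| <= `|v|.
  rewrite cV_norm_le//; apply/forallP => i; rewrite mxE.
  by case: ifP => _; rewrite ?cV_entry_le ?normr0.
have partS (k : 'I_N) : part k.+1 = part k + v k ord0 *: basisv R k.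
  apply/colP => i; rewrite !mxE eqxx andbT ltnS leq_eqVlt.
  have [->|ik] := eqVneq i k; first by rewrite eqxx ltnn add0r mulr1.
  by rewrite (_ : (_ == _) = false) ?mulr0 ?addr0//; exact: negbTE.
have -> : f (p + v) - f p = \sum_(k < N) (f (p + part k.+1) - f (p + part k)).
  pose u k := f (p + part k).
  rewrite -(big_mkord xpredT (fun k => u k.+1 - u k)) telescope_sumr//.
  congr (f (p + _) - f _).
    by apply/colP => i; rewrite mxE ltn_ord.
  by rewrite -[LHS]addr0; congr (_ + _); apply/colP => i; rewrite !mxE.
rewrite -sumrB; apply: le_trans (ler_norm_sum _ _ _) _.
have step (k : 'I_N) : `|f (p + part k.+1) - f (p + part k) - v k ord0 * 'd_k p|
    <= e' * `|v|.
  rewrite partS addrA.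
  have [c cv ->] := mvt_line (p + part k) (v k ord0) (fC1 k).1.
  rewrite -mulrBr normrM mulrC ler_pM ?cV_entry_le// -addrA ltW// dP//.
  apply: le_lt_trans vd; rewrite cV_norm_le//; apply/forallP => i.
  rewrite !mxE eqxx andbT; have [->|ik] := eqVneq i k.
    by rewrite ltnn add0r mulr1 (le_trans cv)// cV_entry_le.
  rewrite mulr0 addr0; case: ifP => _; last by rewrite normr0.
  exact: cV_entry_le.
apply: le_trans (ler_sum _ (fun k _ => step k)) _.
rewrite sumr_const card_ord -[leLHS]mulr_natr mulrAC ler_wpM2r//.
by rewrite mulrAC ler_pdivrMr// ler_wpM2l ?ler_nat// ltW.
Qed.

Lemma derive_partials p v :
  derivable f p v /\ 'D_v f p = \sum_i v i ord0 * 'd_i p.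
Proof.
suff H : (fun h => h^-1 *: ((f \o shift p) (h *: v) - f p)) @ 0^' -->
    \sum_i v i ord0 * 'd_i p.
  split; first by apply/cvg_ex; eexists; exact: H.
  exact: cvg_lim H.
apply/cvgrPdist_le => e e0.
have e'0 : 0 < e / (`|v| + 1) by rewrite divr_gt0// ltr_wpDl.
have [d d0 dP] := partials_differential p e'0.
near=> h.
have h0 : h != 0 by near: h; exact: nbhs_dnbhs_neq.
have hd : `|h *: v| < d.
  rewrite normrZ; apply: (@le_lt_trans _ _ (`|h| * (`|v| + 1))).
    by rewrite ler_wpM2l// lerDl.
  rewrite -ltr_pdivlMr ?ltr_wpDl//.
  near: h; apply: dnbhs0_lt; by rewrite divr_gt0// ltr_wpDl.
have H := dP _ hd.
rewrite distrC /= [h *: v + p]addrC.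
rewrite (_ : _ - _ = h^-1 * (f (p + h *: v) - f p - \sum_i (h *: v) i ord0 * 'd_i p)).
  rewrite normrM normfV mulrC ler_pdivrMr ?normr_gt0//.
  apply: le_trans H _; rewrite normrZ mulrCA mulrC ler_wpM2r//.
  by rewrite mulrAC ler_pdivrMr ?ltr_wpDl// ler_wpM2l ?(ltW e0)// lerDl.
rewrite [in RHS]mulrBr; congr (_ - _); rewrite mulr_sumr; apply: eq_bigr => i _.
by rewrite mxE mulrA mulrA mulVf// mul1r.
Unshelve. all: by end_near. Qed.

End Partials.

Section Taylor.
Context (R : realType) (N : nat) (f : 'cV[R]_N -> R).
Hypothesis fC1 : forall i, has_cont_deriv (basisv R i) f.
Hypothesis fC2 : forall i j, has_cont_deriv (basisv R j) ('D_(basisv R i) f).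

Local Notation "'d_ i" := ('D_(basisv R i) f) (at level 8, i at level 2).
Local Notation "'dd_ ( i , j )" := ('D_(basisv R j) ('D_(basisv R i) f)) (at level 8).

(** The mean value theorem is used twice on the segment: for [g2], the restriction of [f] minus its
    quadratic part, then for [g1]. The remainder is [c * (q2 c' - q2 0)], so only the oscillation of
    the second derivatives enters and no third derivative is required. *)
Lemma taylor2 (p v : 'cV[R]_N) (e : R) : 0 <= e ->
  (forall c i j, 0 <= c <= 1 -> `|'dd_(i, j) (p + c *: v) - 'dd_(i, j) p| <= e) ->
  `|f (p + v) - f p - \sum_i v i ord0 * 'd_i p
     - 2^-1 * \sum_i \sum_j v i ord0 * v j ord0 * 'dd_(i, j) p|
  <= e * (N%:R * `|v|) ^+ 2.
Proof.
move=> e0 He.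
pose q1 := \sum_i v i ord0 * 'd_i p.
pose q2 c := \sum_i \sum_j v i ord0 * v j ord0 * 'dd_(i, j) (p + c *: v).
pose g1 c := \sum_i v i ord0 * 'd_i (p + c *: v).
have Dg r : is_derive r (1 : R) (fun a => f (p + a *: v)) (g1 r).
  have [fv Dv] := derive_partials fC1 (p + r *: v) v.
  by rewrite /g1 -Dv; exact: is_derive_line.
have Dg1 r : is_derive r (1 : R) g1 (q2 r).
  have -> : g1 = \sum_i (fun c => v i ord0 *: 'd_i (p + c *: v)).
    by apply/funext => c; rewrite fct_sumE.
  have -> : q2 r = \sum_i v i ord0 *: (\sum_j v j ord0 * 'dd_(i, j) (p + r *: v)).
    by apply: eq_bigr => i _; rewrite [RHS]mulr_sumr; apply: eq_bigr => j _; rewrite mulrA.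
  apply: is_derive_sum => i; apply: is_deriveZ.
  have [fv Dv] := derive_partials (fC2 i) (p + r *: v) v.
  by rewrite -Dv; exact: is_derive_line.
have cont (g g' : R -> R) : (forall r, is_derive r (1 : R) g (g' r)) ->
    forall x y, {within `[x, y], continuous g}.
  move=> H x y; apply: continuous_subspaceT => r; apply: differentiable_continuous.
  by apply/derivable1_diffP; case: (H r).
have q2b c : 0 <= c <= 1 -> `|q2 c - q2 0| <= e * (N%:R * `|v|) ^+ 2.
  move=> c01; rewrite /q2 -sumrB.
  apply: le_trans (ler_norm_sum _ _ _) _.
  apply: (@le_trans _ _ (\sum_(i < N) \sum_(j < N) (e * `|v| ^+ 2))).
    apply: ler_sum => i _; rewrite -sumrB.
    apply: le_trans (ler_norm_sum _ _ _) _; apply: ler_sum => j _.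
    rewrite -mulrBr normrM mulrC scale0r addr0 ler_pM// ?He//.
    by rewrite normrM expr2 ler_pM ?cV_entry_le.
  by rewrite !sumr_const !card_ord -[leLHS]mulr_natr -[X in X * _]mulr_natr exprMn; lra.
pose g2 (c : R) : R := f (p + c *: v) - c * q1 - 2^-1 * c ^+ 2 * q2 0.
pose g2' (c : R) : R := g1 c - q1 - c * q2 0.
have Dg2 r : is_derive r (1 : R) g2 (g2' r).
  have -> : g2 = (fun a => f (p + a *: v)) - q1 *: id - (2^-1 * q2 0) *: (id ^+ 2).
    by apply/funext => c; rewrite /g2 !fctE /= -[_ *: c]/(_ * c) -[_ *: (c ^+ 2)]/(_ * _); ring.
  apply: is_derive_eq; rewrite /g2' /GRing.scale /= expr1; by field.
have [c] := MVT_segment (ler01 : (0 : R) <= 1) (fun x _ => Dg2 x) (cont _ _ Dg2 0 1).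
rewrite in_itv/= => /andP[c0 c1]; rewrite subr0 mulr1 => H.
have [c' c'c E] := MVT_segment c0 (fun x _ => Dg1 x) (cont _ _ Dg1 0 c).
move: c'c; rewrite in_itv/= => /andP[c'0 c'c].
have {}E : g1 c - q1 = c * q2 c'.
  by move: E; rewrite subr0 [RHS]mulrC /g1 scale0r addr0.
have -> : \sum_i \sum_j v i ord0 * v j ord0 * 'dd_(i, j) p = q2 0.
  by rewrite /q2 scale0r addr0.
rewrite -/q1.
have -> : f (p + v) - f p - q1 - 2^-1 * q2 0 = c * (q2 c' - q2 0).
  move: H; rewrite /g2 /g2' E scale1r scale0r addr0 => H.
  by rewrite mulrBr -H; ring.
rewrite normrM ger0_norm// (le_trans _ (q2b c' _))//; last first.
  by rewrite c'0 (le_trans c'c).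
by rewrite ler_piMl.
Qed.

End Taylor.

(** * The Euler scheme with Rademacher noise *)

Section SpaceTimeSlices.
Context (R : realType) (N : nat).
Implicit Types (phi : 'cV[R]_N * R -> R) (z : 'cV[R]_N).

Lemma slice_quotient phi z s (v : 'cV[R]_N) :
  (fun h : R => h^-1 *: ((phi \o shift (z, s)) (h *: ((v, 0) : 'cV[R]_N * R)) - phi (z, s))) =
  (fun h : R => h^-1 *: (((fun z => phi (z, s)) \o shift z) (h *: v) - phi (z, s))).
Proof.
apply/funext => h /=; congr (_ *: (phi _ - _)).
by congr pair; rewrite /= scaler0 add0r.
Qed.

Lemma slice_derivable phi z s i : derivable phi (z, s) (dirz R i) ->
  derivable (fun z => phi (z, s)) z (basisv R i).
Proof. by rewrite /derivable slice_quotient. Qed.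

Lemma slice_derive phi z s i :
  'D_(basisv R i) (fun z => phi (z, s)) z = 'D_(dirz R i) phi (z, s).
Proof. by rewrite /derive slice_quotient. Qed.

Lemma slice_continuous phi s : continuous phi -> continuous (fun z => phi (z, s)).
Proof.
move=> cphi; apply: epsilon_delta_continuous => z e e0.
have [d d0 dP] := continuous_epsilon_delta (cphi (z, s)) e0.
exists d => // q qz; apply/ltW/dP.
by rewrite prod_normE /= subrr normr0 gt_max qz.
Qed.

Lemma slice_cont_deriv phi s i : has_cont_deriv (dirz R i) phi ->
  has_cont_deriv (basisv R i) (fun z => phi (z, s)).
Proof.
move=> [dphi cphi]; split=> [z|]; first exact: slice_derivable.
rewrite (_ : 'D_(basisv R i) _ = (fun z => 'D_(dirz R i) phi (z, s))).
  exact: (slice_continuous cphi).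
by apply/funext => z; exact: slice_derive.
Qed.

Lemma slice_cont_deriv2 phi s i j : has_cont_deriv (dirz R j) ('D_(dirz R i) phi) ->
  has_cont_deriv (basisv R j) ('D_(basisv R i) (fun z => phi (z, s))).
Proof.
rewrite (_ : 'D_(basisv R i) _ = (fun z => 'D_(dirz R i) phi (z, s))).
  exact: slice_cont_deriv.
by apply/funext => z; exact: slice_derive.
Qed.

Lemma slice_derive2 phi z s i j :
  'D_(basisv R j) ('D_(basisv R i) (fun z => phi (z, s))) z =
  'D_(dirz R j) ('D_(dirz R i) phi) (z, s).
Proof.
rewrite (_ : 'D_(basisv R i) (fun z => phi (z, s)) =
    (fun z => 'D_(dirz R i) phi (z, s))); first exact: slice_derive.
by apply/funext => z'; exact: slice_derive.
Qed.

Lemma mvt_time phi z s (h : R) : has_cont_deriv (dirt R N) phi ->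
  exists2 c, `|c| <= `|h| &
    phi (z, s + h) - phi (z, s) = h * 'D_(dirt R N) phi (z, s + c).
Proof.
move=> [dphi _].
have E (a : R) : (z, s + a) = (z, s) + a *: dirt R N.
  by congr pair; rewrite /= ?scaler0 ?addr0// [_ *: 1]mulr1.
have [c ch H] := mvt_line (z, s) h dphi.
by exists c; rewrite // !E.
Qed.

Lemma compact_bounded_fun (X : topologicalType) (D : set X) (f : X -> R) :
  compact D -> continuous f -> exists2 B, 0 < B & forall p, D p -> `|f p| <= B.
Proof.
move=> cD cf.
have /compact_bounded[B [_ HB]] : compact (f @` D).
  by apply: continuous_compact => //; exact: continuous_subspaceT.
exists (`|B| + 1); first by rewrite ltr_wpDl.
move=> p Dp; apply: (HB (`|B| + 1)); first by rewrite (le_lt_trans (ler_norm B))// ltrDl.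
by exists p.
Qed.

Lemma finite_upper_bound (I : finType) (P : I -> R -> Prop) :
  (forall i, exists2 B, 0 < B & P i B) ->
  (forall i B B', P i B -> B <= B' -> P i B') ->
  exists2 B, 0 < B & forall i, P i B.
Proof.
move=> H mono.
have /choice[B BP] : forall i, exists B, 0 < B /\ P i B.
  by move=> i; have [B B0 PB] := H i; exists B.
exists (1 + \sum_i B i).
  by rewrite ltr_pwDl// sumr_ge0// => i _; exact: ltW (BP i).1.
move=> i; apply: mono (BP i).2 _.
rewrite (bigD1 i)//= addrCA lerDl addr_ge0// sumr_ge0// => j _.
exact: ltW (BP j).1.
Qed.

End SpaceTimeSlices.

(** * Rademacher signs and their first two moments *)

Section Rademacher.
Context (R : realType) (m : nat).
Local Notation signs := {ffun 'I_m -> bool}.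

(** Random signs share the first two moments of a standard Gaussian vector, which is all that a
    second-order generator sees; moreover they are bounded and take finitely many values. *)
Definition sign_vec (xi : signs) : 'cV[R]_m := \col_k (-1) ^+ xi k.

Definition sign_mean (f : signs -> R) : R := #|{: signs}|%:R^-1 * \sum_xi f xi.

Lemma sign_mean_mean : is_mean sign_mean.
Proof.
apply: (@mean_average R _ {ffun 'I_m -> bool} (fun xi f => f xi)).
  by apply/card_gt0P; exists [ffun=> true].
by move=> xi; exact: mean_point.
Qed.

Definition flip (k : 'I_m) (xi : signs) : signs :=
  [ffun i => if i == k then ~~ xi i else xi i].

Lemma flipK k : involutive (flip k).
Proof.
by move=> xi; apply/ffunP => i; rewrite !ffunE; case: eqP; rewrite ?negbK.
Qed.

(** Flipping sign [k] permutes the sign vectors, so the sum equals its own opposite. *)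
Lemma sign_mean_odd k f : (forall xi, f (flip k xi) = - f xi) -> sign_mean f = 0.
Proof.
move=> fodd; have : \sum_xi f xi = - \sum_xi f xi.
  rewrite {1}(reindex_inj (can_inj (flipK k))) -sumrN.
  by apply: eq_bigr => xi _; rewrite fodd.
by rewrite /sign_mean => H; rewrite (_ : \sum_xi _ = 0) ?mulr0//; move: H; lra.
Qed.

Lemma sign_vec_flip k l xi : sign_vec (flip k xi) l ord0 =
  if l == k then - sign_vec xi l ord0 else sign_vec xi l ord0.
Proof. by rewrite !mxE ffunE; case: eqP => // _; rewrite signrN. Qed.

Lemma sign_mean1 k : sign_mean (fun xi => sign_vec xi k ord0) = 0.
Proof. by apply: (@sign_mean_odd k) => xi; rewrite sign_vec_flip eqxx. Qed.

Lemma sign_mean2 k l :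
  sign_mean (fun xi => sign_vec xi k ord0 * sign_vec xi l ord0) = (k == l)%:R.
Proof.
have [->|kl] := eqVneq k l.
  rewrite (_ : (fun _ => _) = fun=> 1) ?(mean_cst sign_mean_mean)//.
  by apply/funext => xi; rewrite !mxE -expr2 sqrr_sign.
apply: (@sign_mean_odd k) => xi.
by rewrite !sign_vec_flip eqxx eq_sym (negbTE kl) mulNr.
Qed.

Lemma sign_vec_norm xi k : `|sign_vec xi k ord0| = 1.
Proof. by rewrite mxE normr_sign. Qed.

End Rademacher.

Section Euler.
Context (R : realType) (N m : nat).
Variables (b : 'cV[R]_N -> R -> 'cV[R]_N).
Variables (sigma : 'cV[R]_N -> R -> 'M[R]_(N, m)).

Definition increment (h : R) z s (xi : {ffun 'I_m -> bool}) : 'cV[R]_N :=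
  h *: b z s + Num.sqrt h *: (sigma z s *m sign_vec R xi).

Definition euler h s (f : 'cV[R]_N -> R) z : R :=
  sign_mean (fun xi => f (z + increment h z s xi)).

Lemma euler_markov h s : is_markov (euler h s).
Proof.
move=> z; have SP := @sign_mean_mean R m; split=> [a f g|f f0|].
- exact: (mean_lin SP).
- exact: (mean_ge0 SP).
- exact: (mean_cst SP).
Qed.

Lemma noiseE z s xi i :
  (sigma z s *m sign_vec R xi) i ord0 = \sum_k sigma z s i k * sign_vec R xi k ord0.
Proof. by rewrite mxE. Qed.

Lemma sign_mean_noise z s i :
  sign_mean (fun xi => (sigma z s *m sign_vec R xi) i ord0) = 0.
Proof.
under eq_fun do rewrite noiseE.
rewrite (mean_sum (sign_mean_mean R m)) big1// => k _.
by rewrite (meanZ (sign_mean_mean R m)) sign_mean1 mulr0.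
Qed.

Lemma sign_mean_noise2 z s i j :
  sign_mean (fun xi => (sigma z s *m sign_vec R xi) i ord0 *
                       (sigma z s *m sign_vec R xi) j ord0) =
  (sigma z s *m (sigma z s)^T) i j.
Proof.
have SP := sign_mean_mean R m.
transitivity (sign_mean (fun xi => \sum_k \sum_l
    (sigma z s i k * sigma z s j l) * (sign_vec R xi k ord0 * sign_vec R xi l ord0))).
  congr sign_mean; apply/funext => xi; rewrite !noiseE mulr_suml.
  by apply: eq_bigr => k _; rewrite mulr_sumr; apply: eq_bigr => l _; rewrite mulrACA.
rewrite (mean_sum SP) mxE; apply: eq_bigr => k _.
rewrite (mean_sum SP) (bigD1 k)//= big1 ?addr0 => [|l lk].
  by rewrite (meanZ SP) sign_mean2 eqxx mulr1 mxE.
by rewrite (meanZ SP) sign_mean2 eq_sym (negbTE lk) mulr0.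
Qed.

Lemma sign_mean_increment h z s i :
  sign_mean (fun xi => increment h z s xi i ord0) = h * b z s i ord0.
Proof.
have SP := sign_mean_mean R m.
transitivity (sign_mean (fun xi => Num.sqrt h * (sigma z s *m sign_vec R xi) i ord0
   + h * b z s i ord0)).
  by congr sign_mean; apply/funext => xi; rewrite addrC 3!mxE [in RHS]mxE mxE.
by rewrite (mean_lin SP) sign_mean_noise mulr0 add0r (mean_cst SP).
Qed.

Lemma sign_mean_increment2 h z s i j : 0 <= h ->
  sign_mean (fun xi => increment h z s xi i ord0 * increment h z s xi j ord0) =
  h ^+ 2 * (b z s i ord0 * b z s j ord0) + h * (sigma z s *m (sigma z s)^T) i j.
Proof.
move=> h0; have SP := sign_mean_mean R m.
pose w i xi := (sigma z s *m sign_vec R xi) i ord0.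
transitivity (sign_mean (fun xi => h * (w i xi * w j xi) +
  (Num.sqrt h * (h * b z s j ord0) * w i xi +
  (Num.sqrt h * (h * b z s i ord0) * w j xi +
    h ^+ 2 * (b z s i ord0 * b z s j ord0))))).
  congr sign_mean; apply/funext => xi.
  have E k : increment h z s xi k ord0 = h * b z s k ord0 + Num.sqrt h * w k xi.
    by rewrite /w 3!mxE [in RHS]mxE mxE.
  rewrite !E; have := sqr_sqrtr h0; set r := Num.sqrt h => <-; ring.
rewrite !(mean_lin SP) (mean_cst SP) /w !sign_mean_noise sign_mean_noise2.
by ring.
Qed.

Hypothesis b_cont : forall i, continuous (fun p : 'cV[R]_N * R => b p.1 p.2 i ord0).
Hypothesis sigma_cont :
  forall i k, continuous (fun p : 'cV[R]_N * R => sigma p.1 p.2 i k).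

(** Bounded noise gives an estimate for every sign vector, not only in mean. The drift part is also
    of order [sqrt h], because [h <= sqrt h] when [h <= 1]. *)
Lemma increment_bound rho tau : exists2 D, 0 < D &
  forall h z s xi, 0 <= h <= 1 -> `|z| <= rho -> `|s| <= tau ->
    `|increment h z s xi| <= Num.sqrt h * D.
Proof.
have cK := @spacetime_box_compact R N rho tau.
have [Bb Bb0 bB] : exists2 B, 0 < B & forall i z s, `|z| <= rho -> `|s| <= tau ->
    `|b z s i ord0| <= B.
  apply: finite_upper_bound => [i|i B B' H BB' z s zr st].
    have [B B0 H] := compact_bounded_fun cK (@b_cont i).
    by exists B => // z s zr st; exact: (H (z, s)).
  exact: le_trans (H _ _ zr st) BB'.
have [Bs Bs0 sB] : exists2 B, 0 < B & forall ik : 'I_N * 'I_m, forall z s,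
    `|z| <= rho -> `|s| <= tau -> `|sigma z s ik.1 ik.2| <= B.
  apply: finite_upper_bound => [[i k]|i B B' H BB' z s zr st].
    have [B B0 H] := compact_bounded_fun cK (@sigma_cont i k).
    by exists B => // z s zr st; exact: (H (z, s)).
  exact: le_trans (H _ _ zr st) BB'.
exists (Bb + m%:R * Bs); first by rewrite ltr_pwDl// mulr_ge0// ltW.
move=> h z s xi /andP[h0 h1] zr st.
rewrite cV_norm_le; last by rewrite mulr_ge0// addr_ge0 ?mulr_ge0// ltW.
apply/forallP => i; rewrite 3!mxE (le_trans (ler_normD _ _))// mulrDr lerD//.
  rewrite normrM ger0_norm// ler_pM ?bB//.
  by rewrite -{1}(sqr_sqrtr h0) expr2 ler_piMl// -sqrtr1 ler_sqrt.
rewrite normrM ger0_norm// ler_wpM2l// mxE.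
apply: le_trans (ler_norm_sum _ _ _) _.
rewrite mulrC mulr_natr -[in leRHS](card_ord m) -sumr_const.
apply: ler_sum => k _; rewrite normrM sign_vec_norm mulr1.
exact: (sB (i, k)).
Qed.

End Euler.

(** * Consistency of one Euler step with the generator *)

Section EulerConsistency.
Context (R : realType) (N m : nat).
Variables (b : 'cV[R]_N -> R -> 'cV[R]_N).
Variables (sigma : 'cV[R]_N -> R -> 'M[R]_(N, m)).
Hypothesis b_cont : forall i, continuous (fun p : 'cV[R]_N * R => b p.1 p.2 i ord0).
Hypothesis sigma_cont :
  forall i k, continuous (fun p : 'cV[R]_N * R => sigma p.1 p.2 i k).

Implicit Types phi : 'cV[R]_N * R -> R.

Lemma uniform_modulus (rho tau : R) (I : finType) (F : I -> 'cV[R]_N * R -> R) (e : R) :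
  (forall i, continuous (F i)) -> 0 < e ->
  exists2 d, 0 < d & forall i z s v c, `|z| <= rho -> `|s| <= tau ->
    `|v| < d -> `|c| < d -> `|F i (z + v, s + c) - F i (z, s)| <= e.
Proof.
move=> cF e0.
have /choice[d dP] : forall i, exists d, 0 < d /\ forall z s v c,
    `|z| <= rho -> `|s| <= tau -> `|v| < d -> `|c| < d ->
    `|F i (z + v, s + c) - F i (z, s)| <= e.
  move=> i.
  have [d d0 dP] := compact_unif_cont (@spacetime_box_compact R N rho tau) (cF i) e0.
  exists d; split => // z s v c zr st vd cd; rewrite distrC ltW// dP//.
  by rewrite prod_normE /= !opprD !addNKr !normrN gt_max vd.
have [r r0 rd] := finite_pos_lower_bound (fun i => (dP i).1).
exists r => // i z s v c zr st vr cr.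
by apply: (dP i).2 => //; apply: lt_le_trans (rd i).
Qed.

(** The time increment is taken at the displaced point [z + v] but compared with the derivative at
    [(z, s)]; uniform continuity of the time derivative absorbs both shifts. *)
Lemma time_taylor phi (rho tau e : R) : has_cont_deriv (dirt R N) phi -> 0 < e ->
  exists2 d, 0 < d & forall z s v h, `|z| <= rho -> `|s| <= tau ->
    `|v| < d -> 0 <= h < d ->
    `|phi (z + v, s + h) - phi (z + v, s) - h * 'D_(dirt R N) phi (z, s)| <= e * h.
Proof.
move=> phit e0.
have [d d0 dP] := @uniform_modulus rho tau unit (fun=> 'D_(dirt R N) phi) e
  (fun=> phit.2) e0.
exists d => // z s v h zr st vd /andP[h0 hd].
have [c ch ->] := mvt_time (z + v) s h phit.
rewrite -mulrBr normrM ger0_norm// mulrC ler_wpM2r// (dP tt)//.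
by rewrite (le_lt_trans ch)// ger0_norm.
Qed.

Lemma space_taylor phi (rho tau e : R) :
  (forall i, has_cont_deriv (dirz R i) phi) ->
  (forall i j, has_cont_deriv (dirz R j) ('D_(dirz R i) phi)) -> 0 < e ->
  exists2 d, 0 < d & forall z s v, `|z| <= rho -> `|s| <= tau -> `|v| < d ->
    `|phi (z + v, s) - phi (z, s) - \sum_i v i ord0 * 'D_(dirz R i) phi (z, s)
      - 2^-1 * \sum_i \sum_j v i ord0 * v j ord0 *
          'D_(dirz R j) ('D_(dirz R i) phi) (z, s)|
    <= e * (N%:R * `|v|) ^+ 2.
Proof.
move=> phi1 phi2 e0.
have [d d0 dP] := @uniform_modulus rho tau ('I_N * 'I_N)%type
  (fun ij => 'D_(dirz R ij.2) ('D_(dirz R ij.1) phi)) e (fun ij => (phi2 _ _).2) e0.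
exists d => // z s v zr st vd.
have -> : \sum_i v i ord0 * 'D_(dirz R i) phi (z, s) =
    \sum_i v i ord0 * 'D_(basisv R i) (fun z => phi (z, s)) z.
  by apply: eq_bigr => i _; rewrite (slice_derive phi).
have -> : \sum_i \sum_j v i ord0 * v j ord0 *
      'D_(dirz R j) ('D_(dirz R i) phi) (z, s) =
    \sum_i \sum_j v i ord0 * v j ord0 *
      'D_(basisv R j) ('D_(basisv R i) (fun z => phi (z, s))) z.
  apply: eq_bigr => i _; apply: eq_bigr => j _.
  by rewrite (slice_derive2 phi z s i j).
apply: (@taylor2 R N (fun z => phi (z, s)) (fun i => slice_cont_deriv s (phi1 i))
  (fun i j => slice_cont_deriv2 s (phi2 i j)) z v e (ltW e0)) => c i j /andP[c0 c1].
rewrite (slice_derive2 phi (z + c *: v)) (slice_derive2 phi z).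
rewrite -[in X in X - _](addr0 s).
apply: (dP (i, j)) => //; last by rewrite normr0.
by rewrite normrZ ger0_norm// (le_lt_trans _ vd)// ler_piMl.
Qed.

(** The noise has mean zero and covariance [h] times [sigma sigma^T], so the quadratic Taylor
    polynomial averages exactly to the generator term, up to the [h ^+ 2] term left by the square of
    the drift. *)
Lemma generator_mean phi z s h : 0 <= h ->
  sign_mean (fun xi => phi (z, s) + h * 'D_(dirt R N) phi (z, s) +
      (\sum_i increment b sigma h z s xi i ord0 * 'D_(dirz R i) phi (z, s) +
       2^-1 * \sum_i \sum_j
         increment b sigma h z s xi i ord0 * increment b sigma h z s xi j ord0 *
         'D_(dirz R j) ('D_(dirz R i) phi) (z, s))) =
  phi (z, s) + h * generator b sigma phi (z, s) +
  h ^+ 2 * (2^-1 * \sum_i \sum_j b z s i ord0 * b z s j ord0 *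
     'D_(dirz R j) ('D_(dirz R i) phi) (z, s)).
Proof.
move=> h0; have SP := sign_mean_mean R m.
set d1 := fun i : 'I_N => 'D_(dirz R i) phi (z, s).
set d2 := fun i j : 'I_N => 'D_(dirz R j) ('D_(dirz R i) phi) (z, s).
set dt := 'D_(dirt R N) phi (z, s).
rewrite (meanD SP) (mean_cst SP) (meanD SP) (meanZ SP) !(mean_sum SP).
have -> : \sum_i sign_mean (fun xi => increment b sigma h z s xi i ord0 * d1 i) =
    h * \sum_i b z s i ord0 * d1 i.
  rewrite mulr_sumr; apply: eq_bigr => i _.
  rewrite -/(d1 i) (_ : (fun _ => _) =
    (fun xi => d1 i * increment b sigma h z s xi i ord0)).
    by rewrite (meanZ SP) sign_mean_increment; ring.
  by apply/funext => xi; rewrite mulrC.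
have -> : \sum_i sign_mean (fun xi => \sum_j
      increment b sigma h z s xi i ord0 * increment b sigma h z s xi j ord0 * d2 i j) =
    h ^+ 2 * (\sum_i \sum_j b z s i ord0 * b z s j ord0 * d2 i j) +
    h * \sum_i \sum_j (sigma z s *m (sigma z s)^T) i j * d2 i j.
  rewrite !mulr_sumr -big_split; apply: eq_bigr => i _ /=.
  rewrite (mean_sum SP) !mulr_sumr -big_split; apply: eq_bigr => j _ /=.
  rewrite -/(d2 i j) (_ : (fun _ => _) = (fun xi => d2 i j *
     (increment b sigma h z s xi i ord0 * increment b sigma h z s xi j ord0))).
    by rewrite (meanZ SP) sign_mean_increment2//; ring.
  by apply/funext => xi; rewrite mulrC.
have -> : generator b sigma phi (z, s) = dt +
    2^-1 * (\sum_i \sum_j (sigma z s *m (sigma z s)^T) i j * d2 i j) +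
    \sum_i b z s i ord0 * d1 i.
  rewrite /generator /diffusion /=; congr (_ + _ + _).
  rewrite mulr_sumr; apply: eq_bigr => i _; rewrite mulr_sumr; apply: eq_bigr => j _.
  by rewrite mxE mulrA.
rewrite -/dt; ring.
Qed.

(** Three errors of size [e / 3 * h]: the time increment, the Taylor remainder in space, and the
    squared drift from [generator_mean]. The space remainder is of order [h] because increments are
    of order [sqrt h]; uniform continuity of the second derivatives supplies the small factor. *)
Lemma euler_consistent phi (rho tau e : R) : C21 phi -> 0 < e ->
  exists2 h0, 0 < h0 & forall h z s, 0 < h <= h0 -> `|z| <= rho -> `|s| <= tau ->
    `|euler b sigma h s (fun z' => phi (z', s + h)) z - phi (z, s)
      - h * generator b sigma phi (z, s)| <= e * h.
Proof.
move=> [_ phit phi1 phi2] e0.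
have [D D0 incD] := @increment_bound R N m b sigma b_cont sigma_cont rho tau.
have e3 : 0 < e / 3 by rewrite divr_gt0.
(* Chosen so that [e2 * (N.+1%:R * (sqrt h * D)) ^+ 2] equals [e / 3 * h]. *)
pose e2 := e / 3 / (N.+1%:R * D) ^+ 2.
have ND0 : 0 < N.+1%:R * D by rewrite mulr_gt0.
have e20 : 0 < e2 by rewrite divr_gt0// exprn_gt0.
have [dt dt0 dtP] := @time_taylor phi rho tau _ phit e3.
have [dz dz0 dzP] := @space_taylor phi rho tau _ phi1 phi2 e20.
pose q p := 2^-1 * \sum_i \sum_j b p.1 p.2 i ord0 * b p.1 p.2 j ord0 *
     'D_(dirz R j) ('D_(dirz R i) phi) p.
have [Q Q0 qQ] : exists2 Q, 0 < Q & forall z s, `|z| <= rho -> `|s| <= tau ->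
    `|q (z, s)| <= Q.
  have [B B0 H] : exists2 B, 0 < B & forall ij : 'I_N * 'I_N, forall z s,
      `|z| <= rho -> `|s| <= tau -> `|b z s ij.1 ord0 * b z s ij.2 ord0 *
        'D_(dirz R ij.2) ('D_(dirz R ij.1) phi) (z, s)| <= B.
    apply: finite_upper_bound => [[i j]|i B B' H BB' z s zr st].
      have cont : continuous (fun p => b p.1 p.2 i ord0 * b p.1 p.2 j ord0 *
          'D_(dirz R j) ('D_(dirz R i) phi) p).
        move=> p; apply: cvgM; last exact: (phi2 i j).2.
        by apply: cvgM; exact: b_cont.
      have [B B0 H] := compact_bounded_fun (@spacetime_box_compact R N rho tau) cont.
      by exists B => // z s zr st; exact: (H (z, s)).
    exact: le_trans (H _ _ zr st) BB'.
  exists (2^-1 * (1 + \sum_(i < N) \sum_(j < N) B)).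
    rewrite mulr_gt0// ltr_pwDl// sumr_ge0// => i _; apply: sumr_ge0 => j _.
    exact: ltW.
  move=> z s zr st; rewrite normrM ger0_norm// ler_wpM2l// ler_wpDl//.
  apply: le_trans (ler_norm_sum _ _ _) _; apply: ler_sum => i _.
  apply: le_trans (ler_norm_sum _ _ _) _; apply: ler_sum => j _.
  exact: (H (i, j)).
pose d := Num.min dt dz.
have d0 : 0 < d by rewrite lt_min dt0.
(* In turn: [h <= 1] for [increment_bound], [h < dt], increments shorter than [d], and
   [h * Q <= e / 3]. *)
pose h0 := Num.min (Num.min (1 / 2) (dt / 2)) (Num.min ((d / (2 * D)) ^+ 2) (e / 3 / Q)).
have h00 : 0 < h0.
  by rewrite !lt_min !divr_gt0// ?exprn_gt0 ?divr_gt0// ?mulr_gt0.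
exists h0 => // h z s /andP[hgt0].
rewrite !le_min => /andP[/andP[h12 hdt] /andP[hd hQ]] zr st.
have hge0 := ltW hgt0.
have h1 : 0 <= h <= 1 by rewrite hge0 (le_trans h12)//; lra.
have incd xi : `|increment b sigma h z s xi| < d.
  apply: le_lt_trans (incD _ _ _ _ h1 zr st) _.
  rewrite -ltr_pdivlMr//.
  have -> : d / D = Num.sqrt ((d / D) ^+ 2) by rewrite sqrtr_sqr ger0_norm// ltW// divr_gt0.
  rewrite ltr_sqrt ?exprn_gt0 ?divr_gt0//.
  apply: le_lt_trans hd _; rewrite ltr_sqr ?nnegrE ?divr_ge0 ?mulr_ge0 ?ltW//.
  by rewrite ltr_pM2l// ltf_pV2 ?posrE ?mulr_gt0//; move: D0; lra.
have SP := sign_mean_mean R m.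
have H := generator_mean phi z s hge0.
set Qf := (X in sign_mean X = _) in H.
have H2 : `|euler b sigma h s (fun z' => phi (z', s + h)) z - sign_mean Qf|
    <= 2 * (e / 3) * h.
  rewrite -[leRHS](mean_cst SP); apply: (mean_dist SP) => xi.
  have := incd xi; rewrite lt_min => /andP[id1 id2].
  have := @dtP z s (increment b sigma h z s xi) h zr st id1.
  have -> : 0 <= h < dt by rewrite hge0 (le_lt_trans hdt)// ltr_pdivrMr// ltr_pMr// ltr1n.
  move=> /(_ isT).
  have := dzP z s _ zr st id2.
  have : e2 * (N%:R * `|increment b sigma h z s xi|) ^+ 2 <= e / 3 * h.
    rewrite /e2 mulrAC ler_pdivrMr ?exprn_gt0// -[leRHS]mulrA ler_wpM2l ?(ltW e3)//.
    have -> : h * (N.+1%:R * D) ^+ 2 = (N.+1%:R * (Num.sqrt h * D)) ^+ 2.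
      by rewrite -{1}(sqr_sqrtr hge0); ring.
    rewrite ler_sqr ?nnegrE ?mulr_ge0//; last exact: ltW.
    by rewrite ler_pM// ?ler_nat ?incD.
  rewrite /Qf.
  set A2 := \sum_i _; set A1 := \sum_i _; set a0 := phi (z + _, s).
  set a1 := phi (z + _, _); set a2 := phi (z, s); set a3 := h * _.
  move=> E1 E2 E3; rewrite (_ : a1 - _ = (a1 - a0 - a3) + (a0 - a2 - A1 - 2^-1 * A2)).
    by apply: le_trans (ler_normD _ _) _; move: E1 E2 E3; lra.
  by ring.
rewrite H in H2.
have := qQ z s zr st; rewrite /q /=; move: H2; set q0 := 2^-1 * _ => H2 q0Q.
have H3 : `|h ^+ 2 * q0| <= e / 3 * h.
  rewrite normrM ger0_norm ?exprn_ge0// expr2 mulrAC ler_wpM2r//.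
  apply: le_trans (ler_wpM2l hge0 q0Q) _.
  by rewrite -ler_pdivlMr.
move: H2; set X := euler _ _ _ _ _ _; set Y := generator _ _ _ _ => H2.
rewrite (_ : X - _ - _ = (X - (phi (z, s) + h * Y + h ^+ 2 * q0)) + h ^+ 2 * q0); last by ring.
by apply: le_trans (ler_normD _ _) _; move: H2 H3; lra.
Qed.

End EulerConsistency.

(** * Bounded means as probability measures *)

Section BoundedMeans.
Context (R : realType) (Z : Type).
Implicit Types (l : (Z -> R) -> R) (f g : Z -> R).

Definition bfun f := exists B, forall z, `|f z| <= B.

Lemma bfun_cst (a : R) : bfun (fun=> a).
Proof. by exists `|a|. Qed.

Lemma bfun_lin a f g : bfun f -> bfun g -> bfun (fun z => a * f z + g z).
Proof.
move=> [B fB] [B' gB]; exists (`|a| * B + B') => z.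
rewrite (le_trans (ler_normD _ _))// lerD// normrM.
by rewrite ler_wpM2l.
Qed.

Lemma bfunB f g : bfun f -> bfun g -> bfun (fun z => f z - g z).
Proof.
move=> [B fB] [B' gB]; exists (B + B') => z.
by rewrite (le_trans (ler_normB _ _))// lerD.
Qed.

Lemma bfun_sum (I : Type) (r : seq I) (F : I -> Z -> R) :
  (forall i, bfun (F i)) -> bfun (fun z => \sum_(i <- r) F i z).
Proof.
move=> /choice[B FB]; exists (\sum_(i <- r) B i) => z.
by rewrite (le_trans (ler_norm_sum _ _ _))// ler_sum.
Qed.

Lemma bfun_bool (p : Z -> bool) : bfun (fun z => (p z)%:R).
Proof. by exists 1 => z; case: (p z); rewrite ?normr1 ?normr0. Qed.

(** Linearity is asked on bounded functions only: there an ultrafilter limit of means is sure to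
    exist and to be additive. *)
Definition is_bounded_mean l :=
  [/\ forall a f g, bfun f -> bfun g -> l (fun z => a * f z + g z) = a * l f + l g,
      forall f, bfun f -> (forall z, 0 <= f z) -> 0 <= l f &
      l (fun=> 1) = 1].

Section Theory.
Context (l : (Z -> R) -> R) (lP : is_bounded_mean l).

Lemma bmeanB f g : bfun f -> bfun g -> l (fun z => f z - g z) = l f - l g.
Proof.
case: lP => lin _ _ bf bg.
have -> : (fun z => f z - g z) = (fun z => -1 * g z + f z).
  by apply/funext => z; ring.
by rewrite lin//; ring.
Qed.

Lemma bmean0 : l (fun=> 0) = 0.
Proof.
rewrite (_ : (fun=> 0) = (fun z : Z => 1 - 1 : R)); last by apply/funext => z; rewrite subrr.
by rewrite bmeanB ?subrr//; exact: bfun_cst.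
Qed.

Lemma bmeanZ a f : bfun f -> l (fun z => a * f z) = a * l f.
Proof.
case: lP => lin _ _ bf; have := lin a f (fun=> 0) bf (bfun_cst 0).
rewrite bmean0 addr0 => <-.
by congr l; apply/funext => z; rewrite addr0.
Qed.

Lemma bmeanD f g : bfun f -> bfun g -> l (fun z => f z + g z) = l f + l g.
Proof.
case: lP => lin _ _ bf bg.
by rewrite -[l f]mul1r -lin//; congr l; apply/funext => z; rewrite mul1r.
Qed.

Lemma bmean_cst a : l (fun=> a) = a.
Proof.
have -> : (fun=> a) = (fun z : Z => a * 1) by apply/funext => z; rewrite mulr1.
by rewrite bmeanZ; [case: lP => _ _ ->; rewrite mulr1|exact: bfun_cst].
Qed.

Lemma bmean_sum (I : Type) (r : seq I) (F : I -> Z -> R) :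
  (forall i, bfun (F i)) ->
  l (fun z => \sum_(i <- r) F i z) = \sum_(i <- r) l (F i).
Proof.
move=> bF; elim: r => [|i r IH].
  by rewrite big_nil -[RHS]bmean0; congr l; apply/funext => z; rewrite big_nil.
rewrite big_cons -IH -bmeanD//; last exact: bfun_sum.
by congr l; apply/funext => z; rewrite big_cons.
Qed.

Lemma bmean_le f g : bfun f -> bfun g -> (forall z, f z <= g z) -> l f <= l g.
Proof.
move=> bf bg fg; rewrite -subr_ge0 -bmeanB//; case: lP => _ + _; apply.
  exact: bfunB.
by move=> z; rewrite subr_ge0.
Qed.

Lemma bmean_dist f g e : bfun f -> bfun g -> (forall z, `|f z - g z| <= e) ->
  `|l f - l g| <= e.
Proof.
move=> bf bg fg; rewrite -bmeanB// ler_norml -{1}(bmean_cst (- e)) -{2}(bmean_cst e).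
apply/andP; split; (apply: bmean_le; [| |by move=> z; have := fg z; rewrite ler_norml => /andP[]]);
  by [exact: bfun_cst|exact: bfunB].
Qed.

End Theory.
End BoundedMeans.

(** * The uniform measure on the unit interval, and coding of a mean *)

Section UnitUniform.
Context (R : realType).

Definition unit_itv : set (measurableTypeR R) := `[0, 1[%classic.

Lemma measurable_unit_itv : measurable unit_itv.
Proof. exact: measurable_itv. Qed.

Definition unit_uniform : set (measurableTypeR R) -> \bar R :=
  mrestr (@lebesgue_measure R) measurable_unit_itv.

HB.instance Definition _ := Measure.on unit_uniform.

Lemma unit_uniform_itv (a b : R) : 0 <= a -> a <= b -> b <= 1 ->
  unit_uniform `[a, b[%classic = (b - a)%:E.
Proof.
move=> a0 ab b1; rewrite /unit_uniform /mrestr setIidl.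
  apply: etrans (lebesgue_measure_itv _) _; rewrite /= lte_fin.
  by case: ltP => // ba; congr (_%:E); move: ab ba; lra.
move=> u /=; rewrite /unit_itv /= !in_itv /= => /andP[au ub].
by rewrite (le_trans a0)//= (lt_le_trans ub).
Qed.

Lemma unit_uniformI B : unit_uniform (B `&` unit_itv) = unit_uniform B.
Proof. by rewrite /unit_uniform /mrestr -setIA setIid. Qed.

Lemma unit_uniformT : unit_uniform setT = 1%E.
Proof.
have := unit_uniform_itv (lexx 0) ler01 (lexx 1).
by rewrite /unit_uniform /mrestr setIid setTI subr0.
Qed.

HB.instance Definition _ := Measure_isProbability.Build _ _ _ unit_uniform unit_uniformT.

End UnitUniform.

(* A mean on bounded functions is only finitely additive.  It is transported to
   [0, 1[ through a coding of the points by nested finite partitions: the cell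
   number [j] of level [i] is represented by the interval [G i j, G i j.+1[. *)
Section Coding.
Context (R : realType) (Z : choiceType) (z0 : Z) (A : nat -> Z -> bool).
Context (l : (Z -> R) -> R) (lP : is_bounded_mean l).

(** The answers to the first [i] tests, read as binary digits with the latest one last, so that
    halving forgets the finest test. *)
Fixpoint code i z : nat := if i is i'.+1 then (code i' z).*2 + A i' z else 0%N.

Lemma code_lt i z : (code i z < 2 ^ i)%N.
Proof. by elim: i => //= i IH; rewrite expnS; case: (A i z); lia. Qed.

Lemma code_half i z : (code i.+1 z)./2 = code i z.
Proof. by rewrite /= addnC half_bit_double. Qed.

(** The distribution function of the code. It provides the left end of the interval of cell [j],
    whose length is the mass of that cell. *)
Definition cumul i j : R := l (fun z => (code i z < j)%N%:R).

Lemma cumul0 i : cumul i 0 = 0.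
Proof. by rewrite -[RHS](bmean0 lP). Qed.

Lemma cumul1 i : cumul i (2 ^ i) = 1.
Proof.
rewrite -[RHS](bmean_cst lP); congr l; apply/funext => z.
by rewrite code_lt.
Qed.

Lemma cumul_le i j k : (j <= k)%N -> cumul i j <= cumul i k.
Proof.
move=> jk; apply: (bmean_le lP) => [||z]; [exact: bfun_bool|exact: bfun_bool|].
by rewrite ler_nat; case: ltnP => // /leq_trans -> //.
Qed.

Lemma cumul_double i j : cumul i.+1 j.*2 = cumul i j.
Proof.
congr l; apply/funext => z; congr (nat_of_bool _)%:R => /=.
by case: (A i z); lia.
Qed.

Lemma cumulS i j : cumul i j.+1 - cumul i j = l (fun z => (code i z == j)%:R).
Proof.
rewrite -(bmeanB lP); [|exact: bfun_bool|exact: bfun_bool].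
congr l; apply/funext => z; rewrite ltnS leq_eqVlt.
by case: ltngtP => _ /=; rewrite ?subr0 ?subrr.
Qed.

Definition branch i (u : R) : nat := \max_(j < 2 ^ i | cumul i j <= u) j.

Lemma branchP i u : 0 <= u < 1 ->
  [/\ (branch i u < 2 ^ i)%N, cumul i (branch i u) <= u &
      u < cumul i (branch i u).+1].
Proof.
move=> /andP[u0 u1].
have p0 : (0 < 2 ^ i)%N by rewrite expn_gt0.
have [j ju Ej] : {j : 'I_(2 ^ i) | cumul i j <= u & branch i u = j :> nat}.
  have P0 : cumul i (Ordinal p0) <= u by rewrite cumul0.
  have [|j Pj Ej] := @eq_bigmax_cond _ [pred j : 'I_(2 ^ i) | cumul i j <= u] val.
    by apply/card_gt0P; exists (Ordinal p0).
  by exists j => //; rewrite -Ej.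
rewrite Ej; split => //; rewrite ltNge; apply/negP => Gu.
have [j1|j1] := ltnP j.+1 (2 ^ i).
  have := @leq_bigmax_cond _ (fun j : 'I_(2 ^ i) => cumul i j <= u) val (Ordinal j1) Gu.
  by rewrite -/(branch i u) Ej ltnn.
by move: Gu; have := cumul_le i j1; rewrite cumul1; move: u1; lra.
Qed.

Lemma branchE i u j : 0 <= u < 1 ->
  cumul i j <= u < cumul i j.+1 -> branch i u = j.
Proof.
move=> u01 /andP[ju uj]; have [_ bu ub] := branchP i u01.
apply/eqP; rewrite eqn_leq; apply/andP; split; rewrite leqNgt; apply/negP => H;
  by have := cumul_le i H; move: ju uj bu ub; lra.
Qed.

Lemma branch_half i u : 0 <= u < 1 -> (branch i.+1 u)./2 = branch i u.
Proof.
move=> u01; apply/esym/branchE => //; have [_ bu ub] := branchP i.+1 u01.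
set k := branch i.+1 u in bu ub *.
have := odd_double_half k; rewrite -(cumul_double i k./2) -(cumul_double i k./2.+1).
move=> Ek; apply/andP; split.
  by apply: le_trans bu; apply: cumul_le; lia.
by apply: lt_le_trans ub _; apply: cumul_le; lia.
Qed.

Definition cell_point i j : Z := xget z0 [set z | code i z = j].

Lemma cell_point_code i z : code i (cell_point i (code i z)) = code i z.
Proof. by rewrite /cell_point; case: xgetP => [y _ //|H]; case: (H z). Qed.

(** A cell without points has mass zero, hence an empty interval, and is never met by [u]; so
    [cell_point] does not fall back on its default [z0] here. *)
Lemma branch_code i u : 0 <= u < 1 -> code i (cell_point i (branch i u)) = branch i u.
Proof.
move=> u01; rewrite /cell_point; case: xgetP => [y _ //|noz].
have [_ bu ub] := branchP i u01.
have : cumul i (branch i u).+1 - cumul i (branch i u) = 0.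
  rewrite cumulS -[RHS](bmean0 lP); congr l; apply/funext => z.
  by case: eqP => // /noz.
by move=> E; exfalso; move: E bu ub; lra.
Qed.

Lemma iter_code_half i d z : iter d half (code (i + d) z) = code i z.
Proof. by elim: d => [|d IH]; rewrite ?addn0// addnS iterSr code_half. Qed.

Lemma iter_branch_half i d u : 0 <= u < 1 ->
  iter d half (branch (i + d) u) = branch i u.
Proof.
by move=> u01; elim: d => [|d IH]; rewrite ?addn0// addnS iterSr branch_half.
Qed.

(** Nested intervals match nested cells: halving [j - i] times brings both the code of the
    representative and the branch from level [j] down to level [i]. *)
Lemma branch_code_le i j u : 0 <= u < 1 -> (i <= j)%N ->
  code i (cell_point j (branch j u)) = branch i u.
Proof.
move=> u01 ij; rewrite -(subnKC ij) -(iter_code_half i (j - i)) subnKC//.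
by rewrite branch_code// -{2}(subnKC ij) iter_branch_half// subnKC.
Qed.

Lemma bmean_step i (g : nat -> R) :
  l (fun z => g (code i z)) = \sum_(j < 2 ^ i) g j * (cumul i j.+1 - cumul i j).
Proof.
have -> : (fun z => g (code i z)) =
    (fun z => \sum_(j < 2 ^ i) g j * (code i z == j)%:R).
  apply/funext => z; rewrite (bigD1 (Ordinal (code_lt i z)))//= eqxx mulr1.
  rewrite big1 ?addr0// => j; rewrite eq_sym -val_eqE /= => /negbTE ->.
  by rewrite mulr0.
rewrite (bmean_sum lP) => [|j].
  by apply: eq_bigr => j _; rewrite (bmeanZ lP) -?cumulS//; exact: bfun_bool.
have [B H] := bfun_bool R (fun z => code i z == j).
exists (`|g j| * B) => z.
by rewrite normrM ler_wpM2l.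
Qed.

Lemma branch_indic i (g : nat -> R) (u : measurableTypeR R) : unit_itv u ->
  g (branch i u) =
  \sum_(j < 2 ^ i) g j * \1_(`[cumul i j, cumul i j.+1[ : set (measurableTypeR R)) u.
Proof.
rewrite /unit_itv /= in_itv /= => u01; have [lt bu ub] := branchP i u01.
rewrite (bigD1 (Ordinal lt))//= big1 => [|j jb].
  by rewrite indicE mem_set ?mulr1 ?addr0//= in_itv /= bu.
rewrite indicE memNset ?mulr0//= in_itv /= => jP; move: jb.
by rewrite -(inj_eq val_inj) /= (branchE u01 jP) eqxx.
Qed.

Lemma branch_measurable i (g : nat -> R) :
  measurable_fun (@unit_itv R) (fun u : measurableTypeR R => g (branch i u)).
Proof.
apply: (eq_measurable_fun (fun u => \sum_(j < 2 ^ i) g j *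
    \1_(`[cumul i j, cumul i j.+1[ : set (measurableTypeR R)) u)).
  by move=> u; rewrite inE => uI; rewrite branch_indic.
apply: measurable_sum => j; exact: measurable_realfun.measurable_funM.
Qed.

(** At a fixed level there are finitely many cells, so finite additivity of [l] is enough: both
    sides are the same finite sum over cells. *)
Lemma branch_integral i (g : nat -> R) :
  (\int[@unit_uniform R]_(u in @unit_itv R) (g (branch i u))%:E =
   (l (fun z => g (code i z)))%:E)%E.
Proof.
pose I j : set (measurableTypeR R) := `[cumul i j, cumul i j.+1[%classic.
rewrite bmean_step.
transitivity (\int[@unit_uniform R]_(u in @unit_itv R) (\sum_(j < 2 ^ i) (g j)%:E *
    (\1_(I j) u)%:E))%E.
  apply: eq_integral => u; rewrite inE => uI; rewrite branch_indic// -sumEFin.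
  by apply: eq_bigr => j _; rewrite EFinM.
have mI j : measurable (I j) by exact: measurable_itv.
have mU := @measurable_unit_itv R.
have iI j : (@unit_uniform R).-integrable (@unit_itv R) (fun u => (\1_(I j) u)%:E).
  by apply: (@integrableS _ _ _ _ setT) => //; exact: integrable_indic.
rewrite integral_sum//; last by move=> j; apply: integrableZl.
rewrite -sumEFin; apply: eq_bigr => j _.
rewrite integralZl// integral_indic// EFinM; congr (_ * _)%E.
have := cumul_le i (leq0n j); rewrite cumul0 => j0.
have := cumul_le i (ltn_ord j); rewrite cumul1 => j1.
rewrite -(unit_uniform_itv j0 (cumul_le i (leqnSn j)) j1).
exact: unit_uniformI.
Qed.

End Coding.

(** * Rational balls and measurability on vectors and on space-time *)

Section SecondCountable.
Context (R : realType).

Lemma open_bigcup_balls (X : normedModType R) (I : Type) (d : I -> X) :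
  (forall x e, 0 < e -> exists i, `|x - d i| < e) ->
  forall O : set X, open O ->
  O = \bigcup_(p in [set p : I * nat | ball (d p.1) p.2.+1%:R^-1 `<=` O])
        ball (d p.1) p.2.+1%:R^-1.
Proof.
move=> dense O oO; apply/seteqP; split=> [x Ox|x [p /= pO /pO//]].
have /nbhs_ballP[e /= e0 xe] : nbhs x O by exact: open_nbhs_nbhs.
have e20 : 0 < e / 2 by rewrite divr_gt0.
have [k /= ke] : exists k : nat, k.+1%:R^-1 < e / 2.
  exists (Num.bound (e / 2)^-1); rewrite invf_plt ?posrE//.
  apply: (@lt_trans _ _ (Num.bound (e / 2)^-1)%:R); last by rewrite ltr_nat.
  by apply: archi_boundP; rewrite invr_ge0 ltW.
have [i ie] := dense x k.+1%:R^-1 (ltac:(by rewrite invr_gt0)).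
exists (i, k) => /=; last by rewrite -ball_normE /= distrC.
apply: subset_trans xe => y; rewrite -!ball_normE /= => yi.
rewrite -(subrKA (d i)) (le_lt_trans (ler_normD _ _))// (splitr e).
by rewrite ltrD// (lt_trans _ ke).
Qed.

Lemma ratr_dense (x e : R) : 0 < e -> exists q : rat, `|x - ratr q| < e.
Proof.
move=> e0; have [|q] := @rat_in_itvoo R (x - e) (x + e); first by lra.
rewrite in_itv /= => /andP[xq qx]; exists q.
by rewrite ltr_norml; apply/andP; split; lra.
Qed.

Lemma cV_ratr_dense N (x : 'cV[R]_N) (e : R) : 0 < e ->
  exists q : 'cV[rat]_N, `|x - map_mx ratr q| < e.
Proof.
move=> e0; have /choice[q qP] := fun i => ratr_dense (x i ord0) e0.
exists (\col_i q i); rewrite cV_norm_lt//; apply/forallP => i.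
by rewrite !mxE.
Qed.

Lemma spacetime_ratr_dense N (x : 'cV[R]_N * R) (e : R) : 0 < e ->
  exists q : 'cV[rat]_N * rat, `|x - (map_mx ratr q.1, ratr q.2)| < e.
Proof.
move=> e0; have [q1 q1P] := cV_ratr_dense x.1 e0.
have [q2 q2P] := ratr_dense x.2 e0.
by exists (q1, q2); rewrite prod_normE /= gt_max q1P.
Qed.

Lemma cV_open_measurable N (O : set (borelType 'cV[R]_N)) :
  open (O : set 'cV[R]_N) -> measurable O.
Proof. exact: sub_sigma_algebra. Qed.

Lemma spacetime_open_measurable N (O : set ('cV[R]_N * R)) : open O ->
  measurable (O : set (spacetime R N)).
Proof.
move=> oO; rewrite (open_bigcup_balls (@spacetime_ratr_dense N) oO).
rewrite bigcup_mkcond; apply: countable_bigcupT_measurable => [|p].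
  exact: countableP.
case: ifPn => _; last exact: measurable0.
set c := map_mx ratr p.1.1; set s : R := ratr p.1.2; set r := _^-1.
have -> : ball (c, s) r = ball c r `*` ball s r by [].
apply: measurableX; last exact: measurable_ball.
by apply: cV_open_measurable; exact: ball_open.
Qed.

Lemma spacetime_continuous_measurable N (f : 'cV[R]_N * R -> R) : continuous f ->
  measurable_fun setT (f : spacetime R N -> R).
Proof.
move=> /continuousP cf; apply: (measurability _ (RGenOpens.measurableE R)).
move=> _ [_ [a [b ->] <-]]; rewrite setTI; apply: spacetime_open_measurable.
exact/cf/interval_open.
Qed.

Lemma cV_continuous_measurable N (f : 'cV[R]_N -> R) : continuous f ->
  measurable_fun setT (f : borelType 'cV[R]_N -> R).
Proof.
move=> /continuousP cf; apply: (measurability _ (RGenOpens.measurableE R)).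
move=> _ [_ [a [b ->] <-]]; rewrite setTI; apply: cV_open_measurable.
exact/cf/interval_open.
Qed.

(** Open sets are countable unions of rational balls, and a ball of the sup norm is a finite
    intersection of conditions on coordinates. *)
Lemma measurable_fun_cV d (T : measurableType d) N D (f : T -> borelType 'cV[R]_N) :
  measurable D ->
  (forall i, measurable_fun D (fun x => (f x : 'cV[R]_N) i ord0)) ->
  measurable_fun D f.
Proof.
move=> mD mf; apply: (@measurability _ _ T (borelType 'cV[R]_N) D f (@open 'cV[R]_N) erefl) => _ [B oB <-].
rewrite (open_bigcup_balls (@cV_ratr_dense N) oB).
rewrite bigcup_mkcond preimage_bigcup setI_bigcupr.
apply: countable_bigcupT_measurable => [|p]; first exact: countableP.
case: ifPn => _; last by rewrite preimage_set0 setI0; exact: measurable0.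
set c := map_mx ratr p.1; set r := _^-1.
have r0 : 0 < r by rewrite invr_gt0.
have -> : D `&` f @^-1` ball c r =
    D `&` \bigcap_(i in [set: 'I_N])
      (D `&` (fun x => (f x : 'cV[R]_N) i ord0) @^-1` ball (c i ord0) r).
  apply/seteqP; split => [x [Dx]|x [Dx H]]; rewrite -ball_normE /= cV_norm_lt//.
    by move=> /forallP H; split => // i _; split => //=; have := H i; rewrite !mxE.
  by split => //; apply/forallP => i; case: (H i Logic.I) => _; rewrite /= !mxE.
apply: measurableI => //; apply: fin_bigcap_measurable => // i _.
by apply: mf => //; exact: measurable_ball.
Qed.

End SecondCountable.

Lemma clip_continuous (R : realType) (T : topologicalType) (g : T -> R) :
  continuous g -> continuous (fun x => Num.max 0 (Num.min 1 (g x))).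
Proof.
move=> cg x; apply: (@continuous_max _ _ (cst 0) (fun x => Num.min 1 (g x))).
  exact: cst_continuous.
apply: (@continuous_min _ _ (cst 1) g); [exact: cst_continuous|exact: cg].
Qed.

Section HalfSpaceCode.
Context (R : realType) (N : nat).
Implicit Types z : 'cV[R]_N.

Definition half_space (i : nat) z : bool :=
  if (unpickle i : option ('I_N * rat)) is Some (a, q) then z a ord0 < ratr q
  else false.

Lemma code_bits m z z' i : code half_space m z = code half_space m z' ->
  (i < m)%N -> half_space i z = half_space i z'.
Proof.
elim: m => // m IH E; have Em : code half_space m z = code half_space m z'.
  by rewrite -(code_half _ m z) -(code_half _ m z') E.
rewrite ltnS leq_eqVlt => /predU1P[->|]; last exact: IH.
by move: E; rewrite /= Em; do 2 case: half_space => //; lia.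
Qed.

(** Finitely many tests on a rational grid of mesh [q < e] locate each coordinate of a point of the
    ball between two neighbouring nodes. Only [z] is assumed bounded: equal codes place [z'] between
    the same nodes. *)
Lemma code_grid (rho e : R) : 0 < e -> exists m0, forall m z z',
  (m0 <= m)%N -> `|z| <= rho -> code half_space m z = code half_space m z' ->
  `|z - z'| <= e.
Proof.
move=> e0.
have [q] := @rat_in_itvoo R 0 e e0; rewrite in_itv /= => /andP[q0 qe].
(* The nodes [(k - K) * q] extend beyond the ball by more than one mesh on each side. *)
pose K := (Num.bound (`|rho| / ratr q)).+1.
have rK : `|rho| / ratr q + 1 < K%:R.
  by rewrite /K -natr1 ltrD2r archi_boundP// divr_ge0// ltW.
pose node (k : 'I_(2 * K).+1) : rat := (k%:R - K%:R) * q.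
(* Past this level every test on a grid node is among the recorded bits. *)
exists (\max_(ak : 'I_N * 'I_(2 * K).+1) (pickle (ak.1, node ak.2)).+1)%N.
move=> m z z' m0m zr E.
rewrite cV_norm_le; last exact: ltW.
apply/forallP => a; rewrite !mxE.
have bit (k : nat) : (k <= 2 * K)%N ->
    (z a ord0 < (k%:R - K%:R) * ratr q) = (z' a ord0 < (k%:R - K%:R) * ratr q).
  rewrite -ltnS => kK; have := @code_bits m z z' (pickle (a, node (Ordinal kK))) E.
  rewrite /half_space pickleK /node rmorphM rmorphB !rmorph_nat; apply.
  apply: leq_trans m0m.
  exact: (@leq_bigmax_cond _ xpredT (fun ak : 'I_N * 'I_(2 * K).+1 =>
    (pickle (ak.1, node ak.2)).+1) (a, Ordinal kK)).
pose x := z a ord0 / ratr q + K%:R.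
have zx : z a ord0 = (x - K%:R) * ratr q by rewrite /x addrK mulfVK// gt_eqF.
have : `|z a ord0 / ratr q| <= `|rho| / ratr q.
  rewrite normrM normfV (gtr0_norm q0) ler_pM2r ?invr_gt0//.
  by rewrite (le_trans (cV_entry_le z a))// (le_trans zr)// ler_norm.
rewrite ler_norml => /andP[x1 x2].
have x0 : 0 <= x by rewrite /x; move: x1 rK; lra.
have xK : x < (2 * K)%:R by rewrite natrM /x; move: x2 rK; lra.
have /andP[kx xk] := truncn_itv x0.
set k := Num.truncn x in kx xk.
have kK : (k < 2 * K)%N by rewrite -(ltr_nat R) (le_lt_trans kx).
have := bit k (ltnW kK); have := bit k.+1 kK.
rewrite zx !ltr_pM2r// !ltrD2r xk [x < k%:R]ltNge kx /= => /esym z'1 /esym/negbT.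
rewrite -leNgt => z'2.
have -> : z' a ord0 = (z' a ord0 / ratr q) * ratr q by rewrite mulfVK// gt_eqF.
rewrite -mulrBl normrM (gtr0_norm q0).
apply: le_trans (ltW qe); rewrite ger_pMl//.
move: z'1 z'2; rewrite -ltr_pdivrMr// -ler_pdivlMr// -natr1 => z'1 z'2.
rewrite ler_norml; apply/andP; split; move: xk; rewrite -natr1; lra.
Qed.

End HalfSpaceCode.

(** * Representation of a tight mean by a probability measure *)

Section Riesz.
Context (R : realType) (N : nat).
Local Notation Z := ('cV[R]_N).
Context (l : (Z -> R) -> R) (lP : is_bounded_mean l).
Hypothesis l_tight : forall e, 0 < e -> exists rho, l (fun z => (rho < `|z|)%R%:R) <= e.

Local Notation half := (half_space (R := R) (N := N)).
Local Notation code := (code half).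
Local Notation cell i := (cell_point (0 : Z) half i).
Local Notation branch := (branch half l).
Local Notation point i u := (cell i (branch i u)).

(** From level [m] on, all points attached to [u] share the code of level [m]. Since [point m u]
    lies in the ball, [code_grid] bounds their distance to it. *)
Lemma point_close (rho e : R) : 0 < e -> exists m0, forall m k (u : measurableTypeR R),
  unit_itv u -> (m0 <= m)%N -> (m <= k)%N -> `|point m u : Z| <= rho ->
  `|(point m u : Z) - point k u| <= e.
Proof.
move=> e0; have [m0 H] := @code_grid R N rho e e0.
exists m0 => m k u uI m0m mk mrho; apply: (H m) => //.
rewrite branch_code_le// branch_code_le//; rewrite /unit_itv /= in_itv /= in uI.
Qed.

(** If [z] or the representative of its cell lies in the ball, the two are close and uniform
    continuity applies; otherwise [f] vanishes at both. *)
Lemma mean_cell (f : Z -> R) (rho e : R) : continuous f ->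
  (forall z, rho < `|z| -> f z = 0) -> 0 < e ->
  exists m0, forall m, (m0 <= m)%N -> `|l (fun z => f (cell m (code m z))) - l f| <= e.
Proof.
move=> cf f0 e0.
have fb : bfun f.
  have [B B0 fB] := compact_bounded_fun (@cV_closed_ball_compact R N rho) cf.
  exists B => z; have [/fB//|/f0 ->] := leP `|z| rho.
  by rewrite normr0 ltW.
have [d d0 dP] := compact_unif_cont (@cV_closed_ball_compact R N rho) cf e0.
have d20 : 0 < d / 2 by rewrite divr_gt0.
have [m0 H] := @code_grid R N rho _ d20.
exists m0 => m m0m; apply: (bmean_dist lP) => // [|z].
  by have [B fB] := fb; exists B => z; exact: fB.
have close z1 z2 : `|z1| <= rho -> code m z1 = code m z2 -> `|f z1 - f z2| <= e.
  move=> z1r E; apply/ltW/dP => //; apply: le_lt_trans (H _ _ _ m0m z1r E) _.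
  by move: d0; lra.
have E := cell_point_code (0 : Z) half m z.
have [zr|rz] := leP `|z| rho; first by rewrite distrC; exact: close.
have [cr|rc] := leP `|cell m (code m z) : Z| rho; first exact: close.
by rewrite f0// f0// subrr normr0 ltW.
Qed.

Definition bounded_at (rho : R) m : set (measurableTypeR R) :=
  @unit_itv R `&` (fun u => `|point m u : Z|) @^-1` `]-oo, rho].

Lemma bounded_at_measurable rho m : measurable (bounded_at rho m).
Proof.
have := branch_measurable half lP m (fun j => `|cell m j : Z|).
by move=> /(_ (@measurable_unit_itv R) `]-oo, rho]%classic); apply.
Qed.

(** Those [u] whose points return infinitely often to some fixed ball. A single return at a fine
    level already confines all later points to a small neighbourhood, so the points form a Cauchy
    sequence. *)
Definition good : set (measurableTypeR R) :=
  \bigcup_(rho : nat) \bigcap_(m : nat) \bigcup_(d : nat) bounded_at rho%:R (m + d).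

Lemma good_measurable : measurable good.
Proof.
apply: bigcupT_measurable => rho; apply: bigcapT_measurable => m.
by apply: bigcupT_measurable => d; exact: bounded_at_measurable.
Qed.

Lemma good_unit : good `<=` @unit_itv R.
Proof. by move=> u [rho _ /(_ 0%N I)[d _ []]]. Qed.

Lemma good_cauchy u (e : R) : good u -> 0 < e ->
  exists M, forall m, (M <= m)%N -> `|(point M u : Z) - point m u| <= e.
Proof.
move=> gu e0; have uI := good_unit gu; move: gu => [rho _ H].
have [m0 close] := @point_close rho%:R e e0.
have [d _ [_ /=]] := H m0 I; rewrite in_itv /= => pr.
by exists (m0 + d)%N => m mm; apply: close => //; rewrite leq_addr.
Qed.

Definition limit_point (u : measurableTypeR R) : Z :=
  if u \in good then lim ((fun m => point m u : Z) @ \oo) else 0.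

Lemma limit_pointP u : good u -> (fun m => point m u : Z) @ \oo --> limit_point u.
Proof.
move=> gu; rewrite /limit_point mem_set//.
suff : cvg ((fun m => point m u : Z) @ \oo) by [].
apply: cauchy_cvg; apply: cauchy_exP => e e0.
have e20 : 0 < e / 2 by rewrite divr_gt0.
have [M H] := good_cauchy gu e20.
exists (point M u : Z); exists M => // m /= Mm; rewrite -ball_normE /=.
by apply: le_lt_trans (H m Mm) _; move: e0; lra.
Qed.

Lemma limit_point_measurable :
  measurable_fun setT (limit_point : measurableTypeR R -> borelType Z).
Proof.
apply: measurable_fun_cV => // i.
apply: (@measurable_fun_cvg _ _ _ _
  (fun m => (fun u => (point m u : Z) i ord0) \_ good)) => [m|u _].
  apply/(measurable_restrictT _ good_measurable).
  apply: (measurable_funS (@measurable_unit_itv R) good_unit).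
  exact: (branch_measurable half lP m (fun j => (cell m j : Z) i ord0)).
rewrite /patch; have [ug|/negbTE ub] := boolP (u \in good); last first.
  by rewrite /limit_point ub mxE; exact: cvg_cst.
move: ug; rewrite inE => gu.
  apply/cvgrPdist_le => e e0; near=> m.
  have : `|limit_point u - (point m u : Z)| <= e.
    by near: m; move/cvgrPdist_le : (limit_pointP gu); exact.
  by apply: le_trans; have := cV_entry_le (limit_point u - (point m u : Z)) i; rewrite !mxE.
Unshelve. all: by end_near. Qed.

(** Dominated convergence along the levels: the integrals at level [m] are means of the discretized
    [f], which tend to [l f] by [mean_cell]. *)
Lemma good_integral (f : Z -> R) (rho : R) : continuous f ->
  (forall z, rho < `|z| -> f z = 0) ->
  (\int[@unit_uniform R]_(u in good) (f (limit_point u))%:E = (l f)%:E)%E.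
Proof.
move=> cf f0.
have mU := @measurable_unit_itv R.
have mX : measurable_fun setT (fun u => f (limit_point u)).
  exact: measurableT_comp (cV_continuous_measurable cf) limit_point_measurable.
have [B B0 fB] := compact_bounded_fun (@cV_closed_ball_compact R N rho) cf.
have {}fB z : `|f z| <= B.
  by have [/fB//|/f0 ->] := leP `|z| rho; rewrite normr0 ltW.
pose F u := ((f \o limit_point) \_ good) u.
have FE : (\int[@unit_uniform R]_(u in good) (f (limit_point u))%:E =
    \int[@unit_uniform R]_(u in @unit_itv R) (F u)%:E)%E.
  rewrite -(setIidr good_unit) integral_mkcondr.
  by apply: eq_integral => u _; rewrite /F /patch /=; case: ifPn.
have fF (u : measurableTypeR R) : unit_itv u -> f (point m u : Z) @[m --> \oo] --> F u.
  move=> uI; rewrite /F /patch; have [|/negP ub] := boolP (u \in good).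
    rewrite inE => gu; apply: (cvg_comp _ _ (limit_pointP gu)); exact: cf.
  (* Off [good] the points eventually stay outside every ball, in particular the one that carries
     [f], so the limit there is 0. *)
  have [M HM] : exists M, forall d, rho < `|(point (M + d) u : Z)|.
    apply: contrapT => H; apply: ub; rewrite inE.
    exists (Num.bound `|rho|) => // m _.
    have : ~ forall d, rho < `|(point (m + d) u : Z)| by move=> H'; apply: H; exists m.
    move=> /existsNP[d /negP]; rewrite -leNgt => pd; exists d => //.
    split => //=; rewrite in_itv /= (le_trans pd)// (le_trans (ler_norm _))// ltW//.
    exact: archi_boundP.
  apply: cvg_near_cst; exists M => // m /= Mm.
  by rewrite -(subnKC Mm) f0.
have mf m : measurable_fun (@unit_itv R) (fun u => (f (point m u : Z))%:E).
  apply/measurable_EFinP.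
  exact: (branch_measurable half lP m (fun j => f (cell m j))).
have mF : measurable_fun (@unit_itv R) (fun u => (F u)%:E).
  apply/measurable_EFinP; apply: measurable_funTS.
  by apply/(measurable_restrictT _ good_measurable); exact: measurable_funTS.
have [|||_ _ cvI] := @dominated_convergence _ _ R (@unit_uniform R) (@unit_itv R) mU
  (fun m u => (f (point m u : Z))%:E) (fun u => (F u)%:E) (cst B%:E) mf mF.
- by apply: aeW => u uI; apply/cvg_EFin; [exact: nearW|exact: fF].
- exact: finite_measure_integrable_cst.
- by apply: aeW => u m _; rewrite lee_fin.
rewrite FE; apply: cvg_unique cvI _ => //.
rewrite (_ : [sequence _]_m = fun m => (l (fun z => f (cell m (code m z))))%:E); last first.
  by apply/funext => m; rewrite -(branch_integral half lP m (fun j => f (cell m j))).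
apply/cvg_EFin; first exact: nearW.
apply/cvgrPdist_le => e e0; have [m0 H] := mean_cell cf f0 e0.
by exists m0 => // m /= m0m; rewrite distrC; exact: H.
Qed.

(** Tightness enters here. A cutoff [chi] equal to 1 on a large ball has mean at least [1 - e], and
    this mean is an integral over [good] of a function at most 1. *)
Lemma good_full : @unit_uniform R good = 1%E.
Proof.
apply/eqP; rewrite eq_le; apply/andP; split.
  by rewrite probability_le1//; exact: good_measurable.
apply/lee_addgt0Pr => e e0; have [rho rhoe] := l_tight e0.
pose chi (z : Z) : R := Num.max 0 (Num.min 1 (rho + 1 - `|z|)).
have chi_cont : continuous chi.
  apply: clip_continuous => z.
  apply: (@continuousB _ _ _ (cst (rho + 1)) (fun z : Z => `|z|)).
    exact: cst_continuous.
  exact: norm_continuous.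
have chi_supp z : rho + 1 < `|z| -> chi z = 0.
  by move=> rz; apply/max_idPl; rewrite ge_min; apply/orP; right; move: rz; lra.
have chi1 z : 0 <= chi z <= 1.
  by rewrite /chi le_max lexx ge_max ler01 ge_min lexx.
have -> : (1 <= unit_uniform good + e%:E)%E = (1 - e%:E <= unit_uniform good)%E.
  by rewrite leeBlDr.
have -> : unit_uniform good = (\int[@unit_uniform R]_(u in good) (cst 1 u))%E.
  by rewrite integral_cst ?mul1e//; exact: good_measurable.
apply: (@le_trans _ _ (l chi)%:E); last first.
  rewrite -(good_integral chi_cont chi_supp); apply: ge0_le_integral => //.
  - exact: good_measurable.
  - by move=> u _; rewrite lee_fin; have /andP[] := chi1 (limit_point u).
  - apply/measurable_EFinP/measurable_funTS.
    exact: measurableT_comp (cV_continuous_measurable chi_cont) limit_point_measurable.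
  - by move=> u _; rewrite lee_fin; have /andP[] := chi1 (limit_point u).
rewrite -EFinB lee_fin -{1}(bmean_cst lP 1) lerBlDr.
have bchi : bfun chi.
  by exists 1 => z; have /andP[c0 c1] := chi1 z; rewrite ger0_norm.
have bT : bfun (fun z : Z => (rho < `|z|)%R%:R : R) by exact: bfun_bool.
apply: (@le_trans _ _ (l (fun z => chi z + (rho < `|z|)%R%:R))); last first.
  by rewrite (bmeanD lP)// lerD2l.
apply: (bmean_le lP); first exact: bfun_cst.
  have := bfun_lin 1 bchi bT; rewrite (_ : (fun z => _) = fun z => chi z + (rho < `|z|)%R%:R)//.
  by apply/funext => z; rewrite mul1r.
move=> z; have /andP[c0 c1] := chi1 z; have [zr|_] := leP `|z| rho; last by rewrite lerDr.
rewrite addr0 le_max le_min lexx orbC /=; apply/orP; left; move: zr; lra.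
Qed.

(** The measure is the law of [limit_point] under the uniform measure. The default value of
    [limit_point] off [good] is harmless, since that set is null. *)
Theorem mean_representation : exists P : probability (borelType Z) R,
  forall f : Z -> R, continuous f -> (exists rho, forall z, rho < `|z| -> f z = 0) ->
    (\int[P]_z (f z)%:E = (l f)%:E)%E.
Proof.
pose mX := isMeasurableFun.Build _ _ _ _ _ limit_point_measurable.
pose X : {mfun measurableTypeR R >-> borelType Z} :=
  HB.pack (limit_point : measurableTypeR R -> borelType Z) mX.
exists (distribution (@unit_uniform R) X) => f cf [rho f0].
have mfX := measurableT_comp (cV_continuous_measurable cf) limit_point_measurable.
have [B B0 fB] := compact_bounded_fun (@cV_closed_ball_compact R N rho) cf.
have {}fB z : `|f z| <= B.
  by have [/fB//|/f0 ->] := leP `|z| rho; rewrite normr0 ltW.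
have iX : (@unit_uniform R).-integrable setT (fun u => (f (limit_point u))%:E).
  apply: (@le_integrable _ _ _ _ _ measurableT _ (cst B%:E)).
  - by apply/measurable_EFinP; exact: mfX.
  - by move=> u _ /=; rewrite lee_fin (le_trans (fB _))// ler_norm.
  - exact: finite_measure_integrable_cst.
rewrite integral_distribution//; last first.
  by apply/measurable_EFinP; exact: cV_continuous_measurable.
rewrite -(good_integral cf f0) (@negligible_integral _ _ _ _ _ (~` good))//.
- by rewrite setTD setCK.
- by apply: measurableC; exact: good_measurable.
have H := @probability_setC _ _ _ (@unit_uniform R) good good_measurable.
apply: etrans H _.
set p := (X in (1 - X)%E); have -> : p = 1%E by exact: good_full.
by rewrite subee.
Qed.

End Riesz.

(** * Approximation by tensor splines *)

Section TruncatedPowers.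
Context (R : realType).
Implicit Types (u : R) (g : R -> R).

Definition C2_line g := exists g1 g2 : R -> R,
  [/\ forall u, is_derive u (1 : R) g (g1 u),
      forall u, is_derive u (1 : R) g1 (g2 u) & continuous g2].

Lemma is_derive_continuous g g1 : (forall u, is_derive u (1 : R) g (g1 u)) -> continuous g.
Proof.
move=> H u; apply: differentiable_continuous.
by apply/derivable1_diffP; case: (H u).
Qed.

Lemma C2_line_lin a g g' : C2_line g -> C2_line g' -> C2_line (fun u => a * g u + g' u).
Proof.
move=> [g1 [g2 [dg dg1 cg2]]] [g1' [g2' [dg' dg1' cg2']]].
exists (fun u => a * g1 u + g1' u), (fun u => a * g2 u + g2' u); split=> [u|u|u].
- exact: (@is_deriveD _ _ _ (a *: g) g').
- exact: (@is_deriveD _ _ _ (a *: g1) g1').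
- by apply: cvgD; [apply: cvgM; [exact: cvg_cst|exact: cg2]|exact: cg2'].
Qed.

Lemma is_derive_affine g g1 (k m u : R) : is_derive (k * u + m) (1 : R) g (g1 (k * u + m)) ->
  is_derive u (1 : R) (fun u => g (k * u + m)) (k * g1 (k * u + m)).
Proof.
move=> dg; have du : is_derive u (1 : R) (fun u => k * u + m) k.
  have -> : (fun u => k * u + m) = k *: id + cst m by [].
  by apply: is_derive_eq; rewrite addr0 [k *: 1]mulr1.
have := @is_derive1_comp _ g (fun u => k * u + m) u _ _ dg du.
by rewrite [g1 _ * k]mulrC.
Qed.

Lemma C2_line_affine g (k m : R) : C2_line g -> C2_line (fun u => g (k * u + m)).
Proof.
move=> [g1 [g2 [dg dg1 cg2]]].
exists (fun u => k * g1 (k * u + m)), (fun u => k * (k * g2 (k * u + m))); split=> [u|u|u].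
- exact: is_derive_affine.
- exact: (@is_deriveZ _ _ _ (fun u => g1 (k * u + m)) k _ _ _ (is_derive_affine (dg1 _))).
- do 2 (apply: cvgM; first exact: cvg_cst).
  apply: (@continuous_comp _ _ _ (fun u => k * u + m) g2); last exact: cg2.
  by apply: cvgD; [apply: cvgM; [exact: cvg_cst|exact: cvg_id]|exact: cvg_cst].
Qed.

(** Truncated powers, from which splines are built; the cube is of class C^2 across 0. *)
Definition tpow n u : R := Num.max u 0 ^+ n.

Lemma tpow_ge n u : 0 <= u -> tpow n u = u ^+ n.
Proof. by move=> u0; rewrite /tpow max_l. Qed.

Lemma tpow_le n u : u <= 0 -> tpow n.+1 u = 0.
Proof. by move=> u0; rewrite /tpow max_r// expr0n. Qed.

Lemma tpow_derive n u : is_derive u (1 : R) (tpow n.+2) (n.+2%:R * tpow n.+1 u).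
Proof.
have [u0|u0|->] := ltrgt0P u.
- apply: (@near_eq_is_derive _ _ _ (fun x : R => x ^+ n.+2)).
    near=> x; rewrite tpow_ge// ltW//; near: x; exact: lt_nbhsr.
  rewrite tpow_ge; last exact: ltW.
  have -> : (fun x : R => x ^+ n.+2) = id ^+ n.+2 by apply/funext => x; rewrite fctE.
  by apply: is_derive_eq; rewrite [_ *: 1]mulr1.
- apply: (@near_eq_is_derive _ _ _ (cst (0 : R))).
    near=> x; rewrite tpow_le// ltW//; near: x; exact: lt_nbhsl.
  by rewrite tpow_le ?ltW// mulr0; exact: is_derive_cst.
- rewrite tpow_le// mulr0.
  suff H : (fun h : R => h^-1 *: ((tpow n.+2 \o shift 0) (h *: 1) - tpow n.+2 0)) @ 0^' --> (0 : R).
    by split; [apply/cvg_ex; exists 0|exact: cvg_lim].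
  apply/cvgrPdist_le => e e0; near=> h.
  rewrite sub0r normrN /= addr0 (tpow_le _ (lexx 0)) subr0 [h *: 1]mulr1.
  have [h0|h0] := leP 0 h; last first.
    by rewrite (tpow_le _ (ltW h0)) scaler0 normr0 ltW.
  have hn0 : h != 0 by near: h; exact: nbhs_dnbhs_neq.
  rewrite tpow_ge// exprS [_ *: _]mulrA mulVf// mul1r ger0_norm ?exprn_ge0//.
  have h1 : h <= 1.
    by apply: (le_trans (ler_norm _)); near: h; apply: dnbhs0_le.
  have he : h <= e.
    by apply: (le_trans (ler_norm _)); near: h; apply: dnbhs0_le.
  by rewrite exprS (le_trans _ he)// ler_piMr// exprn_ile1.
Unshelve. all: by end_near. Qed.

Lemma C2_line_tpow3 : C2_line (tpow 3).
Proof.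
exists (fun u => 3%:R * tpow 2 u), (fun u => 3%:R * (2%:R * tpow 1 u)); split=> [u|u|u].
- exact: tpow_derive.
- exact: (@is_deriveZ _ _ _ (tpow 2) 3%:R _ _ _ (tpow_derive _ _)).
- do 2 (apply: cvgM; first exact: cvg_cst).
  rewrite /tpow; apply: (@continuous_max _ _ id (cst 0)); first exact: cvg_id.
  exact: cst_continuous.
Qed.

(** The third difference of the truncated cube divided by 3!, that is, the primitive of the
    quadratic B-spline: a C^2 step from 0 at 0 to 1 at 3. *)
Definition ramp u : R :=
  6^-1 * (tpow 3 u - 3 * tpow 3 (u - 1) + 3 * tpow 3 (u - 2) - tpow 3 (u - 3)).

Lemma C2_line_ramp : C2_line ramp.
Proof.
have T m : C2_line (fun u => tpow 3 (u - m)).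
  have := C2_line_affine 1 (- m) C2_line_tpow3.
  by under eq_fun do rewrite mul1r.
have T0 : C2_line (cst 0).
  exists (cst 0), (cst 0); split=> [u|u|]; [exact: is_derive_cst|exact: is_derive_cst|exact: cst_continuous].
have := C2_line_lin 6^-1 C2_line_tpow3 (C2_line_lin (- (6^-1 * 3)) (T 1)
  (C2_line_lin (6^-1 * 3) (T 2) (C2_line_lin (- 6^-1) (T 3) T0))).
by congr C2_line; apply/funext => u; rewrite /ramp /=; ring.
Qed.

Lemma ramp_le0 u : u <= 0 -> ramp u = 0.
Proof. by move=> u0; rewrite /ramp !tpow_le; [ring|lra..]. Qed.

Lemma ramp_ge3 u : 3 <= u -> ramp u = 1.
Proof. by move=> u3; rewrite /ramp !tpow_ge; [field|lra..]. Qed.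

(** The derivative is the quadratic B-spline; its nonnegativity is checked on each polynomial piece,
    between the knots 0, 1, 2 and 3. *)
Lemma ramp_homo u v : u <= v -> ramp u <= ramp v.
Proof.
have dr x : is_derive x (1 : R) ramp
    (2^-1 * (tpow 2 x - 3 * tpow 2 (x - 1) + 3 * tpow 2 (x - 2) - tpow 2 (x - 3))).
  have T m : is_derive x (1 : R) (fun u => tpow 3 (u - m)) (3 * tpow 2 (x - m)).
    have := @is_derive_affine (tpow 3) (fun u => 3 * tpow 2 u) 1 (- m) x.
    by under eq_fun do rewrite mul1r; rewrite !mul1r; apply; exact: tpow_derive.
  have H := @is_deriveZ _ _ _ _ 6^-1 _ _ _ (@is_deriveB _ _ _ _ _ _ _ _ _
    (@is_deriveD _ _ _ _ _ _ _ _ _ (@is_deriveB _ _ _ _ _ _ _ _ _ (tpow_derive 1 x)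
      (@is_deriveZ _ _ _ _ 3 _ _ _ (T 1)))
      (@is_deriveZ _ _ _ _ 3 _ _ _ (T 2))) (T 3)).
  by apply: is_derive_eq H _; rewrite /GRing.scale /=; field.
move=> uv; have [c _] := MVT_segment uv (fun x _ => dr x)
  (continuous_subspaceT (is_derive_continuous dr)).
set d := _^-1 * _ => E.
suff d0 : 0 <= d by rewrite -subr_ge0 E mulr_ge0// subr_ge0.
rewrite /d mulr_ge0//.
have [c0|c0] := leP c 0; first by rewrite !tpow_le; lra.
rewrite (tpow_ge 2 (ltW c0)).
have [c1|c1] := leP c 1; first by rewrite !tpow_le; [nra|lra..].
rewrite (@tpow_ge 2 (c - 1)); last by lra.
have [c2|c2] := leP c 2; first by rewrite !tpow_le; [nra|lra..].
rewrite (@tpow_ge 2 (c - 2)); last by lra.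
have [c3|c3] := leP c 3; first by rewrite !tpow_le; [nra|lra..].
rewrite tpow_ge; last by lra.
by nra.
Qed.

Lemma ramp01 u : 0 <= ramp u <= 1.
Proof.
have [u0|u0] := leP u 0; first by rewrite ramp_le0// lexx ler01.
have [u3|u3] := leP 3 u; first by rewrite ramp_ge3// lexx ler01.
by rewrite -(ramp_le0 (lexx 0)) -(ramp_ge3 (lexx 3)) !ramp_homo// ltW.
Qed.

(** The cubic B-spline, written as a difference of ramps so that sums of integer translates
    telescope. *)
Definition spline u : R := ramp (u + 1) - ramp u.

Lemma C2_line_spline : C2_line spline.
Proof.
have := C2_line_lin (-1) C2_line_ramp (C2_line_affine 1 1 C2_line_ramp).
by congr C2_line; apply/funext => u; rewrite /spline mul1r; ring.
Qed.

Lemma spline_ge0 u : 0 <= spline u.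
Proof. by rewrite subr_ge0 ramp_homo// lerDl. Qed.

Lemma spline_supp u : spline u != 0 -> -1 < u < 3.
Proof.
apply: contraR; rewrite negb_and -!leNgt => /orP[u1|u3].
  by rewrite /spline !ramp_le0 ?subrr//; lra.
by rewrite /spline !ramp_ge3 ?subrr//; lra.
Qed.

Lemma sum_spline K u : \sum_(k < 2 * K) spline (u + K%:R - k.+1%:R) =
  ramp (u + K%:R) - ramp (u - K%:R).
Proof.
pose v k := - ramp (u + K%:R - k%:R).
have -> : \sum_(k < 2 * K) spline (u + K%:R - k.+1%:R) =
    \sum_(0 <= k < 2 * K) (v k.+1 - v k).
  rewrite big_mkord; apply: eq_bigr => k _; rewrite /spline /v -natr1 opprK.
  by rewrite addrC; congr (- ramp _ + ramp _); ring.
rewrite telescope_sumr// /v natrM subr0 opprK addrC; congr (_ - ramp _); ring.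
Qed.

End TruncatedPowers.

(** * Tensor products of splines and uniform approximation *)

Section TensorSplines.
Context (R : realType) (N : nat).
Local Notation Z := ('cV[R]_N).
Implicit Types (f : Z -> R) (g : 'I_N -> R -> R).

Definition C2_cV f := exists (f1 : 'I_N -> Z -> R) (f2 : 'I_N -> 'I_N -> Z -> R),
  [/\ continuous f,
      forall i z, is_derive z (basisv R i) f (f1 i z),
      forall i, continuous (f1 i),
      forall i j z, is_derive z (basisv R j) (f1 i) (f2 i j z) &
      forall i j, continuous (f2 i j)].

Lemma C2_cV0 : C2_cV (cst 0).
Proof.
exists (fun=> cst 0), (fun _ _ => cst 0); split=> *;
  by [exact: cst_continuous|exact: is_derive_cst].
Qed.

Lemma continuous_lin (a : R) f f' : continuous f -> continuous f' ->
  continuous (fun z => a * f z + f' z).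
Proof.
move=> cf cf' z; apply: (@continuousD _ _ _ (fun z => a * f z) f'); last exact: cf'.
by apply: (@continuousM _ _ (cst a) f); [exact: cst_continuous|exact: cf].
Qed.

Lemma C2_cV_lin (a : R) f f' : C2_cV f -> C2_cV f' -> C2_cV (fun z => a * f z + f' z).
Proof.
move=> [f1 [f2 [c d1 c1 d2 c2]]] [g1 [g2 [c' d1' c1' d2' c2']]].
exists (fun i z => a * f1 i z + g1 i z), (fun i j z => a * f2 i j z + g2 i j z).
split=> [|i z|i|i j z|i j]; try exact: continuous_lin.
- exact: (@is_deriveD _ _ _ (a *: f) f').
- exact: (@is_deriveD _ _ _ (a *: f1 i) (g1 i)).
Qed.

Lemma C2_cV_sum (I : Type) (r : seq I) (F : I -> Z -> R) :
  (forall i, C2_cV (F i)) -> C2_cV (fun z => \sum_(i <- r) F i z).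
Proof.
move=> HF; elim: r => [|i r IH].
  by under eq_fun do rewrite big_nil; exact: C2_cV0.
under eq_fun do rewrite big_cons.
have := C2_cV_lin 1 (HF i) IH.
by congr C2_cV; apply/funext => z; rewrite mul1r.
Qed.

Lemma tensor_continuous g : (forall a, continuous (g a)) ->
  continuous (fun z : Z => \prod_a g a (z a ord0)).
Proof.
move=> cg; suff : forall r : seq 'I_N, continuous (fun z : Z => \prod_(a <- r) g a (z a ord0)).
  exact.
elim=> [|a r IH].
  by under eq_fun do rewrite big_nil; exact: cst_continuous.
under eq_fun do rewrite big_cons.
move=> z.
apply: (@continuousM _ _ (fun z : Z => g a (z a ord0))
  (fun z : Z => \prod_(a <- r) g a (z a ord0))); last exact: IH.
apply: (@continuous_comp _ _ _ (fun z : Z => z a ord0) (g a)); last exact: cg.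
exact: cV_entry_continuous.
Qed.

Lemma tensor_derive g (d : R -> R) i (z : Z) :
  is_derive (z i ord0) (1 : R) (g i) (d (z i ord0)) ->
  is_derive z (basisv R i) (fun z : Z => \prod_a g a (z a ord0))
    (\prod_a (if a == i then d else g a) (z a ord0)).
Proof.
move=> [dg dgE]; pose c := \prod_(a | a != i) g a (z a ord0).
have -> : \prod_a (if a == i then d else g a) (z a ord0) = d (z i ord0) * c.
  rewrite (bigD1 i)//= eqxx; congr (_ * _).
  by apply: eq_bigr => a /negbTE ->.
have E : (fun h : R => h^-1 *: (((fun z : Z => \prod_a g a (z a ord0)) \o shift z)
      (h *: basisv R i) - \prod_a g a (z a ord0))) =
    (fun h : R => (h^-1 *: ((g i \o shift (z i ord0)) (h *: 1) - g i (z i ord0))) * c).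
  apply/funext => h /=; rewrite (bigD1 i)//= [in X in _ - X](bigD1 i)//=.
  rewrite !mxE !eqxx (eq_bigr (fun a => g a (z a ord0))) => [|a /negbTE ai].
    by rewrite -mulrBl; exact: scalerAl.
  by rewrite !mxE ai mulr0 add0r.
have H : (fun h : R => (h^-1 *: ((g i \o shift (z i ord0)) (h *: 1) - g i (z i ord0))) * c)
    @ 0^' --> d (z i ord0) * c.
  by apply: cvgM; [rewrite -dgE; exact: dg|exact: cvg_cst].
split; rewrite /derivable /derive E; first by apply/cvg_ex; eexists; exact: H.
exact: cvg_lim H.
Qed.

Lemma C2_cV_tensor g : (forall a, C2_line (g a)) ->
  C2_cV (fun z => \prod_a g a (z a ord0)).
Proof.
move=> /choice[g1 /choice[g2 gP]].
have dg a u : is_derive u (1 : R) (g a) (g1 a u) by case: (gP a).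
have dg1 a u : is_derive u (1 : R) (g1 a) (g2 a u) by case: (gP a).
have cg2 a : continuous (g2 a) by case: (gP a).
have cg a := is_derive_continuous (dg a).
have cg1 a := is_derive_continuous (dg1 a).
(* Differentiation replaces one factor by its derivative; the second derivative in the same
   coordinate puts [g2] in that factor. *)
pose G1 i a := if a == i then g1 a else g a.
pose G2 i j a := if a == j then (if a == i then g2 a else g1 a) else G1 i a.
exists (fun i z => \prod_a G1 i a (z a ord0)), (fun i j z => \prod_a G2 i j a (z a ord0)).
split=> [|i z|i|i j z|i j]; try (apply: tensor_continuous => a;
  rewrite /G2 /G1; by repeat case: ifP => _).
- have := @tensor_derive g (g1 i) i z (dg i _).
  by congr (is_derive _ _ _ _); apply: eq_bigr => a _; rewrite /G1; case: eqP => // ->.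
- have := @tensor_derive (G1 i) (if j == i then g2 j else g1 j) j z.
  have dG : is_derive (z j ord0) (1 : R) (G1 i j) ((if j == i then g2 j else g1 j) (z j ord0)).
    by rewrite /G1; case: ifP.
  move=> /(_ dG); congr (is_derive _ _ _ _); apply: eq_bigr => a _; rewrite /G2.
  by case: eqP => // ->.
Qed.

Lemma C2_cV_C21 f : C2_cV f -> C21 (fun p : Z * R => f p.1).
Proof.
move=> [f1 [f2 [c d1 c1 d2 c2]]].
have lift (k : Z -> R) : continuous k -> continuous (fun p : Z * R => k p.1).
  move=> ck p; apply: (@continuous_comp _ _ _ fst k); last exact: ck.
  exact: cvg_fst.
have dlift (k k' : Z -> R) i : (forall z, is_derive z (basisv R i) k (k' z)) ->
    (forall p : Z * R, derivable (fun p => k p.1) p (dirz R i)) /\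
    'D_(dirz R i) (fun p : Z * R => k p.1) = (fun p => k' p.1).
  move=> dk; split=> [[z s]|].
    by rewrite /derivable (slice_quotient (fun p : Z * R => k p.1)); case: (dk z).
  apply/funext => -[z s]; rewrite /derive (slice_quotient (fun p : Z * R => k p.1)).
  by case: (dk z).
have E1 i := dlift _ _ i (d1 i).
have E2 i j := dlift _ _ j (d2 i j).
split.
- exact: lift.
- have E : (fun p : Z * R => (fun h : R => h^-1 *: (((fun p : Z * R => f p.1) \o shift p)
      (h *: dirt R N) - f p.1))) = (fun p h => 0).
    apply/funext => -[z s]; apply/funext => h /=.
    by rewrite scaler0 add0r subrr scaler0.
  have {}E p := congr1 (fun F => F p) E.
  split=> [p|]; first by rewrite /derivable E; exact: is_cvg_cst.
  rewrite (_ : 'D_(dirt R N) _ = cst 0); first exact: cst_continuous.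
  by apply/funext => p; rewrite /derive E; apply: cvg_lim => //; exact: cvg_cst.
- move=> i; split=> [p|]; first by case: (E1 i).
  by rewrite (E1 i).2; exact: lift.
- move=> i j; rewrite (E1 i).2; split=> [p|]; first by case: (E2 i j).
  by rewrite (E2 i j).2; exact: lift.
Qed.

(** Quasi-interpolation: values of [psi] at the nodes of a grid, weighted by tensor B-splines. The
    weights are nonnegative, sum to 1 on the ball and to at most 1 elsewhere, and each lives near
    its node, so the error is controlled by the modulus of continuity of [psi]. *)
Lemma C2_dense (psi : Z -> R) (rho e : R) : continuous psi ->
  (forall z, rho < `|z| -> psi z = 0) -> 0 < e ->
  exists f, [/\ C21 (fun p : Z * R => f p.1),
    exists rho', forall z, rho' < `|z| -> f z = 0 &
    forall z, `|f z - psi z| <= e].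
Proof.
move=> cpsi psi0 e0.
have [d d0 dP] := compact_unif_cont (@cV_closed_ball_compact R N rho) cpsi e0.
(* A B-spline reaches less than 3 meshes from its node, hence less than [d]. *)
pose r := d / 4.
have r0 : 0 < r by rewrite divr_gt0.
(* The margin 3 is the width of the ramp: at every point of the ball one ramp is already 1 and the
   other still 0. *)
pose K := (Num.bound (`|rho| / r) + 3)%N.
have rK : `|rho| / r + 3 < K%:R.
  by rewrite natrD ltrD2r archi_boundP// divr_ge0// ltW.
pose B (k : {ffun 'I_N -> 'I_(2 * K)}) (z : Z) :=
  \prod_a spline (r^-1 * z a ord0 + (K%:R - (k a).+1%:R)).
pose node (k : {ffun 'I_N -> 'I_(2 * K)}) : Z := \col_a (r * ((k a).+1%:R - K%:R)).
pose f z := \sum_k psi (node k) * B k z.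
have B0 k z : 0 <= B k z by apply: prodr_ge0 => a _; exact: spline_ge0.
have BC2 k : C2_cV (B k).
  apply: (@C2_cV_tensor (fun a u => spline (r^-1 * u + (K%:R - (k a).+1%:R)))) => a.
  exact: C2_line_affine (@C2_line_spline R).
have sumB z : \sum_k B k z =
    \prod_a (ramp (r^-1 * z a ord0 + K%:R) - ramp (r^-1 * z a ord0 - K%:R)).
  rewrite -(bigA_distr_bigA (fun a (j : 'I_(2 * K)) =>
    spline (r^-1 * z a ord0 + (K%:R - j.+1%:R)))).
  apply: eq_bigr => a _; rewrite -sum_spline.
  by apply: eq_bigr => j _; rewrite addrA.
have Bnode k z : B k z != 0 -> `|z - node k| < d.
  move=> Bk; rewrite cV_norm_lt//; apply/forallP => a; rewrite !mxE.
  have : spline (r^-1 * z a ord0 + (K%:R - (k a).+1%:R)) != 0.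
    by apply: contraNneq Bk => s0; rewrite /B (bigD1 a)//= s0 mul0r.
  move=> /spline_supp; set t := _ + _ => /andP[t1 t3].
  have -> : z a ord0 - r * ((k a).+1%:R - K%:R) = r * t.
    by rewrite /t !mulrDr mulrA mulfV ?gt_eqF//; ring.
  have -> : d = r * 4 by rewrite /r; field.
  by rewrite ltr_norml -mulrN !ltr_pM2l//; apply/andP; split; lra.
have sumB1 z : 0 <= \sum_k B k z <= 1.
  rewrite sumr_ge0//= sumB; apply: prodr_ile1 => a _.
  have /andP[a0 a1] := ramp01 (r^-1 * z a ord0 + K%:R).
  have /andP[b0 b1] := ramp01 (r^-1 * z a ord0 - K%:R).
  rewrite subr_ge0; apply/andP; split; last by lra.
  by apply: ramp_homo; have : 0 <= K%:R :> R by []; lra.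
have sumBE z : `|z| <= rho -> \sum_k B k z = 1.
  move=> zr; rewrite sumB big1// => a _.
  have : `|r^-1 * z a ord0| <= `|rho| / r.
    rewrite normrM mulrC normfV (gtr0_norm r0) ler_wpM2r ?invr_ge0 ?(ltW r0)//.
    by rewrite (le_trans (cV_entry_le z a))// (le_trans zr)// ler_norm.
  rewrite ler_norml => /andP[z1 z2].
  rewrite ramp_ge3; last by move: rK z1; lra.
  by rewrite ramp_le0 ?subr0//; move: rK z2; lra.
exists f; split.
- apply: C2_cV_C21; apply: C2_cV_sum => k.
  have := C2_cV_lin (psi (node k)) (BC2 k) C2_cV0.
  by congr C2_cV; apply/funext => z; rewrite /= addr0.
- exists (r * K%:R + d) => z zr; rewrite /f big1// => k _.
  have [->|Bk] := eqVneq (B k z) 0; first by rewrite mulr0.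
  have nk : `|node k| <= r * K%:R.
    have rK0 : 0 <= r * K%:R by rewrite mulr_ge0// ltW.
    rewrite cV_norm_le//; apply/forallP => a.
    rewrite !mxE normrM (gtr0_norm r0) ler_pM2l// ler_norml.
    have : (k a).+1%:R <= (2 * K)%:R :> R by rewrite ler_nat.
    have : 0 <= (k a).+1%:R :> R by [].
    by rewrite natrM; lra.
  have := Bnode k z Bk; have := ler_normD (z - node k) (node k).
  by rewrite subrK; move: nk zr; lra.
- move=> z; have [zr|rz] := leP `|z| rho.
    rewrite -[psi z]mul1r -(sumBE z zr) mulr_suml -sumrB.
    apply: le_trans (ler_norm_sum _ _ _) _.
    apply: (@le_trans _ _ (\sum_k e * B k z)); last by rewrite -mulr_sumr sumBE ?mulr1.
    apply: ler_sum => k _; rewrite mulrC -mulrBr normrM (ger0_norm (B0 _ _)) mulrC.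
    have [->|/Bnode zk] := eqVneq (B k z) 0; first by rewrite !mulr0.
    by rewrite ler_wpM2r// distrC ltW// dP.
  rewrite psi0// subr0 (le_trans (ler_norm_sum _ _ _))//.
  apply: (@le_trans _ _ (\sum_k e * B k z)); last first.
    by rewrite -mulr_sumr ler_piMr ?(ltW e0)//; case/andP: (sumB1 z).
  apply: ler_sum => k _; rewrite normrM (ger0_norm (B0 _ _)).
  have [->|/Bnode zk] := eqVneq (B k z) 0; first by rewrite !mulr0.
  rewrite ler_wpM2r//; have [nr|rn] := leP `|node k| rho; last first.
    by rewrite psi0// normr0 ltW.
  (* The point [z] is outside the ball, where [psi] vanishes, so a nearby node inside carries a
     small value; uniform continuity is applied at the node. *)
  rewrite -[psi _]subr0 -(psi0 z rz) ltW// dP//.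
  by rewrite distrC.
Qed.

End TensorSplines.

(** * The restarted Euler chain *)

Section GeneratorRegularity.
Context (R : realType) (N m : nat).
Variables (b : 'cV[R]_N -> R -> 'cV[R]_N).
Variables (sigma : 'cV[R]_N -> R -> 'M[R]_(N, m)).
Hypothesis b_cont : forall i, continuous (fun p : 'cV[R]_N * R => b p.1 p.2 i ord0).
Hypothesis sigma_cont :
  forall i k, continuous (fun p : 'cV[R]_N * R => sigma p.1 p.2 i k).
Implicit Types phi : 'cV[R]_N * R -> R.

Lemma sum_continuous (T : topologicalType) (I : Type) (r : seq I) (F : I -> T -> R) :
  (forall i, continuous (F i)) -> continuous (fun p => \sum_(i <- r) F i p).
Proof.
move=> cF; elim: r => [|i r IH].
  by under eq_fun do rewrite big_nil; exact: cst_continuous.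
under eq_fun do rewrite big_cons.
by move=> p; apply: (@continuousD _ _ _ (F i)); [exact: cF|exact: IH].
Qed.

Lemma diffusion_continuous i j :
  continuous (fun p : 'cV[R]_N * R => diffusion sigma p.1 p.2 i j).
Proof.
rewrite (_ : (fun p => _) = fun p : 'cV[R]_N * R =>
    2^-1 * \sum_k sigma p.1 p.2 i k * sigma p.1 p.2 j k); last first.
  apply/funext => p; rewrite /diffusion !mxE; congr (_ * _).
  by apply: eq_bigr => k _; rewrite mxE.
move=> p; apply: cvgM; first exact: cvg_cst.
apply: (@sum_continuous _ _ _ (fun k p => sigma p.1 p.2 i k * sigma p.1 p.2 j k)) => k q.
by apply: cvgM; exact: sigma_cont.
Qed.

Lemma generator_continuous phi : C21 phi -> continuous (generator b sigma phi).
Proof.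
move=> [_ [_ ct] d1 d2] p; rewrite /generator.
apply: cvgD; first apply: cvgD; first exact: ct.
  apply: (@sum_continuous _ _ _ (fun i p => \sum_j diffusion sigma p.1 p.2 i j *
    'D_(dirz R j) ('D_(dirz R i) phi) p)) => i.
  apply: sum_continuous => j q.
  by apply: cvgM; [exact: diffusion_continuous|exact: (d2 i j).2].
apply: (@sum_continuous _ _ _ (fun i p => b p.1 p.2 i ord0 * 'D_(dirz R i) phi p)) => i q.
by apply: cvgM; [exact: b_cont|exact: (d1 i).2].
Qed.

Lemma derive_supp phi rho (v : 'cV[R]_N * R) : (forall z s, rho < `|z| -> phi (z, s) = 0) ->
  forall z s, rho < `|z| -> 'D_v phi (z, s) = 0.
Proof.
move=> H z s rz; rewrite -(derive_cst 0 (z, s) v); apply/esym.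
have [->|v0] := eqVneq v 0; first by rewrite !derive0.
apply: near_eq_derive.
have e0 : 0 < `|z| - rho by rewrite subr_gt0.
exists (ball z (`|z| - rho), setT) => /=.
  by split; [exact: nbhsx_ballx|exact: filterT].
move=> -[z' s'] /= [+ _]; rewrite -ball_normE /= => zz'; rewrite H//.
by have := ler_normD (z - z') z'; rewrite subrK; move: zz'; lra.
Qed.

Lemma generator_supp phi rho : (forall z s, rho < `|z| -> phi (z, s) = 0) ->
  forall z s, rho < `|z| -> generator b sigma phi (z, s) = 0.
Proof.
move=> H z s rz; have D1 v := derive_supp v H.
rewrite /generator D1// add0r !big1 ?addr0// => i _; first by rewrite D1// mulr0.
by rewrite big1// => j _; rewrite (derive_supp (dirz R j) (D1 (dirz R i)))// mulr0.
Qed.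

End GeneratorRegularity.

Lemma nat_above (R : realType) (x : R) :
  exists n : nat, forall k, (n <= k)%N -> x < k%:R.
Proof.
exists (Num.bound `|x|) => k xk; apply: le_lt_trans (ler_norm x) _.
by apply: lt_le_trans (archi_boundP _) _; rewrite ?ler_nat.
Qed.

Section RestartedEulerChain.
Context (R : realType) (N m : nat).
Local Notation Z := ('cV[R]_N).
Variables (b : Z -> R -> Z) (sigma : Z -> R -> 'M[R]_(N, m)).
Hypothesis b_cont : forall i, continuous (fun p : Z * R => b p.1 p.2 i ord0).
Hypothesis sigma_cont : forall i k, continuous (fun p : Z * R => sigma p.1 p.2 i k).
Variables (T : R) (T0 : 0 < T).
Hypothesis b_per : forall z t, b z (t + T) = b z t.
Hypothesis sigma_per : forall z t, sigma z (t + T) = sigma z t.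

Variables (U W : Z -> R) (a : R).
Hypotheses (W0 : forall z, 0 <= W z) (WU : forall z, W z <= U z) (Ua : U 0 <= a).
Hypothesis U_bounded : forall rho, exists S, forall z, `|z| <= rho -> U z <= S.
Hypothesis W_coercive : forall w, exists rho, forall z, W z <= w -> `|z| <= rho.
(** A drift condition on the discrete scheme itself. The admissible step may depend on the ball,
    which leaves room for coefficients of superlinear growth. *)
Hypothesis U_drift : forall rho, exists2 h0, 0 < h0 & forall h z s,
  0 < h <= h0 -> `|z| <= rho -> euler b sigma h s U z <= U z + h * (a - W z).

Lemma steps_exist (k : nat) : exists K : nat,
  [/\ (0 < K)%N, T / K%:R <= k.+1%:R^-1,
      forall z s xi, `|z| <= k%:R -> `|s| <= k%:R ->
        `|increment b sigma (T / K%:R) z s xi| <= 1 &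
      forall z s, `|z| <= k%:R ->
        euler b sigma (T / K%:R) s U z <= U z + (T / K%:R) * (a - W z)].
Proof.
have [D D0 incD] := increment_bound b_cont sigma_cont k%:R k%:R.
have [h0 h00 Uh] := U_drift k%:R.
(* Increments are at most [sqrt h * D], so [h <= D ^- 2] makes them at most 1. *)
pose e := Num.min (Num.min k.+1%:R^-1 h0) (D ^- 2).
have e0 : 0 < e by rewrite !lt_min !invr_gt0 exprn_gt0// h00 ltr0n.
pose K := (Num.bound (T / e)).+1.
have K0 : 0 < K%:R :> R by [].
have he : T / K%:R <= e.
  rewrite ler_pdivrMr// mulrC -ler_pdivrMr//.
  apply: ltW; apply: lt_trans (archi_boundP _) _; first by rewrite divr_ge0// ltW.
  by rewrite ltr_nat.
have hpos : 0 < T / K%:R by rewrite divr_gt0.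
move: (he); rewrite !le_min => /andP[/andP[hk hh0] hD].
have h1 : T / K%:R <= 1 by rewrite (le_trans hk)// invf_le1// ler1n.
exists K; split=> // [z s xi zk sk|z s zk].
  apply: le_trans (incD _ _ _ _ _ zk sk) _; first by rewrite ltW.
  rewrite -ler_pdivlMr// mul1r -[leRHS]ger0_norm ?invr_ge0 ?(ltW D0)// -sqrtr_sqr.
  by apply: ler_wsqrtr; rewrite exprVn.
by apply: Uh => //; rewrite hpos.
Qed.

Variable K : nat -> nat.
Hypothesis K_gt0 : forall k, (0 < K k)%N.
Let h k := T / (K k)%:R.
Hypothesis h_small : forall k, h k <= k.+1%:R^-1.
Hypothesis small_increment : forall k z s xi, `|z| <= k%:R -> `|s| <= k%:R ->
  `|increment b sigma (h k) z s xi| <= 1.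
Hypothesis h_drift : forall k z s, `|z| <= k%:R ->
  euler b sigma (h k) s U z <= U z + h k * (a - W z).

(** The start at [- k T] recedes with [k], so a fixed time ends up arbitrarily many periods after
    it; as it is a multiple of the period, phases are preserved. *)
Definition time k i : R := i%:R * h k - k%:R * T.

(* The restart keeps the drift inequality, since [W <= U] and [U 0 <= a]. *)
Definition transition k i (f : Z -> R) z : R :=
  if `|z| <= k%:R then euler b sigma (h k) (time k i) f z
  else (1 - h k) * f z + h k * f 0.

Definition period_avg k i := avg (0 : Z) (transition k) (K k) k.+1 i.

Lemma h_gt0 k : 0 < h k.
Proof. by rewrite divr_gt0// ltr0n. Qed.

Lemma h_le1 k : h k <= 1.
Proof. by rewrite (le_trans (h_small k))// invf_le1// ler1n. Qed.

Lemma hK k : h k * (K k)%:R = T.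
Proof. by rewrite mulfVK// pnatr_eq0 -lt0n. Qed.

Lemma timeS k i : time k i.+1 = time k i + h k.
Proof. by rewrite /time -natr1; ring. Qed.

Lemma time_period k i : time k (i + K k) = time k i + T.
Proof. by rewrite /time natrD mulrDl [(K k)%:R * _]mulrC hK; ring. Qed.

Lemma transition_markov k i : is_markov (transition k i).
Proof.
move=> z; rewrite /transition; case: (`|z| <= k%:R); first exact: euler_markov.
apply: (mean_mix (l := fun f => f z) (l' := fun f => f 0)); last 2 first.
- exact: mean_point.
- exact: mean_point.
by rewrite ltW ?h_gt0// h_le1.
Qed.

Lemma transition_period k i : transition k (i + K k) = transition k i.
Proof.
apply/funext => f; apply/funext => z; rewrite /transition; case: ifP => // _.
rewrite time_period /euler; congr sign_mean; apply/funext => xi.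
by rewrite /increment b_per sigma_per.
Qed.

Lemma transition_drift k i z : transition k i U z <= U z + h k * (a - W z).
Proof.
rewrite /transition; case: ifP => zk; first exact: h_drift.
have : h k * W z <= h k * U z by rewrite ler_wpM2l// ltW// h_gt0.
have : h k * U 0 <= h k * a by rewrite ler_wpM2l// ltW// h_gt0.
by lra.
Qed.

Lemma period_avg_mean k i : is_mean (period_avg k i).
Proof. by apply: avg_mean => // j; exact: transition_markov. Qed.

Lemma a_ge0 : 0 <= a.
Proof. by rewrite (le_trans _ Ua)// (le_trans (W0 0)). Qed.

(** Markov's inequality for the cap [min U r]: outside a sublevel set of [W] the cap equals [r], and
    [avg_tight] bounds its mean by [e * r]. *)
Lemma period_avg_tight (tau e : R) : 0 < e -> exists rho k0, forall k i,
  (k0 <= k)%N -> `|time k i| <= tau ->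
  period_avg k i (fun z => (rho < `|z|)%R%:R) <= e.
Proof.
move=> e0; pose B := U 0 + a * (`|tau| + T + T) + 1.
have U00 : 0 <= U 0 by rewrite (le_trans (W0 0)).
have B0 : 0 < B by rewrite ltr_wpDl// addr_ge0// mulr_ge0 ?a_ge0// !addr_ge0// ltW.
(* The order of choice matters: [w] makes the term proportional to [r] equal to [e * r * T / 2],
   then [S] depends on [w], and [r] is finally large enough to absorb [a * T + S]. *)
pose w := 2 * B / (e * T).
have w0 : 0 < w by rewrite divr_gt0 ?mulr_gt0.
have [rhow Hw] := W_coercive w; have [S' HS'] := U_bounded rhow.
pose S := `|S'|; have S0 : 0 <= S := normr_ge0 _.
have HS z : W z <= w -> U z <= S by move=> /Hw/HS' US; exact: le_trans US (ler_norm _).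
pose r := 2 * (a * T + S + 1) / e.
have r0 : 0 < r by rewrite divr_gt0// mulr_gt0// ltr_wpDl// addr_ge0// mulr_ge0 ?a_ge0// ltW.
have [rho Hrho] := W_coercive r.
(* From this [k] on, times in the window lie at least one period after the start, which is the
   condition [K k <= i] of [avg_tight]. *)
exists rho, (Num.bound ((`|tau| + T) / T)).+1 => k i k0k itau.
have kT : `|tau| + T <= k%:R * T.
  rewrite -ler_pdivrMr//; apply: ltW; apply: lt_trans (archi_boundP _) _.
    by rewrite divr_ge0 ?addr_ge0// ltW.
  by rewrite ltr_nat.
have itau' : `|time k i| <= `|tau| by rewrite (le_trans itau)// ler_norm.
have ih : i%:R * h k = time k i + k%:R * T by rewrite /time; ring.
have Ki : (K k <= i)%N.
  rewrite -(ler_nat R) -(ler_pM2r (h_gt0 k)) ih mulrC hK.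
  by move: itau'; rewrite ler_norml => /andP[]; lra.
have := @avg_tight R Z 0 (transition k) (@transition_markov k) (K k) k.+1 isT
  (@transition_period k) (h k) a U W (ltW (h_gt0 k)) a_ge0 W0 WU (@transition_drift k)
  i r w S Ki (ltW r0) w0 S0 HS.
rewrite hK -/(period_avg k i).
(* The time elapsed is at most [tau] plus [2 k + 1] periods; divided by [k.+1] periods averaged, the
   accumulated drift stays bounded in [k]. *)
have XB : (U 0 + h k * a * (i + k.+1 * K k)%:R) / k.+1%:R <= B.
  rewrite natrD natrM mulrDr.
  have -> : h k * a * i%:R = a * (time k i + k%:R * T) by rewrite -ih; ring.
  have -> : h k * a * (k.+1%:R * (K k)%:R) = a * k.+1%:R * T by rewrite -(hK k); ring.
  rewrite ler_pdivrMr//.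
  have aT : 0 <= a * T by rewrite mulr_ge0 ?a_ge0// ltW.
  have : a * time k i <= a * `|tau|.
    by rewrite ler_wpM2l ?a_ge0// (le_trans (ler_norm _)).
  have : 0 <= a * `|tau| by rewrite mulr_ge0 ?a_ge0.
  have k0 : 0 <= k%:R :> R by [].
  have : 0 <= U 0 * k%:R by rewrite mulr_ge0.
  have : 0 <= a * `|tau| * k%:R by rewrite !mulr_ge0 ?a_ge0.
  have : 0 <= a * T * k%:R by rewrite mulr_ge0.
  by rewrite /B -natr1; nra.
move=> H; pose f z := Num.min (U z) r.
have {}H : T * period_avg k i f <= a * T ^+ 2 + T * S + r / w * B.
  apply: le_trans H _; rewrite lerD2l ler_wpM2l// divr_ge0// ltW//.
have {}H : period_avg k i f <= e * r.
  rewrite -(ler_pM2l T0); apply: le_trans H _.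
  have -> : r / w * B = e * r * T / 2 by rewrite /w; field; rewrite !gt_eqF.
  have : a * T + S <= e * r / 2.
    have -> : e * r / 2 = a * T + S + 1 by rewrite /r; field; rewrite gt_eqF.
    by lra.
  by move=> /(ler_wpM2l (ltW T0)); lra.
apply: (@le_trans _ _ (period_avg k i (fun z => r^-1 * f z))); last first.
  by rewrite (meanZ (period_avg_mean k i)) mulrC ler_pdivrMr.
apply: (mean_le (period_avg_mean k i)) => z; case: ltP => zr.
  rewrite mulrC ler_pdivlMr// mul1r /f le_min lexx andbT.
  apply: le_trans (WU z); apply: ltW; rewrite ltNge; apply/negP => /Hrho.
  by rewrite leNgt zr.
rewrite mulr_ge0 ?invr_ge0 ?(ltW r0)// /f le_min (ltW r0) andbT.
exact: le_trans (W0 z) (WU z).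
Qed.

(** Three regions: near the support the Euler step is consistent; between it and the ball of radius
    [k] both sides vanish; beyond, a restart brings mass to the origin with probability [h k], an
    error of at most [h k * B] on a set whose mass is small by tightness. *)
Lemma avg_step phi rho (tau e : R) : C21 phi ->
  (forall z s, rho < `|z| -> phi (z, s) = 0) -> 0 < e ->
  exists k0, forall k i, (k0 <= k)%N -> `|time k i| <= tau ->
  `|period_avg k i.+1 (fun z => phi (z, time k i.+1))
    - period_avg k i (fun z => phi (z, time k i))
    - h k * period_avg k i (fun z => generator b sigma phi (z, time k i))| <= e * h k.
Proof.
move=> phiC phi0 e0; have e2 : 0 < e / 2 by rewrite divr_gt0.
have [phic _ _ _] := phiC.
(* The extra unit of radius matches the bound 1 on increments: from farther out one step cannot
   reach the support. *)
have [h0 h00 Hh0] := euler_consistent b_cont sigma_cont (`|rho| + 1) tau phiC e2.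
have [B B0 HB] := compact_bounded_fun (@spacetime_box_compact R N `|rho| (`|tau| + 1)) phic.
have eB : 0 < e / 2 / B by rewrite divr_gt0.
have [rho1 [k1 Hrho1]] := period_avg_tight tau eB.
have [n1 Hn1] := nat_above (`|rho| + 1); have [n2 Hn2] := nat_above `|rho1|.
have [n3 Hn3] := nat_above `|tau|; have [n4 Hn4] := nat_above h0^-1.
exists (maxn k1 (maxn n1 (maxn n2 (maxn n3 n4)))) => k i.
rewrite !geq_max => /and5P[k1k /Hn1 krho /Hn2 krho1 /Hn3 ktau /Hn4 kh0] itau.
have hh0 : 0 < h k <= h0.
  rewrite h_gt0/= (le_trans (h_small k))// -[leRHS]invrK lef_pV2 ?posrE ?invr_gt0//.
  by rewrite -natr1 ler_wpDr// ltW.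
have hk0 := h_gt0 k; have hk1 := h_le1 k.
have itau' : `|time k i| <= `|tau| by rewrite (le_trans itau)// ler_norm.
pose L z := generator b sigma phi (z, time k i).
pose q (z : Z) : R := h k * (e / 2) + h k * B * (rho1 < `|z|)%R%:R.
have rhole : rho <= `|rho| := ler_norm rho.
have phiB z : `|phi (z, time k i.+1)| <= B.
  have [zr|rz] := leP `|z| `|rho|; last by rewrite phi0 ?normr0 ?(ltW B0)// (le_lt_trans rhole).
  apply: (HB (z, _)); split => //=; rewrite timeS.
  by rewrite (le_trans (ler_normD _ _))// lerD// ger0_norm// ltW.
have pointwise z : `|transition k i (fun z => phi (z, time k i.+1)) z
    - (phi (z, time k i) + h k * L z)| <= q z.
  rewrite opprD addrA /transition /q.
  have ind0 : 0 <= h k * B * (rho1 < `|z|)%R%:R by rewrite !mulr_ge0// ltW.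
  have [zr|rz] := leP `|z| (`|rho| + 1).
    rewrite (le_trans zr (ltW krho)) timeS.
    apply: le_trans (Hh0 (h k) z (time k i) hh0 zr itau) _.
    by rewrite mulrC lerDl.
  have rz' : rho < `|z| by move: rhole rz; lra.
  rewrite phi0// /L (generator_supp _ _ phi0)// mulr0 !subr0.
  have he2 : 0 <= h k * (e / 2) by rewrite mulr_ge0// ltW.
  have [zk|kz] := leP `|z| k%:R.
    rewrite /euler (_ : (fun xi => _) = fun=> 0).
      by rewrite (mean0 (sign_mean_mean R m)) normr0 addr_ge0.
    apply/funext => xi; apply: phi0.
    have := small_increment xi zk (le_trans itau' (ltW ktau)).
    have := ler_normB (z + increment b sigma (h k) z (time k i) xi)
      (increment b sigma (h k) z (time k i) xi).
    by rewrite addrK; move: rhole rz; lra.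
  rewrite phi0// mulr0 add0r (_ : (rho1 < `|z|)%R = true); last first.
    by rewrite (lt_trans _ kz)// (le_lt_trans (ler_norm _)).
  rewrite mulr1 normrM (gtr0_norm hk0) ler_wpDl// ler_wpM2l// ltW//.
have PM := period_avg_mean k i.
have E : period_avg k i.+1 (fun z => phi (z, time k i.+1)) =
    period_avg k i (transition k i (fun z => phi (z, time k i.+1))).
  exact: (avgS _ _ (@transition_period k)).
rewrite E -addrA -opprD -(meanZ PM) -(meanD PM).
apply: le_trans (mean_dist PM pointwise) _.
rewrite /q (meanD PM) (mean_cst PM) (meanZ PM).
have : B * period_avg k i (fun z => (rho1 < `|z|)%R%:R) <= e / 2.
  by rewrite mulrC -ler_pdivlMr// Hrho1.
by move=> /(ler_wpM2l (ltW hk0)); lra.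
Qed.

Lemma time_sub k i j : time k j - time k i = (j%:R - i%:R) * h k.
Proof. by rewrite /time; ring. Qed.

Lemma time_between k i j r (t d : R) : (i <= r)%N -> (r <= j)%N ->
  `|time k i - t| <= d -> `|time k j - t| <= d -> `|time k r - t| <= d.
Proof.
move=> ir rj; rewrite !ler_norml => /andP[i1 i2] /andP[j1 j2].
have : 0 <= time k r - time k i by rewrite time_sub mulr_ge0 ?subr_ge0 ?ler_nat// ltW// h_gt0.
have : 0 <= time k j - time k r by rewrite time_sub mulr_ge0 ?subr_ge0 ?ler_nat// ltW// h_gt0.
by move=> *; apply/andP; split; lra.
Qed.

(** For [f] independent of time, summing [avg_step] with error 1 gives the Lipschitz constant
    [B + 1], where [B] bounds the generator of [f]. *)
Lemma avg_lipschitz (f : Z -> R) rho t : C21 (fun p : Z * R => f p.1) ->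
  (forall z, rho < `|z| -> f z = 0) ->
  exists C k0, 0 < C /\ forall k i j, (k0 <= k)%N ->
    `|time k i - t| <= 1 -> `|time k j - t| <= 1 ->
    `|period_avg k j f - period_avg k i f| <= C * `|time k j - time k i|.
Proof.
move=> fC f0; pose phi (p : Z * R) := f p.1; pose tau := `|t| + 1.
have phi0 z s : rho < `|z| -> phi (z, s) = 0 by exact: f0.
have [B B0 HB] := compact_bounded_fun (@spacetime_box_compact R N `|rho| tau)
  (generator_continuous b_cont sigma_cont fC).
have [k0 Hk0] := avg_step tau fC phi0 ltr01.
exists (B + 1), k0; split; first by rewrite addr_gt0.
suff H k i j : (i <= j)%N -> (k0 <= k)%N ->
    `|time k i - t| <= 1 -> `|time k j - t| <= 1 ->
    `|period_avg k j f - period_avg k i f| <= (B + 1) * (time k j - time k i).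
  move=> k i j k0k it jt; have [ij|ji] := leqP i j.
    by rewrite (le_trans (H k i j ij k0k it jt))// ler_wpM2l ?ler_norm// addr_ge0// ltW.
  rewrite distrC [in leRHS]distrC (le_trans (H k j i (ltnW ji) k0k jt it))//.
  by rewrite ler_wpM2l ?ler_norm// addr_ge0// ltW.
move=> + k0k it; elim: j => [|j IH] ij jt.
  by move: ij; rewrite leqn0 => /eqP ->; rewrite !subrr normr0 mulr0.
move: ij; rewrite leq_eqVlt => /predU1P[->|]; first by rewrite !subrr normr0 mulr0.
rewrite ltnS => ij; have jt' := time_between ij (leqnSn j) it jt.
have jtau : `|time k j| <= tau.
  by have := ler_normD (time k j - t) t; rewrite subrK /tau; move: jt'; lra.
have := IH ij jt'; have := Hk0 k j k0k jtau; rewrite /= timeS.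
set X := period_avg k j.+1 f; set Y := period_avg k j f.
set V := period_avg k j _; set V0 := period_avg k i f => H1 H2.
have VB : `|V| <= B.
  apply: (mean_bnd (period_avg_mean k j)) => z.
  have [zr|rz] := leP `|z| `|rho|; first by apply: (HB (z, _)); split.
  by rewrite (generator_supp _ _ phi0) ?normr0 ?(ltW B0)// (le_lt_trans (ler_norm rho)).
have : `|h k * V| <= h k * B.
  by rewrite normrM (gtr0_norm (h_gt0 k)) ler_wpM2l// ltW// h_gt0.
have -> : X - V0 = (X - Y - h k * V) + (Y - V0) + h k * V by ring.
move=> H3; apply: le_trans (ler_normD _ _) _.
have := ler_normD (X - Y - h k * V) (Y - V0).
by move: H1 H2 H3; lra.
Qed.

(** The Lipschitz bound holds for smooth functions, whereas the generator of a test function is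
    merely continuous; it is approximated uniformly by a smooth function, frozen at time [t]. *)
Lemma avg_equicontinuous psi rho t (e : R) : continuous psi ->
  (forall z s, rho < `|z| -> psi (z, s) = 0) -> 0 < e ->
  exists d k0, 0 < d /\ forall k i j, (k0 <= k)%N ->
    `|time k i - t| <= d -> `|time k j - t| <= d ->
    `|period_avg k i (fun z => psi (z, time k i))
      - period_avg k j (fun z => psi (z, time k j))| <= e.
Proof.
move=> cpsi psi0 e0; have e6 : 0 < e / 6 by rewrite divr_gt0.
have [f [fC [rho' f0] fpsi]] := C2_dense (slice_continuous (s := t) cpsi) (fun z => psi0 z t) e6.
have [C [k0 [C0 HC]]] := avg_lipschitz t fC f0.
have [d1 d10 Hd1] := @uniform_modulus R N `|rho| `|t| unit (fun=> psi) _ (fun=> cpsi) e6.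
(* Each end costs [e / 6] for freezing the time and [e / 6] for smoothing; the middle term costs at
   most [2 * C * d <= e / 3]. *)
pose d := Num.min 1 (Num.min (d1 / 2) (e / 6 / C)).
have d0 : 0 < d by rewrite !lt_min ltr01 !divr_gt0.
have dd1 : d < d1.
  apply: (@le_lt_trans _ _ (d1 / 2)); first by rewrite /d !ge_min lexx !orbT.
  by rewrite ltr_pdivrMr// ltr_pMr// ltr1n.
have d1' : d <= 1 by rewrite /d ge_min lexx.
have dC : C * d <= e / 6.
  by rewrite mulrC -ler_pdivlMr// /d !ge_min lexx !orbT.
exists d, k0; split => // k i j k0k it jt.
have close r : `|time k r - t| <= d ->
    `|period_avg k r (fun z => psi (z, time k r)) - period_avg k r f| <= e / 3.
  move=> rt; rewrite -[leRHS](mean_cst (period_avg_mean k r)).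
  apply: (mean_dist (period_avg_mean k r)) => z.
  have : `|psi (z, time k r) - psi (z, t)| <= e / 6.
    have [zr|rz] := leP `|z| `|rho|; last first.
      by rewrite !psi0 ?subrr ?normr0 ?(ltW e6)// (le_lt_trans (ler_norm rho)).
    have := Hd1 tt z t 0 (time k r - t) zr (lexx _).
    rewrite normr0 addr0 subrKC; apply => //; exact: le_lt_trans rt dd1.
  have := fpsi z; rewrite distrC => H1 H2.
  rewrite -(subrKA (psi (z, t))) (le_trans (ler_normD _ _))//.
  by move: H1 H2; lra.
have := close i it; have := close j jt; rewrite distrC => Hj Hi.
have := HC k j i k0k (le_trans jt d1') (le_trans it d1').
have : `|time k i - time k j| <= 2 * d.
  rewrite -(subrKA t) (le_trans (ler_normD _ _))// [`|t - _|]distrC.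
  by move: it jt; lra.
move=> /(ler_wpM2l (ltW C0)) H1 H2.
set X := period_avg k i (fun z => psi _) in Hi *.
set Y := period_avg k j (fun z => psi _) in Hj *.
have -> : X - Y = (X - period_avg k i f) + (period_avg k i f - period_avg k j f)
    + (period_avg k j f - Y) by ring.
apply: le_trans (ler_normD _ _) _.
have := ler_normD (X - period_avg k i f) (period_avg k i f - period_avg k j f).
by move: Hi Hj H1 H2 dC; lra.
Qed.

(** Summation of [avg_step], with the generator term replaced at every step by its value at one
    nearby index [r]. Half of [e] pays for the steps, half for this replacement. *)
Lemma avg_derivative phi rho t (e : R) : C21 phi ->
  (forall z s, rho < `|z| -> phi (z, s) = 0) -> 0 < e ->
  exists d k0, 0 < d /\ forall k i j r, (k0 <= k)%N -> (i <= j)%N ->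
    `|time k i - t| <= d -> `|time k j - t| <= d -> `|time k r - t| <= d ->
    `|period_avg k j (fun z => phi (z, time k j))
      - period_avg k i (fun z => phi (z, time k i))
      - (time k j - time k i) *
          period_avg k r (fun z => generator b sigma phi (z, time k r))|
    <= e * (time k j - time k i).
Proof.
move=> phiC phi0 e0; have e2 : 0 < e / 2 by rewrite divr_gt0.
have L0 := generator_supp b sigma phi0.
have [d1 [k1 [d10 H1]]] := avg_equicontinuous t
  (generator_continuous b_cont sigma_cont phiC) L0 e2.
have [k2 H2] := avg_step (`|t| + 1) phiC phi0 e2.
exists (Num.min d1 1), (maxn k1 k2); split; first by rewrite lt_min d10 ltr01.
move=> k i j r; rewrite geq_max => /andP[k1k k2k] + it + rt.
elim: j => [|j IH] ij jt.
  by move: ij; rewrite leqn0 => /eqP ->; rewrite !subrr mul0r subr0 normr0 mulr0.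
move: ij; rewrite leq_eqVlt => /predU1P[->|].
  by rewrite !subrr mul0r subr0 normr0 mulr0.
rewrite ltnS => ij; have jt' := time_between ij (leqnSn j) it jt.
have jtau : `|time k j| <= `|t| + 1.
  have : `|time k j - t| <= 1 by rewrite (le_trans jt')// ge_min lexx orbT.
  by have := ler_normD (time k j - t) t; rewrite subrK; lra.
have := IH ij jt'; have := H2 k j k2k jtau.
have := H1 k j r k1k; move=> /(_ (le_trans jt' _))/(_ (le_trans rt _)).
rewrite ge_min lexx => /(_ isT isT).
set X := period_avg k j.+1 _; set Y := period_avg k j (fun z => phi _).
set V := period_avg k j _; set V' := period_avg k r _; set X0 := period_avg k i _.
rewrite timeS => G1 G2 G3; have hk := h_gt0 k.
have : `|h k * (V - V')| <= h k * (e / 2) by rewrite normrM (gtr0_norm hk) ler_wpM2l// ltW.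
have -> : X - X0 - (time k j + h k - time k i) * V' =
  (X - Y - h k * V) + (Y - X0 - (time k j - time k i) * V') + h k * (V - V') by ring.
move=> G4; apply: le_trans (ler_normD _ _) _.
have := ler_normD (X - Y - h k * V) (Y - X0 - (time k j - time k i) * V').
by move: G2 G3 G4; lra.
Qed.

End RestartedEulerChain.

(** * Limit along an ultrafilter *)

Section UltraLimit.
Context (R : realType) (N m : nat).
Local Notation Z := ('cV[R]_N).
Variables (b : Z -> R -> Z) (sigma : Z -> R -> 'M[R]_(N, m)).
Variables (T : R) (T0 : 0 < T) (K : nat -> nat).
Hypothesis K_gt0 : forall k, (0 < K k)%N.
Let h k := T / (K k)%:R.
Hypothesis h_small : forall k, h k <= k.+1%:R^-1.
Hypothesis generator_cont : forall phi, C21 phi -> continuous (generator b sigma phi).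

Variable a : nat -> nat -> (Z -> R) -> R.
Hypothesis a_mean : forall k i, is_mean (a k i).
Hypothesis a_shift : forall k i f B, (forall z, `|f z| <= B) ->
  `|a k (i + K k) f - a k i f| <= 2 * B / k.+1%:R.
Hypothesis a_tight : forall (tau e : R), 0 < e -> exists rho k0, forall k i,
  (k0 <= k)%N -> `|time T K k i| <= tau -> a k i (fun z => (rho < `|z|)%R%:R) <= e.
Hypothesis a_equicontinuous : forall psi rho t (e : R), continuous psi ->
  (forall z s, rho < `|z| -> psi (z, s) = 0) -> 0 < e ->
  exists d k0, 0 < d /\ forall k i j, (k0 <= k)%N ->
    `|time T K k i - t| <= d -> `|time T K k j - t| <= d ->
    `|a k i (fun z => psi (z, time T K k i)) - a k j (fun z => psi (z, time T K k j))| <= e.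
Hypothesis a_derivative : forall phi rho t (e : R), C21 phi ->
  (forall z s, rho < `|z| -> phi (z, s) = 0) -> 0 < e ->
  exists d k0, 0 < d /\ forall k i j r, (k0 <= k)%N -> (i <= j)%N ->
    `|time T K k i - t| <= d -> `|time T K k j - t| <= d -> `|time T K k r - t| <= d ->
    `|a k j (fun z => phi (z, time T K k j)) - a k i (fun z => phi (z, time T K k i))
      - (time T K k j - time T K k i) *
          a k r (fun z => generator b sigma phi (z, time T K k r))|
    <= e * (time T K k j - time T K k i).

Implicit Types psi phi : Z * R -> R.

Variable F : set_system nat.
Context {FU : UltraFilter F}.
Hypothesis oo_F : \oo `<=` F.

Lemma ultra_eventually (P : nat -> Prop) k0 : (forall k, (k0 <= k)%N -> P k) ->
  \forall k \near F, P k.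
Proof. by move=> HP; apply: oo_F; exists k0. Qed.

(** A bounded sequence has a cluster point along the ultrafilter by compactness, and an ultrafilter
    converges to its cluster points. *)
Lemma ultra_cvg (s : nat -> R) B : (forall k, `|s k| <= B) -> cvg (s @ F).
Proof.
move=> sB; have cB : compact `[- B, B] by exact: segment_compact.
have sFB : F (s @^-1` `[- B, B]%classic).
  by apply: filterE => k /=; rewrite in_itv /= -ler_norml.
have [p [_ clp]] := cB (s @ F) _ sFB.
apply/cvg_ex; exists p => V Vp; rewrite /= nbhs_simpl.
have [//|FC] := in_ultra_setVsetC (s @^-1` V) FU.
by have [x [/= nVx Vx]] := clp (~` V) V FC Vp.
Qed.

Definition index k (t : R) : nat := Num.truncn ((t + k%:R * T) / h k).

Let h_gt0 k : 0 < h k.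
Proof. by rewrite divr_gt0// ltr0n. Qed.

Lemma index_close t (d : R) : 0 < d -> exists k0, forall k s, (k0 <= k)%N ->
  `|s - t| <= 1 -> `|time T K k (index k s) - s| <= d.
Proof.
move=> d0; have [n1 H1] := nat_above ((`|t| + 1) / T); have [n2 H2] := nat_above d^-1.
exists (maxn n1 n2) => k s; rewrite geq_max => /andP[/H1 kT /H2 kd] st.
have sk : 0 <= s + k%:R * T.
  move: kT; rewrite ltr_pdivrMr// => kT.
  have := ler_norm (- t); rewrite normrN; move: st; rewrite ler_norml => /andP[].
  by move: kT; lra.
have /andP[i1 i2] := truncn_itv (divr_ge0 sk (ltW (h_gt0 k))).
move: i1 i2; rewrite -/(index k s) -natr1 ler_pdivlMr ?ltr_pdivrMr// => i1 i2.
have hd : h k <= d.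
  rewrite (le_trans (h_small k))// -[leRHS]invrK lef_pV2 ?posrE ?invr_gt0//.
  by rewrite -natr1 ler_wpDr// ltW.
rewrite /time -/(h k) ler_norml; apply/andP; split; move: i1 i2 hd; rewrite mulrDl mul1r; lra.
Qed.

Lemma index_period k t : 0 <= t + k%:R * T -> index k (t + T) = (index k t + K k)%N.
Proof.
move=> tk; have hk := h_gt0 k.
have /andP[i1 i2] := truncn_itv (divr_ge0 tk (ltW hk)).
have K0 : (K k)%:R != 0 :> R by rewrite pnatr_eq0 -lt0n.
apply: truncn_def.
have -> : (t + T + k%:R * T) / h k = (t + k%:R * T) / h k + (K k)%:R.
  by rewrite /h; field; rewrite K0 gt_eqF.
rewrite -/(index k t) in i1 i2.
by rewrite natrD lerD2r i1 -addSn natrD ltrD2r.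
Qed.

Definition ultra_mean t (f : Z -> R) : R := lim (a k (index k t) f @[k --> F]).

Lemma ultra_mean_cvg t f : bfun f -> a k (index k t) f @[k --> F] --> ultra_mean t f.
Proof.
move=> [B fB]; apply: (@ultra_cvg _ B) => k.
exact: (mean_bnd (a_mean _ _)).
Qed.

Lemma ultra_mean_bounded_mean t : is_bounded_mean (ultra_mean t).
Proof.
split=> [c f g bf bg|f bf f0|].
- have H : c * a k (index k t) f + a k (index k t) g @[k --> F] -->
      c * ultra_mean t f + ultra_mean t g.
    apply: cvgD; last exact: ultra_mean_cvg.
    by apply: cvgM; [exact: cvg_cst|exact: ultra_mean_cvg].
  apply: cvg_lim => //; apply: cvg_trans H.
  by under eq_fun do rewrite (mean_lin (a_mean _ _)).
- apply: (@ler_cvg_to _ F _ R (cst 0) (fun k => a k (index k t) f)).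
  + exact: cvg_cst.
  + exact: ultra_mean_cvg.
  + by apply: filterE => k; exact: (mean_ge0 (a_mean _ _)).
- apply: cvg_lim => //; under eq_fun do rewrite (mean_cst (a_mean _ _)).
  exact: cvg_cst.
Qed.

Lemma ultra_mean_tight t (e : R) : 0 < e ->
  exists rho, ultra_mean t (fun z => (rho < `|z|)%R%:R) <= e.
Proof.
move=> e0; have [rho [k1 H]] := a_tight (`|t| + 1) e0.
have [k2 H2] := index_close t ltr01.
exists rho; apply: (@ler_cvg_to _ F _ R
  (fun k => a k (index k t) (fun z => (rho < `|z|)%R%:R)) (cst e)).
- by apply: ultra_mean_cvg; exact: bfun_bool.
- exact: cvg_cst.
- apply: (@ultra_eventually _ (maxn k1 k2)) => k; rewrite geq_max => /andP[k1k k2k].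
  apply: H => //; have := H2 k t k2k; rewrite subrr normr0 => /(_ ler01).
  by have := ler_normD (time T K k (index k t) - t) t; rewrite subrK; lra.
Qed.

Lemma ultra_mean_period t f : bfun f -> ultra_mean (t + T) f = ultra_mean t f.
Proof.
move=> bf; have [B fB] := bf.
apply: cvg_lim => //; apply/cvgrPdist_le => e e0.
have B0 : 0 <= B by rewrite (le_trans _ (fB 0)).
have [n1 H1] := nat_above (4 * B / e); have [n2 H2] := nat_above (`|t| / T).
have : \forall k \near F, `|ultra_mean t f - a k (index k t) f| <= e / 2.
  by move/cvgrPdist_le : (ultra_mean_cvg (t := t) bf); apply; rewrite divr_gt0.
have : \forall k \near F, `|a k (index k (t + T)) f - a k (index k t) f| <= e / 2.
  apply: (@ultra_eventually _ (maxn n1 n2)) => k; rewrite geq_max => /andP[/H1 k1 /H2 k2].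
  rewrite index_period; last first.
    move: k2; rewrite ltr_pdivrMr//; have := ler_norm (- t); rewrite normrN; lra.
  apply: le_trans (a_shift _ _ fB) _; rewrite ler_pdivrMr// mulrAC ler_pdivlMr//.
  by move: k1; rewrite ltr_pdivrMr// -natr1 mulrDl [_ * e]mulrC; lra.
apply: filterS2 => k H H'.
rewrite -(subrKA (a k (index k t) f)) (le_trans (ler_normD _ _))//.
by rewrite [X in _ + X]distrC; move: H H'; lra.
Qed.

Lemma slice_bfun psi rho t : continuous psi ->
  (forall z s, rho < `|z| -> psi (z, s) = 0) -> bfun (fun z : Z => psi (z, t)).
Proof.
move=> cpsi psi0.
have [B B0 fB] := compact_bounded_fun (@spacetime_box_compact R N rho `|t|) cpsi.
exists B => z; have [zr|/psi0 ->] := leP `|z| rho; last by rewrite normr0 ltW.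
by apply: (fB (z, t)).
Qed.

Lemma ultra_mean_slice psi rho t : continuous psi ->
  (forall z s, rho < `|z| -> psi (z, s) = 0) ->
  (* The integrand is evaluated at the grid time rather than at [t]; the grid time tends to [t],
     uniformly enough by the uniform continuity of [psi] on its spatial support. *)
  a k (index k t) (fun z => psi (z, time T K k (index k t))) @[k --> F] -->
  ultra_mean t (fun z => psi (z, t)).
Proof.
move=> cpsi psi0; apply/cvgrPdist_le => e e0; have e2 : 0 < e / 2 by rewrite divr_gt0.
have bpsi := slice_bfun t cpsi psi0.
have [d d0 Hd] := @uniform_modulus R N `|rho| `|t| unit (fun=> psi) _ (fun=> cpsi) e2.
have d20 : 0 < d / 2 by rewrite divr_gt0.
have [k1 H1] := index_close t d20.
have : \forall k \near F, `|ultra_mean t (fun z => psi (z, t)) -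
    a k (index k t) (fun z => psi (z, t))| <= e / 2.
  by move/cvgrPdist_le : (ultra_mean_cvg (t := t) bpsi); apply.
have : \forall k \near F, `|time T K k (index k t) - t| <= d / 2.
  apply: (@ultra_eventually _ k1) => k k1k; apply: H1 => //.
  by rewrite subrr normr0.
apply: filterS2 => k Ht Hm.
have H : `|a k (index k t) (fun z => psi (z, t)) -
    a k (index k t) (fun z => psi (z, time T K k (index k t)))| <= e / 2.
  rewrite distrC -[leRHS](mean_cst (a_mean k (index k t))).
  apply: (mean_dist (a_mean _ _)) => z.
  have [zr|rz] := leP `|z| `|rho|; last first.
    by rewrite !psi0 ?subrr ?normr0 ?(ltW e2)// (le_lt_trans (ler_norm rho)).
  have := Hd tt z t 0 (time T K k (index k t) - t) zr (lexx _).
  rewrite normr0 addr0 subrKC; apply => //; apply: le_lt_trans Ht _.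
  by rewrite ltr_pdivrMr// ltr_pMr// ltr1n.
rewrite -(subrKA (a k (index k t) (fun z => psi (z, t)))).
by rewrite (le_trans (ler_normD _ _))//; move: Hm H; lra.
Qed.

Lemma index_cvg t : time T K k (index k t) @[k --> F] --> t.
Proof.
apply/cvgrPdist_le => e e0; have [k0 H] := index_close t e0.
by apply: (@ultra_eventually _ k0) => k k0k; rewrite distrC H// subrr normr0.
Qed.

Lemma ultra_mean_continuous psi rho : continuous psi ->
  (forall z s, rho < `|z| -> psi (z, s) = 0) ->
  continuous (fun t => ultra_mean t (fun z => psi (z, t))).
Proof.
move=> cpsi psi0; apply: epsilon_delta_continuous => t e e0.
have [d [k0 [d0 H]]] := a_equicontinuous t cpsi psi0 e0.
have d20 : 0 < d / 2 by rewrite divr_gt0.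
have [k1 H1] := index_close t d20.
exists (Num.min 1 (d / 2)); first by rewrite lt_min ltr01.
move=> s; rewrite lt_min => /andP[st1 std].
apply: (@ler_cvg_to _ F _ R
  (fun k => `|a k (index k s) (fun z => psi (z, time T K k (index k s))) -
              a k (index k t) (fun z => psi (z, time T K k (index k t)))|) (cst e)).
- by apply: cvg_norm; apply: cvgB; exact: (ultra_mean_slice cpsi psi0).
- exact: cvg_cst.
- apply: (@ultra_eventually _ (maxn k0 k1)) => k; rewrite geq_max => /andP[k0k k1k].
  apply: H => //.
    have := H1 k s k1k (ltW st1) => Hs.
    rewrite -(subrKA s) (le_trans (ler_normD _ _))//; move: std Hs; lra.
  by have := H1 k t k1k; rewrite subrr normr0 => /(_ ler01); move: d20; lra.
Qed.

(** The bound of [a_derivative] has a window [d] independent of [k], and each of its terms converges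
    along [F]; the inequality therefore survives in the limit and is the estimate on the difference
    quotient. *)
Lemma ultra_mean_derive phi rho t : C21 phi ->
  (forall z s, rho < `|z| -> phi (z, s) = 0) ->
  is_derive t (1 : R) (fun t => ultra_mean t (fun z => phi (z, t)))
    (ultra_mean t (fun z => generator b sigma phi (z, t))).
Proof.
move=> phiC phi0; have [cphi _ _ _] := phiC.
have cG := generator_cont phiC; have G0 := generator_supp b sigma phi0.
pose Phi s := ultra_mean s (fun z => phi (z, s)).
pose G := ultra_mean t (fun z => generator b sigma phi (z, t)).
suff H : (fun h : R => h^-1 *: ((Phi \o shift t) (h *: 1) - Phi t)) @ 0^' --> G.
  by split; [apply/cvg_ex; exists G|exact: cvg_lim H].
apply/cvgrPdist_le => e e0.
have [d [k0 [d0 H]]] := a_derivative t phiC phi0 e0.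
have d20 : 0 < d / 2 by rewrite divr_gt0.
have [k1 H1] := index_close t d20.
near=> u.
have u0 : u != 0 by near: u; exact: nbhs_dnbhs_neq.
have u1 : `|u| <= 1 by near: u; exact: dnbhs0_le.
have ud : `|u| <= d / 2 by near: u; exact: dnbhs0_le.
rewrite distrC /= [u *: 1]mulr1 [u + t]addrC.
suff Hu : `|Phi (t + u) - Phi t - u * G| <= e * `|u|.
  rewrite (_ : _ - G = u^-1 * (Phi (t + u) - Phi t - u * G)).
    by rewrite normrM normfV mulrC ler_pdivrMr ?normr_gt0.
  by rewrite mulrBr mulrA mulVf// mul1r.
pose i k := index k (t + u); pose j k := index k t.
have cvu := @ultra_mean_slice phi rho (t + u) cphi phi0.
have cvt := @ultra_mean_slice phi rho t cphi phi0.
have cvG := @ultra_mean_slice _ rho t cG G0.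
have cvtime : time T K k (i k) - time T K k (j k) @[k --> F] --> u.
  have -> : u = (t + u) - t by rewrite addrC addKr.
  by apply: cvgB; rewrite ?[t + _ - t]addrC ?addKr; exact: index_cvg.
apply: (@ler_cvg_to _ F _ R
  (fun k => `|a k (i k) (fun z => phi (z, time T K k (i k)))
     - a k (j k) (fun z => phi (z, time T K k (j k)))
     - (time T K k (i k) - time T K k (j k)) *
        a k (j k) (fun z => generator b sigma phi (z, time T K k (j k)))|)
  (fun k => e * `|time T K k (i k) - time T K k (j k)|)).
- apply: cvg_norm; apply: cvgB; first exact: cvgB.
  exact: cvgM.
- by apply: cvgM; [exact: cvg_cst|exact: cvg_norm].
- apply: (@ultra_eventually _ (maxn k0 k1)) => k; rewrite geq_max => /andP[k0k k1k].
  have jt : `|time T K k (j k) - t| <= d.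
    by have := H1 k t k1k; rewrite subrr normr0 => /(_ ler01); have := d20; rewrite /j; lra.
  have it : `|time T K k (i k) - t| <= d.
    have := H1 k (t + u) k1k; rewrite [t + u - t]addrAC subrr add0r => /(_ u1) Hs.
    rewrite -(subrKA (t + u)) (le_trans (ler_normD _ _))// [t + u - t]addrAC subrr add0r.
    by move: ud Hs; rewrite /i; lra.
  set X := a k (i k) _; set Y := a k (j k) (fun z => phi _); set V := a k (j k) _.
  (* The increment [u] has either sign, while [a_derivative] asks for ordered indices. *)
  have [ij|ji] := leqP (i k) (j k).
    have := H k (i k) (j k) (j k) k0k ij it jt jt; rewrite -/X -/Y -/V => HH.
    have -> : X - Y - (time T K k (i k) - time T K k (j k)) * V =
        - (Y - X - (time T K k (j k) - time T K k (i k)) * V) by ring.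
    rewrite normrN [in leRHS]distrC.
    by apply: le_trans HH _; rewrite ler_wpM2l ?(ltW e0)// ler_norm.
  have := H k (j k) (i k) (j k) k0k (ltnW ji) jt it jt; rewrite -/X -/Y -/V => HH.
  by apply: le_trans HH _; rewrite ler_wpM2l ?(ltW e0)// ler_norm.
Unshelve. all: by end_near. Qed.

End UltraLimit.

(** * From means to a measure on space-time *)

Section MeasurableFamily.
Context (R : realType) (N : nat).
Local Notation Z := ('cV[R]_N).
Variable P : measurableTypeR R -> probability (borelType Z) R.
Hypothesis P_continuous : forall f : Z -> R, continuous f ->
  (exists rho, forall z, rho < `|z| -> f z = 0) ->
  measurable_fun setT (fun t => (\int[P t]_z (f z)%:E)%E).

Definition tent (c : Z) (r : R) (z : Z) : R := Num.max 0 (r - `|z - c|).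

Lemma tent_continuous c r : continuous (tent c r).
Proof.
move=> z; rewrite /tent; apply: (@continuous_max _ _ (cst 0) (fun z : Z => r - `|z - c|)).
  exact: cst_continuous.
apply: (@continuousB _ _ _ (cst r) (fun z : Z => `|z - c|)).
  exact: cst_continuous.
apply: (@continuous_comp _ _ _ (fun z : Z => z - c) (fun z : Z => `|z|)); last exact: norm_continuous.
by apply: (@continuousB _ _ _ id (cst c)); [exact: id|exact: cst_continuous].
Qed.

Definition bump (i : nat) (O : set Z) : Z -> R :=
  if (unpickle i : option ('cV[rat]_N * nat)) is Some p then
    if `[< ball (map_mx ratr p.1 : Z) p.2.+1%:R^-1 `<=` O >]
    then tent (map_mx ratr p.1) p.2.+1%:R^-1 else cst 0
  else cst 0.

Lemma bump_ge0 i O z : 0 <= bump i O z.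
Proof.
by rewrite /bump; case: unpickle => // p; case: asboolP => // _; rewrite /tent le_max lexx.
Qed.

Lemma bump_out i O z : ~ O z -> bump i O z = 0.
Proof.
rewrite /bump; case: unpickle => // p nOz; case: asboolP => // pO.
apply/max_idPl; rewrite subr_le0 leNgt; apply/negP => zc; apply/nOz/pO.
by rewrite -ball_normE /= distrC.
Qed.

Lemma bump_in O z : open O -> O z -> exists i, 0 < bump i O z.
Proof.
move=> oO; rewrite {1}(open_bigcup_balls (@cV_ratr_dense R N) oO) => -[p /= pO pz].
exists (pickle p); rewrite /bump pickleK; case: asboolP => // _.
by rewrite lt_max ltxx /= subr_gt0 distrC; move: pz; rewrite -ball_normE.
Qed.

Lemma bump_continuous i O : continuous (bump i O).
Proof.
rewrite /bump; case: unpickle => [p|]; last exact: cst_continuous.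
by case: asboolP => _; [exact: tent_continuous|exact: cst_continuous].
Qed.

Lemma bump_supp i O : exists rho, forall z : Z, rho < `|z| -> bump i O z = 0.
Proof.
rewrite /bump; case: unpickle => [p|]; last by exists 0.
case: asboolP => _; last by exists 0.
set c : Z := map_mx _ _; exists (`|c| + p.2.+1%:R^-1) => z zc.
apply/max_idPl; rewrite subr_le0 -(lerD2l `|c|); apply: le_trans (ltW zc) _.
by rewrite addrC -{1}(subrK c z) ler_normD.
Qed.

(** The factor [j] pushes any positive partial sum above 1 for large [j], so the clipped functions
    tend pointwise to the indicator of [O]. *)
Definition open_approx (O : set Z) (j : nat) (z : Z) : R :=
  Num.max 0 (Num.min 1 (j%:R * \sum_(i < j) bump i O z)).

Lemma open_approx_continuous O j : continuous (open_approx O j).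
Proof.
apply: clip_continuous => z.
apply: (@continuousM _ _ (cst j%:R) (fun z => \sum_(i < j) bump i O z)).
  exact: cst_continuous.
by apply: sum_continuous => i; exact: bump_continuous.
Qed.

Lemma open_approx_supp O j : exists rho, forall z : Z, rho < `|z| -> open_approx O j z = 0.
Proof.
have /choice[rho H] := fun i => bump_supp i O.
exists (\sum_(i < j) `|rho i|) => z rz; rewrite /open_approx big1 => [|i _].
  by rewrite mulr0 min_r// maxxx.
apply: H; apply: le_lt_trans rz; apply: le_trans (ler_norm _) _.
by rewrite (bigD1 i)//= lerDl sumr_ge0.
Qed.

Lemma open_approx_cvg O z : open O -> open_approx O j z @[j --> \oo] --> (\1_O z : R).
Proof.
move=> oO; have [Oz|nOz] := pselect (O z); last first.
  rewrite indicE memNset// (_ : (fun j => _) = fun=> 0); first exact: cvg_cst.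
  apply/funext => j; rewrite /open_approx big1 ?mulr0 ?min_r ?maxxx// => i _.
  exact: bump_out.
rewrite indicE mem_set//.
have [i i0] := bump_in oO Oz.
have [n Hn] := nat_above (bump i O z)^-1.
apply: cvg_near_cst; exists (maxn i.+1 n) => // j /=; rewrite geq_max => /andP[ij /Hn nj].
have H : 1 <= j%:R * \sum_(i < j) bump i O z.
  apply: (@le_trans _ _ (j%:R * bump i O z)).
    by rewrite -ler_pdivrMr// div1r ltW.
  rewrite ler_wpM2l// (bigD1 (Ordinal ij))//= lerDl sumr_ge0// => k _.
  exact: bump_ge0.
by rewrite /open_approx min_l// max_r.
Qed.

Lemma measurable_family_open (O : set Z) : open O ->
  measurable_fun setT (fun t => P t (O : set (borelType Z))).
Proof.
move=> oO; have mO := cV_open_measurable oO.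
have approx1 j z : 0 <= open_approx O j z <= 1.
  by rewrite /open_approx le_max lexx ge_max ler01 ge_min lexx.
apply: (@emeasurable_fun_cvg _ _ R setT
  (fun j t => (\int[P t]_z (open_approx O j z)%:E)%E)) => [j|t _].
  by apply: P_continuous; [exact: open_approx_continuous|exact: open_approx_supp].
have -> : P t O = (\int[P t]_z (\1_O z)%:E)%E.
  by rewrite integral_indic// setIT.
have mA j : measurable_fun setT (fun z : borelType Z => (open_approx O j z)%:E).
  by apply/measurable_EFinP; apply: cV_continuous_measurable; exact: open_approx_continuous.
have [||||_ _ +] := @dominated_convergence _ _ R (P t) setT measurableT
  (fun j z => (open_approx O j z)%:E) (fun z => (\1_O z)%:E) (cst 1%E) mA _.
- exact/measurable_EFinP.
- by apply: aeW => z _; apply/cvg_EFin; [exact: nearW|exact: open_approx_cvg].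
- exact: finite_measure_integrable_cst.
- apply: aeW => z j _; have /andP[z0 z1] := approx1 j z.
  by rewrite /= lee_fin ger0_norm.
- exact.
Qed.

(** Dynkin's argument: open sets are stable under intersection and generate, and measurability in
    [t] passes to complements and countable disjoint unions. *)
Lemma measurable_family (A : set (borelType Z)) :
  measurable A -> measurable_fun setT (fun t => P t A).
Proof.
move=> mA.
apply: (@dynkin_induction _ (borelType Z) (@open Z)
  (fun A => measurable_fun setT (fun t => P t A)) _ _ _ _ _ _ A mA).
- by [].
- exact: openI.
- rewrite (_ : (fun t => _) = cst 1%E); first exact: measurable_cst.
  by apply/funext => t; exact: probability_setT.
- by move=> O; exact: measurable_family_open.
- move=> S mS mPS; rewrite (_ : (fun t => _) = (fun t => (1 - P t S)%E)).
    by apply: emeasurable_funB => //; exact: measurable_cst.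
  by apply/funext => t; exact: probability_setC.
- move=> F mF tF mPF.
  rewrite (_ : (fun t => _) = (fun t => (\sum_(0 <= k <oo) P t (F k))%E)).
    by apply: ge0_emeasurable_sum.
  apply/funext => t; rewrite (@measure_bigcup _ _ _ (P t) setT F)//.
  by apply: eq_eseriesl => k; rewrite in_setT.
Qed.

End MeasurableFamily.

Section MeasurableFamilyKernel.
Context d d' (X : measurableType d) (Y : measurableType d') (R : realType).
Variable P : X -> probability Y R.
Hypothesis mP : forall A, measurable A -> measurable_fun setT (fun t => P t A).

(* The unused argument carries the measurability proof, so that the kernel
   structure can be inferred from the function. *)
Definition family_kernel (_ : forall A, measurable A -> measurable_fun setT (fun t => P t A)) :
  X -> {measure set Y -> \bar R} := P.

HB.instance Definition _ := isKernel.Build _ _ X Y R (family_kernel mP) mP.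

Let family_kernel_setT t : family_kernel mP t setT = 1%E.
Proof. exact: probability_setT. Qed.

HB.instance Definition _ :=
  Kernel_isProbability.Build _ _ X Y R (family_kernel mP) family_kernel_setT.

End MeasurableFamilyKernel.

(** * The space-time measure of a kernel and its local integrability *)

Section SliceMeasure.
Context (R : realType) (N : nat).
Local Notation Z := ('cV[R]_N).
Variable k : R.-pker (measurableTypeR R) ~> (borelType Z).

Definition slice_mass (A : set (spacetime R N)) : \bar R :=
  (\int[@lebesgue_measure R]_t k t [set z | A (z, t)])%E.

(** A time slice fixes the second coordinate whereas [xsection] fixes the first, hence the swap. *)
Lemma slice_xsection (A : set (spacetime R N)) (t : measurableTypeR R) :
  [set z | A (z, t)] = xsection ((@unstable.swap (measurableTypeR R) (borelType Z)) @^-1` A) t.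
Proof. by apply/seteqP; split => z; rewrite /xsection /= ?inE. Qed.

Lemma measurable_swap_set (A : set (spacetime R N)) : measurable A ->
  measurable ((@unstable.swap (measurableTypeR R) (borelType Z)) @^-1` A).
Proof.
by move=> mA; have := measurable_swap measurableT mA; rewrite setTI.
Qed.

Lemma measurable_slice (A : set (spacetime R N)) (t : R) :
  measurable A -> measurable ([set z | A (z, t)] : set (borelType Z)).
Proof.
by move=> mA; rewrite slice_xsection; apply: measurable_xsection; exact: measurable_swap_set.
Qed.

Lemma measurable_slice_fun (A : set (spacetime R N)) : measurable A ->
  measurable_fun setT (fun t => k t [set z | A (z, t)]).
Proof.
move=> mA; rewrite (_ : (fun t => _) = (fun t => k t (xsection
  ((@unstable.swap (measurableTypeR R) (borelType Z)) @^-1` A) t))).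
  by apply: measurable_fun_xsection_finite_kernel; rewrite inE; exact: measurable_swap_set.
by apply/funext => t; rewrite slice_xsection.
Qed.

Let slice_mass0 : slice_mass set0 = 0%E.
Proof.
by apply: integral0_eq => t _; rewrite (_ : [set z | _] = set0) ?measure0.
Qed.

Let slice_mass_ge0 A : (0 <= slice_mass A)%E.
Proof. exact: integral_ge0. Qed.

Let slice_mass_additive : semi_sigma_additive slice_mass.
Proof.
move=> F mF tF mUF; have cF := @is_cvg_ereal_nneg_natsum _ (fun n => slice_mass (F n)) 0
  (fun n _ => slice_mass_ge0 (F n)).
rewrite (_ : slice_mass _ = (\sum_(0 <= n <oo) slice_mass (F n))%E)//.
rewrite -integral_nneseries => [|//|n|n t _]; [|exact: measurable_slice_fun|exact: measure_ge0].
apply: eq_integral => t _.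
rewrite (_ : [set z | _] = \bigcup_n ([set z | F n (z, t)] : set (borelType Z)))//.
rewrite (@measure_bigcup _ _ _ (k t) setT)//.
- by apply: eq_eseriesl => n; rewrite in_setT.
- by move=> n _; exact: measurable_slice.
- by move=> i j _ _ [z [/= Fi Fj]]; apply: (tF i j) => //; exists (z, t).
Qed.

HB.instance Definition _ := isMeasure.Build _ _ _ slice_mass
  slice_mass0 slice_mass_ge0 slice_mass_additive.

(** Each slice has mass at most 1, so a set within a bounded time interval has mass at most the
    length of that interval. *)
Lemma slice_mass_bounded (A : set (spacetime R N)) (tau : R) : measurable A ->
  (forall p, A p -> `|p.2| <= tau) -> (slice_mass A < +oo)%E.
Proof.
move=> mA At.
apply: (@le_lt_trans _ _ (\int[@lebesgue_measure R]_t (\1_(`[- tau, tau]%classic) t)%:E)%E).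
  apply: ge0_le_integral => //; first exact: measurable_slice_fun.
    by apply/measurable_EFinP; exact: measurable_indic.
  move=> t _; rewrite indicE; case: (boolP (t \in _)) => tt.
    rewrite -[(true%:R)%:E](@prob_kernel _ _ _ _ _ k t).
    by apply: le_measure; rewrite ?inE//; exact: measurable_slice.
  rewrite (_ : [set z | _] = set0) ?measure0//.
  apply/seteqP; split => // z /= /At /= h; move/negP: tt; apply.
  by rewrite inE /= in_itv /= -ler_norml.
rewrite integral_indic// setIT.
suff: (@lebesgue_measure R `[(- tau)%R, tau%R]%classic < +oo)%E by [].
by rewrite lebesgue_measure_itv /=; case: ifP => // _; rewrite -EFinB ltry.
Qed.

Lemma slice_mass_L1loc (f : Z * R -> R) : continuous f -> L1loc slice_mass f.
Proof.
move=> cf K cK.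
have mK : measurable (K : set (spacetime R N)).
  rewrite -(setCK K); apply: measurableC; apply: spacetime_open_measurable.
  by apply: closed_openC; apply: compact_closed => //; exact: norm_hausdorff.
have [B B0 fB] := compact_bounded_fun cK cf.
have c2 : continuous (fun p : Z * R => p.2) by move=> p; exact: cvg_snd.
have [tau tau0 Kt] := compact_bounded_fun cK c2.
apply: measurable_bounded_integrable => //.
- exact: slice_mass_bounded mK Kt.
- by apply: measurable_funTS; exact: spacetime_continuous_measurable.
- exists B; split => [|M BM p Kp]; first exact: num_real.
  by apply: le_trans (ltW BM); exact: fB.
Qed.

End SliceMeasure.

(** * The Fokker-Planck equation from a differentiable family of means *)

Section MeanFamilySolution.
Context (R : realType) (N m : nat).
Local Notation Z := ('cV[R]_N).
Variables (b : Z -> R -> Z) (sigma : Z -> R -> 'M[R]_(N, m)) (T : R).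
Hypothesis b_cont : forall i, continuous (fun p : Z * R => b p.1 p.2 i ord0).
Hypothesis sigma_cont : forall i k, continuous (fun p : Z * R => sigma p.1 p.2 i k).

Variable l : R -> (Z -> R) -> R.
Hypothesis l_mean : forall t, is_bounded_mean (l t).
Hypothesis l_tight : forall t e, 0 < e ->
  exists rho, l t (fun z => (rho < `|z|)%R%:R) <= e.
Hypothesis l_period : forall t f, bfun f -> l (t + T) f = l t f.
Hypothesis l_continuous : forall (psi : Z * R -> R) rho, continuous psi ->
  (forall z s, rho < `|z| -> psi (z, s) = 0) ->
  continuous (fun t => l t (fun z => psi (z, t))).
Hypothesis l_derive : forall phi rho t, C21 phi ->
  (forall z s, rho < `|z| -> phi (z, s) = 0) ->
  is_derive t (1 : R) (fun t => l t (fun z => phi (z, t)))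
    (l t (fun z => generator b sigma phi (z, t))).

Definition represents (L : (Z -> R) -> R) : set (pprobability (borelType Z) R) :=
  [set P : probability (borelType Z) R | forall f : Z -> R, continuous f ->
    (exists rho, forall z, rho < `|z| -> f z = 0) ->
    (\int[P]_z (f z)%:E = (L f)%:E)%E].

(* The choice depends on [t] only through [represents (l t)], which is [T]-periodic
   in [t] whereas [l t] itself is periodic only on bounded functions. *)
Definition representative (t : measurableTypeR R) : probability (borelType Z) R :=
  xget (point : pprobability (borelType Z) R) (represents (l t)).

Lemma representativeE t (f : Z -> R) : continuous f ->
  (exists rho, forall z, rho < `|z| -> f z = 0) ->
  (\int[representative t]_z (f z)%:E = (l t f)%:E)%E.
Proof.
have [P PP] := mean_representation (l_mean t) (l_tight t).
by move: f; rewrite /representative; case: xgetP => [Q _ QQ|/(_ P)].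
Qed.

Lemma cont_supp_bfun (f : Z -> R) : continuous f ->
  (exists rho, forall z, rho < `|z| -> f z = 0) -> bfun f.
Proof.
move=> cf [rho f0]; have [B B0 fB] := compact_bounded_fun (@cV_closed_ball_compact R N rho) cf.
by exists B => z; have [/fB//|/f0 ->] := leP `|z| rho; rewrite normr0 ltW.
Qed.

Lemma representative_period t : representative (t + T) = representative t.
Proof.
rewrite /representative (_ : represents (l (t + T)) = represents (l t))//.
apply/seteqP; split => P H f cf f0; have := H f cf f0;
  by rewrite l_period//; exact: cont_supp_bfun.
Qed.

Lemma representative_measurable A : measurable A ->
  measurable_fun setT (fun t => representative t A).
Proof.
apply: measurable_family => f cf f0.
rewrite (_ : (fun t => _) = (fun t => (l t f)%:E)).
  apply/measurable_EFinP; apply: continuous_measurable_fun.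
  have [rho fr] := f0.
  apply: (@l_continuous (fun p => f p.1) rho) => [p|z s]; last exact: fr.
  by apply: (@continuous_comp _ _ _ fst f); [exact: cvg_fst|exact: cf].
by apply/funext => t; exact: representativeE.
Qed.

Lemma compactly_supported_bounds (phi : Z * R -> R) : compactly_supported phi ->
  exists2 r, 0 < r & forall z t, r < `|z| \/ r < `|t| -> phi (z, t) = 0.
Proof.
move=> cK.
have c1 : continuous (fun p : Z * R => `|p.1|).
  by move=> p; apply: (@continuous_comp _ _ _ fst (fun z : Z => `|z|));
    [exact: cvg_fst|exact: norm_continuous].
have c2 : continuous (fun p : Z * R => p.2) by move=> p; exact: cvg_snd.
have [B1 B10 H1] := compact_bounded_fun cK c1.
have [B2 B20 H2] := compact_bounded_fun cK c2.
exists (Num.max B1 B2); first by rewrite lt_max B10.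
move=> z t zt; apply/eqP/negP => /negP phi0.
have cl : closure [set p | phi p != 0] (z, t) by exact: subset_closure.
have /= h1 := H1 _ cl; have /= h2 := H2 _ cl.
rewrite normr_id in h1; case: zt; rewrite gt_max => /andP[z1 z2].
  by move: z1; rewrite ltNge h1.
by move: z2; rewrite ltNge h2.
Qed.

(** The inner integral is the derivative of [F], the mean of the test function at time [t], which
    vanishes at both ends of a long time interval. *)
Lemma generator_integral0 phi : C21 phi -> compactly_supported phi ->
  (\int[@lebesgue_measure R]_t \int[representative t]_z (generator b sigma phi (z, t))%:E = 0)%E.
Proof.
move=> phiC /compactly_supported_bounds[r r0 phi0].
have phiz z s : r < `|z| -> phi (z, s) = 0 by move=> h; apply: phi0; left.
have cG := generator_continuous b_cont sigma_cont phiC.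
have G0 := generator_supp b sigma phiz.
pose F t := l t (fun z => phi (z, t)).
pose g t := l t (fun z => generator b sigma phi (z, t)).
have dF t : is_derive t (1 : R) F (g t) := l_derive t phiC phiz.
have cg : continuous g := l_continuous cG G0.
have F0 t : r < `|t| -> F t = 0.
  move=> rt; rewrite /F (_ : (fun z => _) = fun=> 0); first exact: (bmean0 (l_mean t)).
  by apply/funext => z; apply: phi0; right.
have cF : continuous F.
  by move=> t; apply: differentiable_continuous; apply/derivable1_diffP; case: (dF t).
have gE t : r < `|t| -> g t = 0.
  move=> rt; have [_ <-] := dF t.
  rewrite (@near_eq_derive _ _ _ F (cst 0))//; first exact: derive_cst.
  exists (`|t| - r); first by rewrite /= subr_gt0.
  move=> s /= st; apply: F0; have := ler_normD (t - s) s; rewrite subrK; move: st; lra.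
transitivity (\int[@lebesgue_measure R]_t (g t)%:E)%E.
  apply: eq_integral => t _; apply: representativeE; first exact: slice_continuous.
  by exists r => z; exact: G0.
(* Vanishing is known only strictly beyond [r], so the interval is enlarged by one unit. *)
pose u := r + 1.
transitivity (\int[@lebesgue_measure R]_(t in `[(- u)%R, u%R]) (g t)%:E)%E.
  rewrite [RHS]integral_mkcond; apply: eq_integral => t _; rewrite patchE.
  case: ifPn => // /negP tu; congr (_%:E); apply: gE; rewrite ltNge; apply/negP => tr; apply: tu.
  by rewrite inE /= in_itv /= -ler_norml /u; move: tr; lra.
rewrite (@continuous_FTC2 _ g F).
- by rewrite !F0 ?subee// ?normrN /u gtr0_norm; lra.
- by rewrite /u; move: r0; lra.
- exact: continuous_subspaceT.
- split => [t _||]; first by case: (dF t).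
  + by apply: cvg_at_right_filter; exact: cF.
  + by apply: cvg_at_left_filter; exact: cF.
- by move=> t _; rewrite derive1E; case: (dF t).
Qed.

Theorem mean_family_solution :
  exists mu, periodic_probability_solution b sigma T mu.
Proof.
pose k : R.-pker (measurableTypeR R) ~> (borelType Z) := family_kernel representative_measurable.
exists (slice_mass k); exists k; split.
- by [].
- by move=> t A _; rewrite /k /family_kernel /= representative_period.
- by move=> i j; apply: slice_mass_L1loc; exact: diffusion_continuous.
- by move=> i; apply: slice_mass_L1loc; exact: b_cont.
- exact: generator_integral0.
Qed.

End MeanFamilySolution.

(** * Existence from a discrete Lyapunov function *)

Section LyapunovExistence.
Context (R : realType) (N m : nat).
Local Notation Z := ('cV[R]_N).
Variables (b : Z -> R -> Z) (sigma : Z -> R -> 'M[R]_(N, m)).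
Hypothesis b_cont : forall i, continuous (fun p : Z * R => b p.1 p.2 i ord0).
Hypothesis sigma_cont : forall i k, continuous (fun p : Z * R => sigma p.1 p.2 i k).
Variables (T : R) (T0 : 0 < T).
Hypothesis b_per : forall z t, b z (t + T) = b z t.
Hypothesis sigma_per : forall z t, sigma z (t + T) = sigma z t.

Variables (U W : Z -> R) (a : R).
Hypotheses (W0 : forall z, 0 <= W z) (WU : forall z, W z <= U z) (Ua : U 0 <= a).
Hypothesis U_bounded : forall rho, exists S, forall z, `|z| <= rho -> U z <= S.
Hypothesis W_coercive : forall w, exists rho, forall z, W z <= w -> `|z| <= rho.
Hypothesis U_drift : forall rho, exists2 h0, 0 < h0 & forall h z s,
  0 < h <= h0 -> `|z| <= rho -> euler b sigma h s U z <= U z + h * (a - W z).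

Theorem lyapunov_periodic_solution :
  exists mu, periodic_probability_solution b sigma T mu.
Proof.
have /choice[K KP] := steps_exist b_cont sigma_cont T0 U_drift.
have K_gt0 k : (0 < K k)%N by case: (KP k).
have h_small k : T / (K k)%:R <= k.+1%:R^-1 by case: (KP k).
have h_inc k : forall z s xi, `|z| <= k%:R -> `|s| <= k%:R ->
  `|increment b sigma (T / (K k)%:R) z s xi| <= 1 by case: (KP k).
have h_drift k : forall z s, `|z| <= k%:R ->
  euler b sigma (T / (K k)%:R) s U z <= U z + (T / (K k)%:R) * (a - W z) by case: (KP k).
have cG phi : C21 phi -> continuous (generator b sigma phi) by exact: generator_continuous.
have [F [FU ooF]] := @ultraFilterLemma nat _ (eventually_filter).
have Amean := period_avg_mean b sigma T0 K_gt0 h_small.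
have Ashift k i f B : (forall z, `|f z| <= B) ->
  `|period_avg b sigma T K k (i + K k) f - period_avg b sigma T K k i f| <= 2 * B / k.+1%:R.
  move=> fB; by apply: avg_shift => // j; exact: transition_markov.
have Atight tau e : 0 < e -> exists rho k0, forall k i, (k0 <= k)%N ->
  `|time T K k i| <= tau -> period_avg b sigma T K k i (fun z => (rho < `|z|)%R%:R) <= e.
  by apply: (@period_avg_tight _ _ _ b sigma _ _ _ _ U W a).
have Aequi psi rho t e : continuous psi ->
  (forall z s, rho < `|z| -> psi (z, s) = 0) -> 0 < e ->
  exists d k0, 0 < d /\ forall k i j, (k0 <= k)%N ->
    `|time T K k i - t| <= d -> `|time T K k j - t| <= d ->
    `|period_avg b sigma T K k i (fun z => psi (z, time T K k i))
      - period_avg b sigma T K k j (fun z => psi (z, time T K k j))| <= e.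
  by apply: (@avg_equicontinuous _ _ _ b sigma _ _ _ _ _ _ U W a).
have Ader phi rho t e : C21 phi ->
  (forall z s, rho < `|z| -> phi (z, s) = 0) -> 0 < e ->
  exists d k0, 0 < d /\ forall k i j r, (k0 <= k)%N -> (i <= j)%N ->
    `|time T K k i - t| <= d -> `|time T K k j - t| <= d -> `|time T K k r - t| <= d ->
    `|period_avg b sigma T K k j (fun z => phi (z, time T K k j))
      - period_avg b sigma T K k i (fun z => phi (z, time T K k i))
      - (time T K k j - time T K k i) * period_avg b sigma T K k r
          (fun z => generator b sigma phi (z, time T K k r))|
    <= e * (time T K k j - time T K k i).
  by apply: (@avg_derivative _ _ _ b sigma _ _ _ _ _ _ U W a).
apply: (@mean_family_solution _ _ _ b sigma T _ _
  (ultra_mean T K (period_avg b sigma T K) F)) => //.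
- by move=> t; apply: ultra_mean_bounded_mean.
- by move=> t e; apply: ultra_mean_tight.
- by move=> t f; apply: ultra_mean_period.
- by move=> psi rho; apply: ultra_mean_continuous.
- by move=> phi rho t; apply: ultra_mean_derive.
Qed.

End LyapunovExistence.

(** * The damped system *)

Section EuclideanAlgebra.
Context (R : realType) (n : nat).
Implicit Types (u v w : 'cV[R]_n) (A : 'M[R]_n) (a : R).

Lemma dotvE u v : dotv u v = (u^T *m v) ord0 ord0.
Proof. by rewrite mxE; apply: eq_bigr => i _; rewrite mxE. Qed.

Lemma dotvC u v : dotv u v = dotv v u.
Proof. by apply: eq_bigr => i _; rewrite mulrC. Qed.

Lemma dotvDr u v w : dotv u (v + w) = dotv u v + dotv u w.
Proof. by rewrite !dotvE mulmxDr mxE. Qed.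

Lemma dotvDl u v w : dotv (u + v) w = dotv u w + dotv v w.
Proof. by rewrite dotvC dotvDr !(dotvC w). Qed.

Lemma dotvZr a u v : dotv u (a *: v) = a * dotv u v.
Proof. by rewrite !dotvE -scalemxAr mxE. Qed.

Lemma dotvZl a u v : dotv (a *: u) v = a * dotv u v.
Proof. by rewrite dotvC dotvZr dotvC. Qed.

Lemma dotvNr u v : dotv u (- v) = - dotv u v.
Proof. by rewrite -scaleN1r dotvZr mulN1r. Qed.

Lemma dotvBr u v w : dotv u (v - w) = dotv u v - dotv u w.
Proof. by rewrite dotvDr dotvNr. Qed.

Lemma dotv_ge0 u : 0 <= dotv u u.
Proof. by apply: sumr_ge0 => i _; rewrite -expr2 sqr_ge0. Qed.

Lemma enorm_ge0 u : 0 <= enorm u.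
Proof. exact: sqrtr_ge0. Qed.

Lemma enorm_sqr u : enorm u ^+ 2 = dotv u u.
Proof. by rewrite sqr_sqrtr// dotv_ge0. Qed.

Lemma entry_sqr_le u i : u i ord0 ^+ 2 <= dotv u u.
Proof.
rewrite /dotv (bigD1 i)//= -expr2 lerDl; apply: sumr_ge0 => j _.
by rewrite -expr2 sqr_ge0.
Qed.

Lemma dotv0_eq0 u : dotv u u = 0 -> u = 0.
Proof.
move=> u0; apply/matrixP => i j; rewrite ord1 mxE; apply/eqP; rewrite -sqrf_eq0.
by rewrite eq_le sqr_ge0 -u0 entry_sqr_le.
Qed.

(** The Cauchy-Schwarz inequality, by expanding the square of [|v| u - |u| v] and dividing by
    [|u| |v|] when it is nonzero. *)
Lemma dotv_le_enorm u v : dotv u v <= enorm u * enorm v.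
Proof.
have := dotv_ge0 (enorm v *: u - enorm u *: v).
rewrite dotvBr !dotvZr ![dotv (_ - _) _]dotvC !dotvBr !dotvZr -!enorm_sqr (dotvC v u).
have [/eqP|u0] := eqVneq (enorm u * enorm v) 0.
  rewrite mulf_eq0 => /orP[|] /eqP e0 _; rewrite e0 ?mul0r ?mulr0.
    by rewrite (dotv0_eq0 (_ : dotv u u = 0)) -?enorm_sqr ?e0 ?expr0n// dotvE trmx0 mul0mx mxE.
  by rewrite (dotv0_eq0 (_ : dotv v v = 0)) -?enorm_sqr ?e0 ?expr0n// dotvE mulmx0 mxE.
have uv0 : 0 < enorm u * enorm v by rewrite lt_def u0 mulr_ge0// enorm_ge0.
move=> H; rewrite -(ler_pM2l uv0); move: H; nra.
Qed.

Lemma dotv_ge_enorm u v : - (enorm u * enorm v) <= dotv u v.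
Proof.
have := dotv_le_enorm u (- v); rewrite dotvNr lerNl.
by rewrite (_ : enorm (- v) = enorm v)// /enorm dotvNr dotvC dotvNr opprK.
Qed.

Lemma enorm_sub_norm u (rho : R) : `|u| <= rho -> dotv u u <= n%:R * rho ^+ 2.
Proof.
move=> ur; apply: le_trans (_ : \sum_(i < n) rho ^+ 2 <= _); last first.
  by rewrite sumr_const card_ord -[leLHS]mulr_natl.
apply: ler_sum => i _; rewrite -expr2 -real_normK ?num_real//.
by rewrite lerXn2r ?nnegrE ?(le_trans _ ur)// cV_entry_le.
Qed.

Lemma dotv_mulmxT A u v : dotv u (A^T *m v) = dotv (A *m u) v.
Proof. by rewrite !dotvE mulmxA trmx_mul. Qed.

Lemma sympart_dotv A v : dotv v (sympart A *m v) = dotv v (A *m v).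
Proof.
rewrite /sympart -scalemxAl dotvZr mulmxDl dotvDr dotv_mulmxT (dotvC _ v).
by field.
Qed.

Lemma loewner_dotv a A v : loewner_le a%:M (sympart A) -> a * dotv v v <= dotv v (A *m v).
Proof.
case=> _ /(_ v); rewrite mulmxBl dotvBr sympart_dotv mul_scalar_mx dotvZr.
by rewrite subr_ge0.
Qed.

Lemma enorm_mulmx A v : enorm (A *m v) <= opnorm A * enorm v.
Proof.
have [v0|v0] := eqVneq (enorm v) 0.
  have -> : v = 0 by apply: dotv0_eq0; rewrite -enorm_sqr v0 expr0n.
  by rewrite mulmx0 /enorm !dotvE !mulmx0 mxE sqrtr0 mulr0.
have vp : 0 < enorm v by rewrite lt_def v0 enorm_ge0.
rewrite -ler_pdivrMr//.
have -> : enorm (A *m v) / enorm v = enorm (A *m ((enorm v)^-1 *: v)).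
  rewrite -scalemxAr {3}/enorm dotvZr dotvZl mulrA -expr2 sqrtrM ?sqr_ge0// sqrtr_sqr.
  by rewrite ger0_norm ?invr_ge0 ?enorm_ge0// mulrC.
apply: ub_le_sup; last first.
  exists ((enorm v)^-1 *: v) => //=.
  rewrite {1}/enorm dotvZr dotvZl -enorm_sqr mulrA -expr2 -exprMn mulVf// expr1n.
  by rewrite sqrtr1.
(* The supremum in [opnorm] bounds its set only if the set is bounded above; the Frobenius norm is
   such a bound, row by row. *)
exists (Num.sqrt (\sum_i enorm (row i A)^T ^+ 2)) => _ [w /= w1 <-].
apply: ler_wsqrtr; apply: ler_sum => i _.
have -> : (A *m w) i ord0 = dotv (row i A)^T w by rewrite dotvE trmxK -row_mul [RHS]mxE.
rewrite -expr2 -real_normK ?num_real// lerXn2r ?nnegrE ?enorm_ge0//.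
have H : enorm (row i A)^T * enorm w <= enorm (row i A)^T.
  by rewrite ler_piMr ?enorm_ge0.
rewrite ler_norml (le_trans (dotv_le_enorm _ _) H) andbT.
by apply: le_trans (dotv_ge_enorm _ _); rewrite lerN2.
Qed.

End EuclideanAlgebra.

(** * Coefficients of the damped system and the Euler step on its energy *)

Section SystemCoefficients.
Context (R : realType) (n : nat).
Local Notation Z := ('cV[R]_(n + n)).

Lemma split_continuous :
  continuous (fun p : Z * R => (usubmx p.1, dsubmx p.1, p.2)).
Proof.
move=> p; apply/(@cvgrPdist_le _ _ _ (nbhs p)) => e e0.
apply/nbhs_ballP; exists e => // q; rewrite -ball_normE /= => /ltW.
rewrite !prod_normE /= !ge_max -andbA => /andP[q1 q2]; rewrite q2 andbT.
have e0' := ltW e0; move: q1; rewrite !cV_norm_le// => /forallP H.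
apply/andP; split; apply/forallP => i.
  by have := H (lshift n i); rewrite !mxE.
by have := H (rshift n i); rewrite !mxE.
Qed.

Lemma coef_entry_continuous (p q : nat)
    (f : 'cV[R]_n -> 'cV[R]_n -> R -> 'M[R]_(p, q)) i j :
  coef_continuous f ->
  continuous (fun z : Z * R => f (usubmx z.1) (dsubmx z.1) z.2 i j).
Proof.
move=> cf z; apply: (@continuous_comp _ _ _
  (fun z : Z * R => (usubmx z.1, dsubmx z.1, z.2))
  (fun y : 'cV[R]_n * 'cV[R]_n * R => f y.1.1 y.1.2 y.2 i j)).
  exact: split_continuous.
apply: (@continuous_comp _ _ _
  (fun y : 'cV[R]_n * 'cV[R]_n * R => f y.1.1 y.1.2 y.2)
  (fun M : 'M[R]_(p, q) => M i j)); first exact: cf.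
exact: coord_continuous.
Qed.

Lemma space_entry_continuous i : continuous (fun p : Z * R => p.1 i ord0).
Proof.
move=> p; apply: (@continuous_comp _ _ _ fst (fun z : Z => z i ord0)).
  exact: cvg_fst.
exact: cV_entry_continuous.
Qed.

Variables (V : 'cV[R]_n -> R) (E : 'cV[R]_n -> 'cV[R]_n -> R -> 'cV[R]_n).
Variables (C Sigma : 'cV[R]_n -> 'cV[R]_n -> R -> 'M[R]_n).

Lemma sys_drift_continuous i : coef_continuous C -> coef_continuous E ->
  coef_continuous (fun x _ _ => grad V x) ->
  continuous (fun p : Z * R => sys_drift V E C p.1 p.2 i ord0).
Proof.
move=> cC cE cV; rewrite /sys_drift; case: (split_ordP i) => k ->.
  under eq_fun do rewrite col_mxEu mxE; exact: space_entry_continuous.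
pose F1 (p : Z * R) : R := \sum_j C (usubmx p.1) (dsubmx p.1) p.2 k j * dsubmx p.1 j ord0.
pose F2 (p : Z * R) : R := grad V (usubmx p.1) k ord0.
pose F3 (p : Z * R) : R := E (usubmx p.1) (dsubmx p.1) p.2 k ord0.
suff cF : continuous (fun p => - (F1 p + F2 p + F3 p)).
  rewrite (_ : (fun p : Z * R => col_mx _ _ _ _) = (fun p => - (F1 p + F2 p + F3 p)))//.
  by apply/funext => p; rewrite col_mxEd [LHS]mxE /F1 /F2 /F3; congr (- _); rewrite !mxE.
have c1 : continuous F1.
  apply: sum_continuous => j q.
  apply: (@continuousM _ _ (fun p : Z * R => C (usubmx p.1) (dsubmx p.1) p.2 k j)
    (fun p : Z * R => dsubmx p.1 j ord0)); first exact: coef_entry_continuous.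
  move: q; rewrite (_ : (fun p : Z * R => _) = fun p => p.1 (rshift n j) ord0).
    exact: space_entry_continuous.
  by apply/funext => q; rewrite mxE.
have c2 : continuous F2 by exact: (coef_entry_continuous cV).
have c3 : continuous F3 by exact: (coef_entry_continuous cE).
move=> p; apply: (@continuous_comp _ _ _ (fun p => F1 p + F2 p + F3 p) (@GRing.opp R)); last first.
  exact: opp_continuous.
apply: (@continuousD _ R _ (fun p => F1 p + F2 p) F3); last exact: c3.
by apply: (@continuousD _ R _ F1 F2); [exact: c1|exact: c2].
Qed.

Lemma sys_sigma_continuous i k : coef_continuous Sigma ->
  continuous (fun p : Z * R => sys_sigma Sigma p.1 p.2 i k).
Proof.
move=> cS; rewrite /sys_sigma; case: (split_ordP i) => l ->.
  by under eq_fun do rewrite col_mxEu mxE; exact: cst_continuous.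
by under eq_fun do rewrite col_mxEd; exact: coef_entry_continuous.
Qed.

Lemma sys_increment h (z : Z) s xi (eta := increment (sys_drift V E C) (sys_sigma Sigma) h z s xi) :
  usubmx eta = h *: dsubmx z.
Proof.
rewrite /eta /increment /sys_drift /sys_sigma mul_col_mx mul0mx.
by rewrite !scale_col_mx add_col_mx col_mxKu scaler0 addr0.
Qed.

Lemma sys_sigma_dd z s i : let S := Sigma (usubmx z) (dsubmx z) s in
  (sys_sigma Sigma z s *m (sys_sigma Sigma z s)^T) (rshift n i) (rshift n i) =
  (S *m S^T) i i.
Proof.
by rewrite /sys_sigma /= tr_col_mx mul_col_row block_mxEdr.
Qed.

Variables alpha c0 : R.

(** Kinetic plus potential energy is dissipated through [y] only. The cross term contributes
    [- alpha <x, grad V>] to the drift and so makes it coercive in [x] too; the constant is used to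
    make the whole nonnegative. *)
Definition energy (z : Z) : R :=
  2^-1 * dotv (dsubmx z) (dsubmx z) + V (usubmx z) + alpha * dotv (usubmx z) (dsubmx z) + c0.

Lemma euler_energy h z s : 0 <= h ->
  let x := usubmx z in let y := dsubmx z in
  let B := - (C x y s *m y + grad V x + E x y s) in
  euler (sys_drift V E C) (sys_sigma Sigma) h s energy z =
  2^-1 * (dotv y y + 2 * h * dotv y B + h ^+ 2 * dotv B B
          + h * \tr (Sigma x y s *m (Sigma x y s)^T))
  + V (x + h *: y) + alpha * dotv (x + h *: y) (y + h *: B) + c0.
Proof.
move=> h0 x y B; have SP := sign_mean_mean R n.
set b := sys_drift V E C; set sg := sys_sigma Sigma.
pose eta xi i := increment b sg h z s xi (rshift n i) ord0.
have m1 i : sign_mean (fun xi => eta xi i) = h * B i ord0.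
  by rewrite /eta sign_mean_increment /b /sys_drift col_mxEd.
have m2 i : sign_mean (fun xi => eta xi i * eta xi i) =
    h ^+ 2 * (B i ord0 * B i ord0) + h * (Sigma x y s *m (Sigma x y s)^T) i i.
  by rewrite /eta sign_mean_increment2// sys_sigma_dd /b /sys_drift col_mxEd.
pose x' := x + h *: y.
pose k0 := 2^-1 * dotv y y + V x' + alpha * dotv x' y + c0.
(* The new position [x'] does not depend on the signs, so the energy is a quadratic polynomial in
   the velocity increment [eta] and its first two moments suffice. *)
rewrite /euler (_ : (fun xi => _) = fun xi => \sum_i (2^-1 * (eta xi i * eta xi i)
   + (y i ord0 + alpha * x' i ord0) * eta xi i) + k0); last first.
  apply/funext => xi; rewrite /energy.
  have -> : usubmx (z + increment b sg h z s xi) = x'.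
    by rewrite linearD /= sys_increment.
  have dE i : dsubmx (z + increment b sg h z s xi) i ord0 = y i ord0 + eta xi i.
    by rewrite linearD [LHS]mxE; congr (_ + _); rewrite mxE.
  have -> : dotv (dsubmx (z + increment b sg h z s xi)) (dsubmx (z + increment b sg h z s xi)) =
     \sum_i (y i ord0 * y i ord0 + 2 * (y i ord0 * eta xi i) + eta xi i * eta xi i).
    by apply: eq_bigr => i _; rewrite dE; ring.
  have -> : dotv x' (dsubmx (z + increment b sg h z s xi)) =
     \sum_i (x' i ord0 * y i ord0 + x' i ord0 * eta xi i).
    by apply: eq_bigr => i _; rewrite dE mulrDr.
  have -> : \sum_i (2^-1 * (eta xi i * eta xi i) + (y i ord0 + alpha * x' i ord0) * eta xi i) =
     \sum_i (2^-1 * (eta xi i * eta xi i) + y i ord0 * eta xi i + alpha * (x' i ord0 * eta xi i)).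
    by apply: eq_bigr => i _; ring.
  by rewrite /k0 !big_split /= -!mulr_sumr -/(dotv y y) -/(dotv x' y); field.
rewrite (meanD SP) (mean_cst SP) (mean_sum SP).
under eq_bigr => i _ do rewrite (meanD SP) !(meanZ SP) m1 m2.
rewrite /k0 dotvDr dotvZr /mxtrace.
have -> : dotv y B = \sum_i y i ord0 * B i ord0 by [].
have -> : dotv B B = \sum_i B i ord0 * B i ord0 by [].
have -> : dotv x' B = \sum_i x' i ord0 * B i ord0 by [].
rewrite (_ : \sum_i _ = \sum_i (2^-1 * h ^+ 2 * (B i ord0 * B i ord0)
  + 2^-1 * h * (Sigma x y s *m (Sigma x y s)^T) i i + h * (y i ord0 * B i ord0)
  + alpha * h * (x' i ord0 * B i ord0))); last by apply: eq_bigr => i _; ring.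
by rewrite !big_split /= -!mulr_sumr; field.
Qed.

End SystemCoefficients.

(** * Superquadratic powers and growth of the potential *)

Section SuperquadraticGrowth.
Context (R : realType).

Lemma powR_monotone (p x y : R) : 0 <= p -> 0 <= x -> x <= y -> x `^ p <= y `^ p.
Proof.
move=> p0 x0 xy; have y0 := le_trans x0 xy.
by apply: (@ge0_ler_powR _ _ p0 x y); rewrite ?nnegrE.
Qed.

(** Beyond [r0], where [eta * b * r ^ eps] reaches [k], the power dominates; below [r0] the square
    is bounded by its value there. *)
Lemma square_le_power (b eps k eta : R) : 0 < b -> 0 < eps -> 0 <= k -> 0 < eta ->
  exists2 A, 0 <= A & forall r, 0 <= r -> k * r ^+ 2 <= eta * (b * r `^ (2 + eps)) + A.
Proof.
move=> b0 eps0 k0 eta0; pose r0 := (k / (eta * b)) `^ eps^-1.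
exists (k * r0 ^+ 2); first by rewrite mulr_ge0// sqr_ge0.
move=> r r0'; have [rr|rr] := leP r r0.
  rewrite ler_wpDl//; first by rewrite !mulr_ge0 ?powR_ge0// ltW.
  by rewrite ler_wpM2l// lerXn2r ?nnegrE ?powR_ge0.
rewrite ler_wpDr//; first by rewrite mulr_ge0// sqr_ge0.
have rp : 0 < r by exact: le_lt_trans (powR_ge0 _ _) rr.
rewrite powRD; last by rewrite (gt_eqF rp) implybT.
rewrite powR_mulrn//.
have H : k / (eta * b) <= r `^ eps.
  apply: (@le_trans _ _ (r0 `^ eps)).
    by rewrite /r0 -powRrM mulVf ?gt_eqF// powRr1// divr_ge0// mulr_ge0// ltW.
  by apply: powR_monotone; rewrite ?powR_ge0// ltW.
have eb : 0 < eta * b by rewrite mulr_gt0.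
move: H; rewrite ler_pdivrMr// => H.
have := ler_wpM2l (sqr_ge0 r) H; lra.
Qed.

Lemma power_half (p s r : R) : 0 <= p -> 2^-1 <= s -> 0 <= r ->
  2^-1 `^ p * r `^ p <= (s * r) `^ p.
Proof.
move=> p0 s2 r0; have s0 : 0 <= s by apply: le_trans s2; rewrite invr_ge0.
rewrite -powRM ?invr_ge0//; apply: powR_monotone; rewrite ?mulr_ge0 ?invr_ge0//.
by rewrite ler_wpM2r.
Qed.

End SuperquadraticGrowth.

Section Potential.
Context (R : realType) (n : nat) (V : 'cV[R]_n -> R).
Hypothesis V_C2 : C2 V.

Lemma derive_grad p v : derivable V p v /\ 'D_v V p = dotv v (grad V p).
Proof.
have [_ V1 _] := V_C2; have [dV ->] := derive_partials V1 p v; split=> //.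
by apply: eq_bigr => i _; rewrite mxE.
Qed.

Lemma potential_mvt q v (a : R) :
  exists2 c, `|c| <= `|a| & V (q + a *: v) - V q = a * dotv v (grad V (q + c *: v)).
Proof.
have [c ca H] := @mvt_line R _ V q v a (fun p => (derive_grad p v).1).
by exists c => //; rewrite H (derive_grad _ _).2.
Qed.

Variables b M eps : R.
Hypotheses (b0 : 0 < b) (M0 : 0 < M) (eps0 : 0 < eps).
Hypothesis V_lb : has_lbound (range V).
Hypothesis V_coercive : forall x, b * enorm x `^ (2 + eps) - M <= dotv x (grad V x).

(* The mean value theorem is applied on [3x/4, x], inside the ray from x/2. *)
Lemma potential_growth : exists A, forall x,
  4^-1 * 2^-1 `^ (2 + eps) * (b * enorm x `^ (2 + eps)) - A <= V x.
Proof.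
have [v0 Hv] := V_lb; exists (M / 2 - v0) => x.
have [c] := potential_mvt ((3 / 4) *: x) x (4^-1).
rewrite [`|4^-1|]ger0_norm ?invr_ge0// ler_norml => /andP[c1 c2].
rewrite -!scalerDl (_ : 3 / 4 + 4^-1 = 1 :> R); last by field.
rewrite scale1r; set s := 3 / 4 + c => H.
have s1 : 2^-1 <= s by rewrite /s; move: c1; lra.
have s0 : 0 < s by apply: lt_le_trans s1; rewrite invr_gt0.
have es : enorm (s *: x) = s * enorm x.
  by rewrite /enorm dotvZl dotvZr mulrA -expr2 sqrtrM ?sqr_ge0// sqrtr_sqr gtr0_norm.
have Hs := V_coercive (s *: x); rewrite es dotvZl in Hs.
have Hp := power_half (_ : 0 <= 2 + eps) s1 (enorm_ge0 x).
have {}Hp := Hp (addr_ge0 (ler0n _ 2) (ltW eps0)).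
have V0 : v0 <= V ((3 / 4) *: x) by apply: Hv; exists ((3 / 4) *: x).
set P := enorm x `^ (2 + eps) in Hp *; set p2 := 2^-1 `^ (2 + eps) in Hp *.
set Ps := (s * enorm x) `^ (2 + eps) in Hs Hp.
set D := dotv x _ in H Hs.
have sle : s <= 1 by rewrite /s; move: c2; lra.
have bP : b * (p2 * P) <= b * Ps by rewrite ler_pM2l.
have P0 : 0 <= b * (p2 * P) by rewrite !mulr_ge0 ?powR_ge0// ltW.
have sD : b * (p2 * P) - M <= s * D by move: bP Hs; lra.
(* Division by [s], which lies between 1/2 and 1, at most doubles the loss [M]; the sign of [D]
   decides which bound on [s] is used. *)
have HD : b * (p2 * P) - 2 * M <= D.
  have [D0|D0] := leP 0 D.
    have : s * D <= D by rewrite ler_piMl.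
    by move: sD M0; lra.
  have : s * D <= 2^-1 * D by rewrite ler_nM2r.
  by move: sD M0 P0; lra.
by move: HD H V0; lra.
Qed.

End Potential.

(** * Lyapunov estimates for the damped system *)

Section DampedSystem.
Context (R : realType) (n : nat).
Local Notation Z := ('cV[R]_(n + n)).
Variables (T : R) (V : 'cV[R]_n -> R) (E : 'cV[R]_n -> 'cV[R]_n -> R -> 'cV[R]_n).
Variables (C Sigma : 'cV[R]_n -> 'cV[R]_n -> R -> 'M[R]_n).
Variables (alpha beta b M eps c M1 : R).
Hypotheses (alpha0 : 0 < alpha) (beta0 : 0 < beta) (b0 : 0 < b) (M0 : 0 < M).
Hypotheses (eps0 : 0 < eps) (c0 : 0 < c) (c1 : c < 1).
Hypotheses (V_C2 : C2 V) (V_lb : has_lbound (range V)).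
Hypothesis C_coercive : forall x y t, loewner_le (2 * alpha)%:M (sympart (C x y t)).
Hypothesis CE_bounded : forall x y t,
  Num.max (opnorm (C x y t)) (enorm (E x y t)) <= beta.
Hypothesis V_coercive : forall x,
  b * enorm x `^ (2 + eps) - M <= dotv x (grad V x).
Hypothesis S_growth : forall x y t,
  \tr (Sigma x y t *m (Sigma x y t)^T)
  <= c * alpha * (enorm y ^+ 2 + b * enorm x `^ (2 + eps)) + M1.

Let Q (x : 'cV[R]_n) := b * enorm x `^ (2 + eps).
Let force x y t := - (C x y t *m y + grad V x + E x y t).

Let split_norm (z : Z) rho : `|z| <= rho -> `|usubmx z| <= rho /\ `|dsubmx z| <= rho.
Proof.
move=> zr; have rho0 := le_trans (normr_ge0 z) zr; split; rewrite cV_norm_le//;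
  by apply/forallP => i; rewrite mxE (le_trans (cV_entry_le _ _)).
Qed.

Let Q_ge0 x : 0 <= Q x.
Proof. by rewrite mulr_ge0 ?powR_ge0// ltW. Qed.

Let E_le x y t : enorm (E x y t) <= beta.
Proof. by have := CE_bounded x y t; rewrite ge_max => /andP[]. Qed.

Let Cy_le x y t v : enorm (C x y t *m v) <= beta * enorm v.
Proof.
apply: le_trans (enorm_mulmx _ _) _; rewrite ler_wpM2r ?enorm_ge0//.
by have := CE_bounded x y t; rewrite ge_max => /andP[].
Qed.

(** The left side is the generator applied to the energy. The terms [<y, grad V>] cancel; damping
    gives [- 2 alpha |y|^2], the cross term gives back [alpha |y|^2] and yields [- alpha Q]. Since
    [c < 1], the trace uses at most half of the resulting [alpha (|y|^2 + Q)]. The terms in [C] and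
    [E] use [alpha / 4] of [|y|^2], and their squares of [|x|] use [alpha / 4] of [Q]. *)
Lemma energy_drift : exists a0, forall x y t,
  2^-1 * \tr (Sigma x y t *m (Sigma x y t)^T) + dotv y (force x y t)
  + dotv y (grad V x) + alpha * (dotv y y + dotv x (force x y t))
  <= a0 - alpha / 4 * (dotv y y + Q x).
Proof.
(* The coefficient of [|x|^2] produced by Young's inequality: [2 alpha beta^2] from [I2] and [alpha]
   from [I3]. *)
pose k := 2 * alpha * beta ^+ 2 + alpha.
have k0 : 0 <= k by rewrite addr_ge0 ?mulr_ge0 ?sqr_ge0// ltW.
have [A A0 HA] := square_le_power b0 eps0 k0 (divr_gt0 alpha0 (ltr0n _ 4) : 0 < alpha / 4).
exists (M1 / 2 + 2 * beta ^+ 2 / alpha + alpha * beta ^+ 2 + alpha * M + A) => x y t.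
rewrite /force !dotvNr !dotvDr -!enorm_sqr.
have tS := S_growth x y t; rewrite -/(Q x) in tS.
have vC := V_coercive x; rewrite -/(Q x) in vC.
have yC := loewner_dotv y (C_coercive x y t); rewrite -enorm_sqr in yC.
have xC := le_trans (dotv_ge_enorm x (C x y t *m y)) (lexx _).
have HC := Cy_le x y t y; have HE := E_le x y t.
have yE := dotv_ge_enorm y (E x y t).
have xE := dotv_ge_enorm x (E x y t).
have x0 := enorm_ge0 x; have y0 := enorm_ge0 y.
have xC1 : enorm x * enorm (C x y t *m y) <= enorm x * (beta * enorm y) by rewrite ler_wpM2l.
have yE1 : enorm y * enorm (E x y t) <= enorm y * beta by rewrite ler_wpM2l.
have xE1 : enorm x * enorm (E x y t) <= enorm x * beta by rewrite ler_wpM2l.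
have HAx := HA _ x0; rewrite -/(Q x) in HAx.
have Qx := Q_ge0 x.
move: tS vC yC xC yE xE xC1 yE1 xE1 HAx Qx.
set tr := \tr _; set yCy := dotv y (C x y t *m y); set xCy := dotv x (C x y t *m y).
set eC := enorm (C x y t *m y); set eE := enorm (E x y t).
set yG := dotv y (grad V x); set xG := dotv x (grad V x).
set yEE := dotv y (E x y t); set xEE := dotv x (E x y t).
set ry := enorm y in y0 *; set rx := enorm x in x0 *; set q := Q x.
move=> tS vC yC xC yE xE xC1 yE1 xE1 HAx Qx.
have yE2 : - (ry * beta) <= yEE by lra.
have I1 : ry * beta <= alpha / 8 * ry ^+ 2 + 2 * beta ^+ 2 / alpha.
  have -> : alpha / 8 * ry ^+ 2 + 2 * beta ^+ 2 / alpha =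
    ry * beta + (alpha * ry - 4 * beta) ^+ 2 / (8 * alpha) by field; rewrite gt_eqF.
  by rewrite lerDl divr_ge0 ?sqr_ge0// mulr_ge0// ltW.
have I2 : alpha * (rx * (beta * ry)) <= alpha / 8 * ry ^+ 2 + 2 * alpha * beta ^+ 2 * rx ^+ 2.
  have -> : alpha / 8 * ry ^+ 2 + 2 * alpha * beta ^+ 2 * rx ^+ 2 =
    alpha * (rx * (beta * ry)) + alpha / 8 * (ry - 4 * beta * rx) ^+ 2 by field.
  by rewrite lerDl mulr_ge0 ?sqr_ge0// divr_ge0// ltW.
have I3 : alpha * (rx * beta) <= alpha * beta ^+ 2 + alpha * rx ^+ 2.
  rewrite -mulrDr ler_pM2l//; have := sqr_ge0 (rx - beta); have := sqr_ge0 rx.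
  have := sqr_ge0 beta; rewrite sqrrB; lra.
have I4 : alpha * (- (rx * (beta * ry))) <= alpha * xCy by rewrite ler_pM2l//; lra.
have I5 : alpha * (- (rx * beta)) <= alpha * xEE by rewrite ler_pM2l//; lra.
have I6 : alpha * (q - M) <= alpha * xG by rewrite ler_pM2l.
have I7 : c * alpha * (ry ^+ 2 + q) <= alpha * (ry ^+ 2 + q).
  by rewrite ler_wpM2r ?addr_ge0 ?sqr_ge0// ler_piMl ?ltW.
move: HAx; rewrite /k; lra.
Qed.

(** Completing a square gives [alpha <x, y> >= - |y|^2 / 4 - alpha^2 |x|^2], and the superquadratic
    growth of [V] absorbs the last term. *)
Lemma energy_coercive : exists k0 delta, [/\ 0 < delta, delta <= alpha / 4 &
  forall z : Z, delta * (dotv (dsubmx z) (dsubmx z) + Q (usubmx z)) <= energy V alpha k0 z].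
Proof.
have [A HA] := potential_growth V_C2 b0 M0 eps0 V_lb V_coercive.
pose kappa : R := 4^-1 * 2^-1 `^ (2 + eps).
have kappa0 : 0 < kappa by rewrite mulr_gt0 ?invr_gt0// powR_gt0 ?invr_gt0.
have [A' A'0 HA'] := square_le_power b0 eps0 (sqr_ge0 alpha)
  (divr_gt0 kappa0 (ltr0n _ 2) : 0 < kappa / 2).
(* The bounds on [delta]: the dissipation rate of [energy_drift], what the cross term leaves of the
   kinetic energy, and what it leaves of the growth of [V]. *)
exists (A + A'), (Num.min (alpha / 4) (Num.min 4^-1 (kappa / 2))); split.
- by rewrite !lt_min invr_gt0 ltr0n (divr_gt0 alpha0 (ltr0n _ 4)) (divr_gt0 kappa0 (ltr0n _ 2)).
- by rewrite ge_min lexx.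
move=> z; rewrite /energy; set x := usubmx z; set y := dsubmx z; set delta := Num.min _ _.
have d1 : delta <= 4^-1 by rewrite /delta !ge_min lexx !orbT.
have d2 : delta <= kappa / 2 by rewrite /delta !ge_min lexx !orbT.
have Hx := HA x; rewrite -/(Q x) -/kappa in Hx.
have Hx' := HA' _ (enorm_ge0 x); rewrite -/(Q x) enorm_sqr in Hx'.
have : delta * dotv y y <= 4^-1 * dotv y y by rewrite ler_wpM2r ?dotv_ge0.
have : delta * Q x <= kappa / 2 * Q x by rewrite ler_wpM2r.
have := dotv_ge0 (2^-1 *: y + alpha *: x).
rewrite dotvDr !dotvDl !dotvZl !dotvZr (dotvC y x).
by move: Hx Hx'; lra.
Qed.

(** This is the coefficient of [h ^+ 2] in the energy after one Euler step; a bound on each ball,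
    uniform in time, lets a small step absorb it. *)
Lemma force_bounded (rho : R) : exists K, forall x y t, `|x| <= rho -> `|y| <= rho ->
  2^-1 * dotv (force x y t) (force x y t) + alpha * dotv y (force x y t) <= K.
Proof.
have cG : continuous (fun x : 'cV[R]_n => dotv (grad V x) (grad V x)).
  rewrite /dotv; apply: sum_continuous => i x.
  have [_ V1 _] := V_C2; have [_ cV] := V1 i.
  under eq_fun do rewrite !mxE.
  by apply: (@continuousM _ _ ('D_(basisv R i) V) ('D_(basisv R i) V)); exact: cV.
have [G G0 HG] := compact_bounded_fun (@cV_closed_ball_compact R n rho) cG.
pose Y := n%:R * rho ^+ 2; pose F := 3 * (beta ^+ 2 * Y + G + beta ^+ 2).
exists (2^-1 * F + alpha * (2^-1 * (Y + F))) => x y t xr yr.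
have YY := enorm_sub_norm yr; rewrite -/Y in YY.
have GG : dotv (grad V x) (grad V x) <= G by apply: le_trans (ler_norm _) _; exact: HG.
have CC : dotv (C x y t *m y) (C x y t *m y) <= beta ^+ 2 * Y.
  rewrite -enorm_sqr; apply: le_trans (_ : (beta * enorm y) ^+ 2 <= _).
    by rewrite lerXn2r ?nnegrE ?mulr_ge0 ?enorm_ge0// ltW.
  by rewrite exprMn enorm_sqr ler_wpM2l ?sqr_ge0.
have EE : dotv (E x y t) (E x y t) <= beta ^+ 2.
  by rewrite -enorm_sqr lerXn2r ?nnegrE ?enorm_ge0// ltW.
have FF : dotv (force x y t) (force x y t) <= F.
  rewrite /force dotvNr dotvC dotvNr opprK.
  have := dotv_ge0 (C x y t *m y - grad V x).
  have := dotv_ge0 (C x y t *m y - E x y t).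
  have := dotv_ge0 (grad V x - E x y t).
  rewrite !dotvBr ![dotv (_ - _) _]dotvC !dotvBr !dotvDr !dotvDl.
  rewrite (dotvC (grad V x) (C x y t *m y)) (dotvC (E x y t) (C x y t *m y)).
  rewrite (dotvC (E x y t) (grad V x)) /F.
  by move: GG CC EE; lra.
have yF : dotv y (force x y t) <= 2^-1 * (Y + F).
  have := dotv_ge0 (y - force x y t).
  rewrite !dotvBr ![dotv (_ - _) _]dotvC !dotvBr (dotvC (force x y t) y).
  by move: YY FF; lra.
by rewrite lerD ?ler_pM2l// ?invr_gt0.
Qed.

(** Controls the increment of [V] over the step [h y]: by the mean value theorem it is governed by
    the gradient at a nearby point, which may be replaced by [x] at a cost of 1. *)
Lemma gradient_modulus (rho : R) : exists2 d, 0 < d & forall (x y : 'cV[R]_n) (a : R),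
  `|x| <= rho -> `|y| <= rho -> `|a| < d ->
  dotv y (grad V (x + a *: y)) <= dotv y (grad V x) + 1.
Proof.
pose f (p : Z * R) := dotv (dsubmx p.1) (grad V (usubmx p.1 + p.2 *: dsubmx p.1)).
have cf : continuous f.
  rewrite /f /dotv; apply: sum_continuous => i p.
  have [_ V1 _] := V_C2; have [_ cV] := V1 i.
  have cy j : continuous (fun p : Z * R => dsubmx p.1 j ord0).
    rewrite (_ : (fun p => _) = fun p : Z * R => p.1 (rshift n j) ord0).
      exact: space_entry_continuous.
    by apply/funext => q; rewrite mxE.
  apply: (@continuousM _ _ (fun p : Z * R => dsubmx p.1 i ord0)
    (fun p : Z * R => grad V (usubmx p.1 + p.2 *: dsubmx p.1) i ord0)); first exact: cy.
  rewrite (_ : (fun p : Z * R => grad V _ _ _) =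
    (fun p : Z * R => 'D_(basisv R i) V (usubmx p.1 + p.2 *: dsubmx p.1))); last first.
    by apply/funext => q; rewrite mxE.
  apply: (@continuous_comp _ _ _ (fun p : Z * R => usubmx p.1 + p.2 *: dsubmx p.1)
    ('D_(basisv R i) V)); last exact: cV.
  have cs := @split_continuous R n p.
  apply: (@continuousD _ _ _ (fun p : Z * R => usubmx p.1) (fun p : Z * R => p.2 *: dsubmx p.1)).
    apply: (@continuous_comp _ _ _ (fun p : Z * R => (usubmx p.1, dsubmx p.1, p.2))
      (fun q => q.1.1)); first exact: cs.
    by apply: continuous_comp; exact: cvg_fst.
  apply: (@continuous_comp _ _ _ (fun p : Z * R => (usubmx p.1, dsubmx p.1, p.2))
    (fun q => q.2 *: q.1.2)); first exact: cs.
  apply: (@continuousZ _ _ _ (fun q : 'cV[R]_n * 'cV[R]_n * R => q.2) (fun q => q.1.2)).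
    exact: cvg_snd.
  by apply: continuous_comp; [exact: cvg_fst|exact: cvg_snd].
(* The last coordinate carries the step length; base points have length 0, and the perturbed point
   may leave the compact set. *)
have [d d0 H] := compact_unif_cont (@spacetime_box_compact R (n + n) `|rho| 0) cf ltr01.
exists d => // x y a xr yr ad.
have := H (col_mx x y, 0) (col_mx x y, a).
rewrite /f /= !col_mxKu !col_mxKd scale0r addr0 => {}H.
suff : `|dotv y (grad V x) - dotv y (grad V (x + a *: y))| < 1.
  by rewrite ltr_norml => /andP[] + _; lra.
apply: H.
  split; last by rewrite normr0.
  rewrite cV_norm_le//; apply/forallP => i; apply: le_trans (ler_norm rho).
  case: (split_ordP i) => k ->; rewrite ?col_mxEu ?col_mxEd; apply: le_trans (cV_entry_le _ _) _;
    by [exact: xr|exact: yr].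
by rewrite prod_normE /= subrr normr0 sub0r normrN gt_max d0.
Qed.

Hypotheses (T0 : 0 < T) (perC : coef_periodic T C) (perE : coef_periodic T E).
Hypotheses (perS : coef_periodic T Sigma).
Hypotheses (cC : coef_continuous C) (cE : coef_continuous E) (cS : coef_continuous Sigma).
Hypothesis cG : coef_continuous (fun x _ _ => grad V x).

Theorem damped_system_solution : exists mu,
  periodic_probability_solution (sys_drift V E C) (sys_sigma Sigma) T mu.
Proof.
have [a0 Ha0] := energy_drift.
have [k0 [delta [delta0 delta_alpha Hdelta]]] := energy_coercive.
pose W (z : Z) := delta * (dotv (dsubmx z) (dsubmx z) + Q (usubmx z)).
pose U := energy V alpha k0.
(* One unit pays for the increment of [V], one for the [h ^+ 2] remainder; the comparison with [U 0]
   serves the restart at the origin. *)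
pose a := Num.max (a0 + 2) (U 0).
apply: (@lyapunov_periodic_solution _ _ _ _ _ _ _ T _ _ _ U W a) => //.
- by move=> i; exact: sys_drift_continuous.
- by move=> i k; exact: sys_sigma_continuous.
- by move=> z t; rewrite /sys_drift perC perE.
- by move=> z t; rewrite /sys_sigma perS.
- by move=> z; rewrite mulr_ge0 ?(ltW delta0)// addr_ge0 ?dotv_ge0.
- by rewrite /a le_max lexx orbT.
- move=> rho; have [V0 _ _] := V_C2.
  have [B B0 HB] := compact_bounded_fun (@cV_closed_ball_compact R n rho) V0.
  exists (2^-1 * (n%:R * rho ^+ 2) + B + alpha * (n%:R * rho ^+ 2) + k0) => z /split_norm[xr yr].
  have := enorm_sub_norm xr; have := enorm_sub_norm yr.
  have := le_trans (ler_norm _) (HB _ xr).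
  rewrite /U /energy; set x := usubmx z; set y := dsubmx z => Vx Y X.
  have : alpha * dotv x y <= alpha * (n%:R * rho ^+ 2).
    rewrite ler_pM2l//; have := dotv_ge0 (x - y).
    rewrite dotvBr ![dotv (_ - _) _]dotvC !dotvBr (dotvC y x); move: X Y; lra.
  by move: Vx X Y; lra.
- move=> w; have [A A0 HA] := square_le_power b0 eps0 ler01 ltr01.
  (* As [rho >= 1], a square bounded by [rho] is bounded by [rho ^+ 2], which avoids a square
     root. *)
  pose rho := 1 + `|w / delta| + A; exists rho => z.
  rewrite /W mulrC -ler_pdivlMr// => Hw.
  have rho1 : 1 <= rho by rewrite /rho -addrA lerDl addr_ge0.
  have rho0 : 0 <= rho by apply: le_trans rho1.
  have sq (r : R) : r ^+ 2 <= `|w / delta| + A -> `|r| <= rho.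
    move=> rw; rewrite -(@ler_pXn2r _ 2)// ?nnegrE// real_normK ?num_real//.
    apply: le_trans rw _; apply: (@le_trans _ _ rho); first by rewrite /rho -addrA lerDr.
    by rewrite expr2 ler_peMl.
  have Hw' := le_trans Hw (ler_norm _).
  rewrite cV_norm_le//; apply/forallP => i; apply: sq.
  have X := HA _ (enorm_ge0 (usubmx z)); rewrite !mul1r -/(Q _) enorm_sqr in X.
  have Y := dotv_ge0 (dsubmx z); have Qx := Q_ge0 (usubmx z).
  case: (split_ordP i) => k ->.
    have := entry_sqr_le (usubmx z) k; rewrite mxE; move: X Y Qx Hw'; lra.
  have := entry_sqr_le (dsubmx z) k; rewrite mxE; move: X Y Qx Hw'; lra.
- move=> rho; have [K HK] := force_bounded rho; have [d d0 Hd] := gradient_modulus rho.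
  have K1 : 0 < `|K| + 1 by rewrite ltr_wpDl.
  (* The first bound keeps the intermediate point within reach of [gradient_modulus]; the second
     makes the [h ^+ 2] remainder at most [h]. *)
  exists (Num.min (d / 2) (`|K| + 1)^-1); first by rewrite lt_min divr_gt0//= invr_gt0.
  move=> h z s; rewrite le_min => /andP[h0 /andP[hd hK]] /split_norm[xr yr].
  rewrite /U euler_energy ?(ltW h0)//.
  have Hx := Ha0 (usubmx z) (dsubmx z) s; have HKx := HK _ _ s xr yr.
  move: Hx HKx; rewrite /force /energy.
  set x := usubmx z in xr *; set y := dsubmx z in yr *.
  set B := - (_ + _) => Hx HKx.
  have [e eh He] := potential_mvt V_C2 x y h.
  have ed : `|e| < d.
    by apply: le_lt_trans eh _; rewrite gtr0_norm//; move: hd d0; lra.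
  have HV := Hd x y e xr yr ed.
  have hV : V (x + h *: y) <= V x + h * (dotv y (grad V x) + 1).
    by rewrite -lerBlDl He ler_pM2l.
  have hh : h ^+ 2 * (2^-1 * dotv B B + alpha * dotv y B) <= h.
    rewrite expr2 -mulrA ler_piMr ?(ltW h0)//; apply: (@le_trans _ _ (h * (`|K| + 1))).
      rewrite ler_pM2l//; apply: le_trans HKx _; have := ler_norm K; lra.
    by rewrite -ler_pdivlMr// div1r.
  have Wz : W z <= alpha / 4 * (dotv y y + Q x).
    by rewrite /W ler_wpM2r// addr_ge0// dotv_ge0.
  have aE : a0 + 2 <= a by rewrite /a le_max lexx.
  have hW : h * (a0 - alpha / 4 * (dotv y y + Q x) + 2) <= h * (a - W z).
    by rewrite ler_pM2l//; move: Wz aE; lra.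
  have {}Hx := ler_wpM2l (ltW h0) Hx.
  rewrite !dotvDr !dotvDl !dotvZl !dotvZr.
  by move: Hx hW hh hV; lra.
Qed.

End DampedSystem.

Theorem theorem1p4 (R : realType) (n : nat) (hn : (1 <= n)%N)
    (T : R) (hT : 0 < T)
    (V : 'cV[R]_n -> R)
    (E : 'cV[R]_n -> 'cV[R]_n -> R -> 'cV[R]_n)
    (C Sigma : 'cV[R]_n -> 'cV[R]_n -> R -> 'M[R]_n)
    (alpha beta b M eps c M1 : R)
    (halpha : 0 < alpha) (hbeta : 0 < beta) (hb : 0 < b) (hM : 0 < M)
    (heps : 0 < eps) (hc : 0 < c) (hM1 : 0 < M1) (hc1 : c < 1)
    (regC : coef_regular C) (regE : coef_regular E) (regS : coef_regular Sigma)
    (regV : coef_regular (fun x _ _ => grad V x))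
    (V_C2 : C2 V) (V_lb : has_lbound (range V))
    (perC : coef_periodic T C) (perE : coef_periodic T E)
    (perS : coef_periodic T Sigma)
    (C_coercive : forall x y t,
       loewner_le (2 * alpha)%:M (sympart (C x y t)))
    (CE_bounded : forall x y t,
       Num.max (opnorm (C x y t)) (enorm (E x y t)) <= beta)
    (V_coercive : forall x,
       b * enorm x `^ (2 + eps) - M <= dotv x (grad V x))
    (S_growth : forall x y t,
       \tr (Sigma x y t *m (Sigma x y t)^T)
       <= c * alpha * (enorm y ^+ 2 + b * enorm x `^ (2 + eps)) + M1) :
  exists mu : {measure set (spacetime R (n + n)) -> \bar R},
    periodic_probability_solution (sys_drift V E C) (sys_sigma Sigma) T mu.
Proof.
apply: (@damped_system_solution R n T V E C Sigma alpha beta b M eps c M1) => //.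
- exact: regC.1.
- exact: regE.1.
- exact: regS.1.
- exact: regV.1.
Qed.
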